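(* The generating function $B(z)=\sum_{n\ge0}|\mathcal{P}_n(312)|z^n$ for $312$-avoiding set partitions is a root of the cubic polynomial in $B$ $$(z-1)(5z^2-2z+1)^2B^3+(-9z^5+54z^4-85z^3+59z^2-14z+3)B^2+(-9z^4+60z^3-64z^2+13z-3)B+(-9z^3+23z^2-4z+1).$$ Moreover $|\mathcal{P}_n(312)|\sim\delta\,n^{-5/2}\rho^n$, where $$\rho=\frac{3(9+6\sqrt3)^{1/3}}{3+2(9+6\sqrt3)^{1/3}-(9+6\sqrt3)^{2/3}}\approx 6.97685$$ and $\delta\approx 0.061518$.
   Context: $\mathcal{P}_n$ is the set of set partitions of $[n]$. A partition is represented by arcs: for each block $\{i_1<i_2<\dots<i_a\}$ draw arcs $(i_1,i_2),(i_2,i_3),\dots,(i_{a-1},i_a)$. A partition avoids $\tau\in S_k$ if there are no $i_1<\dots<i_{2k}$ such that all arcs $(i_a,i_{2k+1-\tau(a)})$, $1\le a\le k$, are present. $\mathcal{P}_n(\tau)$ is the set of $\tau$-avoiding partitions of $[n]$.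
   Formalization: The value δ ≈ 0.061518 is stated only as |δ − 0.061518| ≤ 5·10⁻⁵, because the last printed digits are wrong: the true constant is δ ≈ 0.061486. *)

(* Defs.v *)
From HB Require Import structures.
From mathcomp Require Import all_boot all_order all_algebra all_fingroup.
From mathcomp Require Import all_classical all_reals all_analysis.

Set Implicit Arguments.
Unset Strict Implicit.
Unset Printing Implicit Defensive.

Import Order.TTheory GRing.Theory Num.Theory.
Import numFieldNormedType.Exports.

Local Open Scope ring_scope.

Section Partitions.
Variable n : nat.
Implicit Types (P : {set {set 'I_n}}) (i j l : 'I_n).

Definition is_arc P i j : bool :=
  (i < j)%N &&
  [exists B in P,
    [&& i \in B, j \in B & [forall l in B, ~~ ((i < l)%N && (l < j)%N)]]].

(* With 0-based positions, the 1-based index a is the ordinal of value a - 1,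
   so that rev_ord (lshift k (tau a)) : 'I_(k + k) is the 1-based index
   2k + 1 - tau(a). *)
Definition contains_pattern k (tau : 'S_k) P : bool :=
  [exists i : {ffun 'I_(k + k) -> 'I_n},
    [forall a : 'I_(k + k), forall b : 'I_(k + k), (a < b)%N ==> (i a < i b)%N] &&
    [forall a : 'I_k, is_arc P (i (lshift k a)) (i (rev_ord (lshift k (tau a))))]].

End Partitions.

Definition avoiding_partitions n k (tau : 'S_k) : {set {set {set 'I_n}}} :=
  [set P : {set {set 'I_n}} | finset.partition P [set: 'I_n]
                              & ~~ contains_pattern tau P].

(* One-line notation, with the values shifted to be 0-based. *)
Definition oneline312 : 'I_3 -> 'I_3 :=
  tnth [tuple inord 2; inord 0; inord 1].

Lemma oneline312_inj : injective oneline312.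
Proof.
have val_oneline i : \val (oneline312 i) = nth 0%N [:: 2; 0; 1]%N i.
  rewrite /oneline312 (tnth_nth ord0) /=.
  by case: i => [[|[|[|i]]] Hi] //=; rewrite inordK.
move=> i j /(congr1 val); rewrite !val_oneline => eq_ij; apply: val_inj.
by case: i j eq_ij => [[|[|[|i]]] Hi] [[|[|[|j]]] Hj].
Qed.

Definition perm312 : 'S_3 := perm oneline312_inj.

(* The ring of formal power series, as a synonym of nat -> R (whose own ring
   structure in the library is the pointwise one). *)
Definition fps (R : Type) : Type := nat -> R.

HB.instance Definition _ (R : Type) := gen_eqMixin (fps R).
HB.instance Definition _ (R : Type) := gen_choiceMixin (fps R).

Section PowerSeries.
Variable R : comNzRingType.
Implicit Types (f g h : fps R) (p q : {poly R}).

Definition fps_of_poly p : fps R := fun n => p`_n.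
Definition fps_add f g : fps R := fun n => f n + g n.
Definition fps_opp f : fps R := fun n => - f n.
Definition fps_mul f g : fps R := fun n => \sum_(i < n.+1) f i * g (n - i)%N.

Lemma fps_addA : associative fps_add.
Proof. by move=> f g h; apply/funext => n; rewrite /fps_add addrA. Qed.

Lemma fps_addC : commutative fps_add.
Proof. by move=> f g; apply/funext => n; rewrite /fps_add addrC. Qed.

Lemma fps_add0 : left_id (fps_of_poly 0) fps_add.
Proof.
by move=> f; apply/funext => n; rewrite /fps_add /fps_of_poly coef0 add0r.
Qed.

Lemma fps_addN : left_inverse (fps_of_poly 0) fps_opp fps_add.
Proof.
by move=> f; apply/funext => n; rewrite /fps_add /fps_of_poly coef0 addNr.
Qed.

HB.instance Definition _ := GRing.isZmodule.Build (fps R)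
  fps_addA fps_addC fps_add0 fps_addN.

Definition fps_trunc N f : {poly R} := \poly_(i < N) f i.

Lemma fps_mul_trunc N f g n : (n < N)%N ->
  fps_mul f g n = (fps_trunc N f * fps_trunc N g)`_n.
Proof.
move=> ltnN; rewrite coefM; apply: eq_bigr => -[i /= ltin] _.
by rewrite !coef_poly (leq_ltn_trans _ ltnN) // (leq_ltn_trans (leq_subr _ _)).
Qed.

Lemma fps_mul_poly p q : fps_mul (fps_of_poly p) (fps_of_poly q) =
  fps_of_poly (p * q).
Proof. by apply/funext => n; rewrite /fps_of_poly coefM. Qed.

Lemma fps_mulC : commutative fps_mul.
Proof.
by move=> f g; apply/funext => n; rewrite !(@fps_mul_trunc n.+1) // mulrC.
Qed.

Lemma fps_mulA : associative fps_mul.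
Proof.
move=> f g h; apply/funext => n.
transitivity ((fps_trunc n.+1 f * (fps_trunc n.+1 g * fps_trunc n.+1 h))`_n).
  rewrite coefM; apply: eq_bigr => -[i /= ltin] _.
  by rewrite coef_poly ltin -fps_mul_trunc // ltnS leq_subr.
rewrite mulrA coefM; apply: eq_bigr => -[i /= ltin] _.
by rewrite -fps_mul_trunc // coef_poly ltnS leq_subr.
Qed.

Lemma fps_mul1 : left_id (fps_of_poly 1) fps_mul.
Proof.
move=> f; apply/funext => n.
rewrite /fps_mul big_ord_recl big1 => [|i _].
  by rewrite /fps_of_poly coef1 mul1r subn0 addr0.
by rewrite /fps_of_poly coef1 mul0r.
Qed.

Lemma fps_mulDl : left_distributive fps_mul fps_add.
Proof.
move=> f g h; apply/funext => n; rewrite /fps_mul /fps_add -big_split.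
by apply: eq_bigr => i _; rewrite mulrDl.
Qed.

Lemma fps_1neq0 : fps_of_poly 1 != fps_of_poly 0.
Proof.
by apply/eqP => /(congr1 (@^~ 0%N)) /eqP; rewrite /fps_of_poly !coefE oner_eq0.
Qed.

HB.instance Definition _ := GRing.Zmodule_isComNzRing.Build (fps R)
  fps_mulA fps_mulC fps_mul1 fps_mulDl fps_1neq0.

Lemma fps_of_poly_is_zmod_morphism : zmod_morphism fps_of_poly.
Proof. by move=> p q; apply/funext => n; rewrite /fps_of_poly coefB. Qed.

Lemma fps_of_poly_is_monoid_morphism : monoid_morphism fps_of_poly.
Proof. by split=> // p q; rewrite -fps_mul_poly. Qed.

HB.instance Definition _ := GRing.isZmodMorphism.Build {poly R} (fps R)
  fps_of_poly fps_of_poly_is_zmod_morphism.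
HB.instance Definition _ := GRing.isMonoidMorphism.Build {poly R} (fps R)
  fps_of_poly fps_of_poly_is_monoid_morphism.

End PowerSeries.

Definition genfun312 : fps int :=
  fun n => #|avoiding_partitions n perm312|%:Z.

(* The outer variable is B, the inner one is z. *)
Definition cubic312 : {poly {poly int}} :=
  let z : {poly int} := 'X in
  let B : {poly {poly int}} := 'X in
    ((z - 1) * (5 * z ^+ 2 - 2 * z + 1) ^+ 2)%:P * B ^+ 3
  + (- 9 * z ^+ 5 + 54 * z ^+ 4 - 85 * z ^+ 3 + 59 * z ^+ 2 - 14 * z + 3)%:P
      * B ^+ 2
  + (- 9 * z ^+ 4 + 60 * z ^+ 3 - 64 * z ^+ 2 + 13 * z - 3)%:P * B
  + (- 9 * z ^+ 3 + 23 * z ^+ 2 - 4 * z + 1)%:P.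

Definition growth312 (R : realType) : R :=
  let c : R := 9 + 6 * Num.sqrt 3 in
  3 * c `^ (1 / 3) / (3 + 2 * c `^ (1 / 3) - c `^ (2 / 3)).

(* Main.v *)
(** Read a partition from left to right, recording for each vertex what it
    closes and whether it opens.  An open vertex [b] must not be closed as long
    as some open [a < b] is covered, together with [b], by an arc.  Hence the
    open vertices form a stack of chains, each
    consisting of one closable vertex and the vertices above that wait for it,
    and the possible continuations depend on the chain lengths only: opening
    pushes a chain of length 1, and closing merges the chains down to the one
    of the closed vertex into a single chain, shortened by one.

    The generating function of the words with a given stack is a product over
    its chains.  The factors are the coefficients in [u] of a series [L(z, u)]
    that satisfies a quadratic functional equation, and the kernel method gives
    [z = U / ((1 + 2U)(1 + U + U^2))] and
    [B = (1 + U + U^3)(1 + U + U^2) / ((1 + U)(1 + U^2)^2)],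
    from which the cubic follows by elimination.

    The parametrization of [z] has a critical point at the root [tau] of
    [4 tau^3 + 3 tau^2 = 1].  After scaling by the radius of convergence, [U]
    lies in the ring of the series [f] in [l^1] such that
    [f' = (1 - x)^(-1/2) g] with [g] in [l^1].  For these series the
    coefficients of [(1 - x)^(-1/2) f] are asymptotic to [f(1)] times those of
    [(1 - x)^(-1/2)], by an elementary recurrence; this replaces analytic
    continuation.  The second derivative of [B] is [(1 - x)^(-1/2)] times a
    series of the ring, and Wallis' product gives the exponent [-5/2] and the
    constant. *)
From HB Require Import structures.
Require Import Defs.
From mathcomp Require Import all_boot all_order all_algebra all_fingroup.
From mathcomp Require Import all_classical all_reals all_analysis.
From mathcomp Require Import zify ring lra.

Set Implicit Arguments.
Unset Strict Implicit.
Unset Printing Implicit Defensive.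

Import Order.TTheory GRing.Theory Num.Theory.
Import numFieldNormedType.Exports.
Local Open Scope ring_scope.

(** * Partitions as words *)

(** In a complete word an open [a] is closed beyond the present vertex, so closing some [b > a] now
    fixes the order in which the two are closed; this makes avoidance a condition on each single
    closing.

    The functional equation is quadratic in [L] and also contains the unknown [L(z, 0)]. The kernel
    method is therefore applied to its derivative in [u]: [U] annihilates the coefficient of the
    derivative of [L], which leaves three algebraic equations for [U], [L(z, U)] and [L(z, 0)].

    The derivative of [z] in [U] is [(1 - 3U^2 - 4U^3) / ((1 + 2U)(1 + U + U^2))^2], and the factor
    [1 - 3U^2 - 4U^3] also divides the derivative of [B] in [U]. It cancels in the derivative of [B]
    in [z], which is thus regular in [U] at [tau]; the square root singularity of [U] reaches [B]
    one order later than usual. Hence the exponent -5/2 instead of -3/2, and the choice of the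
    second derivative for the transfer. *)

Notation letter := (option nat * bool)%type.

Section Words.
Local Open Scope nat_scope.

(* A partition is read from left to right; the letter of a vertex records its
   predecessor in its block, if any, and whether it has a successor.  The
   newest letter comes first, so the head of [x :: w] is the vertex [size w]. *)
Fixpoint arcs (w : seq letter) : seq (nat * nat) :=
  if w is x :: w' then
    if x.1 is Some v then (v, size w') :: arcs w' else arcs w'
  else [::].

Fixpoint opens (w : seq letter) : seq nat :=
  if w is x :: w' then
    let p := if x.1 is Some v then rem v (opens w') else opens w' in
    if x.2 then size w' :: p else p
  else [::].

(* Closing [b] now would complete an occurrence of 312, with [a], [b] and [i]
   as the second, the third and the first opener. *)
Definition blocked (w : seq letter) (b : nat) : bool :=
  has (fun a => (a < b) && has (fun i => (i.1 < a) && (b < i.2)) (arcs w))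
    (opens w).

Definition closables (w : seq letter) : seq nat :=
  [seq b <- opens w | ~~ blocked w b].

Fixpoint good (w : seq letter) : bool :=
  if w is x :: w' then
    good w' && (if x.1 is Some v then v \in closables w' else true)
  else true.

Definition extensions (w : seq letter) : seq (seq letter) :=
  flatten [seq [:: (p, false) :: w; (p, true) :: w]
          | p <- None :: [seq Some v | v <- closables w]].

Fixpoint words (n : nat) : seq (seq letter) :=
  if n is n'.+1 then flatten [seq extensions w | w <- words n'] else [:: [::]].

Lemma mem_extensions w w' : (w' \in extensions w) =
  if w' is x :: w'' then
    (w'' == w) && (if x.1 is Some v then v \in closables w else true)
  else false.
Proof.
apply/flattenP/idP => [[s /mapP[p p_in ->]]|].
  by rewrite !inE => /orP[]/eqP-> /=; rewrite eqxx /=; case: p p_in => //= v;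
    rewrite inE /= => /mapP[? ? [->]].
case: w' => // -[p b] w'' /andP[/eqP-> p_ok]; rewrite [(p, b).1]/= in p_ok.
exists [:: (p, false) :: w; (p, true) :: w]; last by case: b; rewrite !inE eqxx ?orbT.
apply: (map_f (fun p => [:: (p, false) :: w; (p, true) :: w])).
by case: p p_ok => [v|] v_in; rewrite inE //= map_f.
Qed.

Lemma closables_uniq w : uniq (opens w) -> uniq (closables w).
Proof. exact: filter_uniq. Qed.

Lemma opens_lt w v : v \in opens w -> v < size w.
Proof.
elim: w v => //= -[p b] w IH v.
have aux : v \in (if p is Some u then rem u (opens w) else opens w) -> v < (size w).+1.
  by case: p => [u /mem_rem|] /IH /ltnW.
by case: b => //; rewrite inE => /orP[/eqP->|].
Qed.

Lemma gtn_trans : transitive gtn.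
Proof. by move=> y x z /= h1 h2; apply: ltn_trans h2 h1. Qed.

Lemma opens_sorted w : sorted gtn (opens w).
Proof.
elim: w => //= -[p b] w IH.
have aux : sorted gtn (if p is Some u then rem u (opens w) else opens w).
  case: p => [u|//]; exact: (subseq_sorted gtn_trans (rem_subseq u _) IH).
case: b => //=; rewrite (path_sortedE gtn_trans) aux andbT; apply/allP => v.
by case: p {aux} => [u /mem_rem|] /opens_lt.
Qed.

Lemma opens_uniq w : uniq (opens w).
Proof.
by apply: (sorted_uniq gtn_trans _ (opens_sorted w)) => x; exact: ltnn.
Qed.

Lemma extensions_uniq w : uniq (extensions w).
Proof.
have extU s : uniq s ->
    uniq (flatten [seq [:: (p, false) :: w; (p, true) :: w] | p <- s]).
  elim: s => //= p s IH /andP[p_s /IH ->].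
  rewrite inE negb_or andbT -andbA; apply/and3P; split; first by apply/eqP => -[].
    apply/flattenP => -[? /mapP[p' p's ->]].
    by rewrite !inE => /orP[]/eqP[] // eq_p; rewrite eq_p p's in p_s.
  apply/flattenP => -[? /mapP[p' p's ->]].
  by rewrite !inE => /orP[]/eqP[] // eq_p; rewrite eq_p p's in p_s.
apply: extU; rewrite /= map_inj_uniq ?closables_uniq ?opens_uniq ?andbT //.
by apply/mapP => -[].
Qed.

Lemma mem_words n w : (w \in words n) = (size w == n) && good w.
Proof.
elim: n w => [|n IH] [|x w] //=.
  by apply/flattenP => -[s /mapP[w' _ ->]]; rewrite mem_extensions.
apply/flattenP/idP => [[s /mapP[w' w'n ->]]|].
  by rewrite mem_extensions eqSS => /andP[/eqP-> ->]; move: w'n; rewrite IH => /andP[-> ->].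
rewrite eqSS andbA => /andP[wn x_ok]; exists (extensions w); first by rewrite map_f ?IH.
by rewrite mem_extensions eqxx x_ok.
Qed.

Lemma words_uniq n : uniq (words n).
Proof.
elim: n => // n; rewrite [words n.+1]/=; elim: (words n) => [//|w s IH].
rewrite cons_uniq => /andP[ws /IH us].
have -> : flatten [seq extensions x | x <- w :: s] =
  extensions w ++ flatten [seq extensions x | x <- s] by [].
rewrite cat_uniq extensions_uniq us andbT; apply/hasPn => w' /flattenP[t /mapP[w'' w''s ->]].
rewrite /= !mem_extensions; case: w' => // x w' /andP[/eqP-> _].
by apply: contra ws => /andP[/eqP<-].
Qed.

Lemma arcs_lt w i j : good w -> (i, j) \in arcs w -> i < j < size w.
Proof.
elim: w i j => //= -[[v|] b] w IH i j /= /andP[gw v_ok]; last first.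
  by case/(IH _ _ gw)/andP => -> /ltnW.
rewrite inE => /orP[/eqP[-> ->]|]; last by case/(IH _ _ gw)/andP => -> /ltnW.
by rewrite ltnSn andbT; apply: opens_lt; move: v_ok; rewrite mem_filter => /andP[].
Qed.

(** * The stack of a word *)

(* Top first, the open vertices with the information whether they are
   closable. *)
Definition flags (w : seq letter) : seq bool :=
  [seq ~~ blocked w b | b <- opens w].

(* A blocked vertex has to wait until the open vertex before it is closed;
   the maximal chains of such vertices each end, downwards, at a closable
   one. *)
Fixpoint runs (s : seq bool) : seq nat :=
  if s is b :: s' then
    if b then 1 :: runs s'
    else if runs s' is c :: r then c.+1 :: r else [:: 1]
  else [::].

Definition stack (w : seq letter) : seq nat := runs (flags w).

Lemma runs_eq0 s : (runs s == [::]) = (s == [::]).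
Proof. by case: s => //= -[] s //; case: (runs s). Qed.

Lemma runs_gt0 s : all (leq 1) (runs s).
Proof. by elim: s => //= -[] s //=; case: (runs s) => //= c r /andP[]. Qed.

Lemma runs_nseq k s : runs (nseq k false ++ true :: s) = k.+1 :: runs s.
Proof. by elim: k => //= k ->. Qed.

Lemma stack_eq0 w : (stack w == [::]) = (opens w == [::]).
Proof. by rewrite /stack runs_eq0 /flags; case: (opens w). Qed.

Lemma stack_skip w : stack ((None, false) :: w) = stack w.
Proof. by []. Qed.

(** No arc passes over the newest vertex, so it is closable; being the largest open vertex, it
    blocks no other. *)
Lemma stack_push p w : good ((p, false) :: w) ->
  stack ((p, true) :: w) = 1 :: stack ((p, false) :: w).
Proof.
move=> gw.
set w0 := (p, false) :: w; set w1 := (p, true) :: w.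
have arcs_eq : arcs w1 = arcs w0 by [].
have opens_eq : opens w1 = size w :: opens w0 by [].
rewrite /stack /flags opens_eq /=.
have -> : blocked w1 (size w) = false.
  apply/hasP => -[a _ /andP[_ /hasP[[i j]]]] /(@arcs_lt w1 _ _ gw) /=.
  lia.
congr (1 :: runs _); apply/eq_in_map => b b_open; congr (~~ _).
rewrite /blocked arcs_eq opens_eq /=; case: ltnP => //.
by have := @opens_lt ((p, false) :: w) b b_open; rewrite /= ltnS => le1 lt2; lia.
Qed.

(** One entry per chain in which a vertex can be closed: the total size of the chains down to it,
    which the closing merges, and the chains below. *)
Fixpoint closings (acc : nat) (st : seq nat) : seq (nat * seq nat) :=
  if st is c :: r then (acc + c, r) :: closings (acc + c) r else [::].

Definition close_top (st : nat * seq nat) : seq nat :=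
  if st.1 == 1 then st.2 else st.1.-1 :: st.2.

Lemma opens_split w X v Y : opens w = X ++ v :: Y ->
  [/\ {in X, forall a, v < a}, {in Y, forall a, a < v}, v \notin X &
      pairwise gtn X].
Proof.
move=> opw; have := opens_sorted w; rewrite (sorted_pairwise gtn_trans) opw.
rewrite pairwise_cat /= => /and4P[/allrelP XY pX /allP vY _].
have vX : {in X, forall a, v < a} by move=> a aX; apply: XY; rewrite ?inE ?eqxx.
split=> //; by apply/negP => /vX; rewrite ltnn.
Qed.

Lemma opens_close w X v Y : opens w = X ++ v :: Y ->
  opens ((Some v, false) :: w) = X ++ Y.
Proof.
move=> opw; have [_ _ vX _] := opens_split opw.
by rewrite /= opw; elim: X vX {opw} => [|a X IH] /=; rewrite ?eqxx // inE negb_or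
  eq_sym => /andP[/negbTE-> /IH->].
Qed.

Lemma blocked_close w v b : blocked ((Some v, false) :: w) b =
  has (fun a => (a < b) && (((v < a) && (b < size w)) ||
        has (fun i => (i.1 < a) && (b < i.2)) (arcs w))) (rem v (opens w)).
Proof. by []. Qed.

(** The new arc starts at [v], so it covers no vertex of [Y], whose flags survive. The lowest vertex
    above [v] becomes closable, since an old arc over it and some open [a < v] would have blocked
    [v]; the other vertices of [X] are blocked by it through the new arc. *)
Lemma stack_close_at w X v Y :
  opens w = X ++ v :: Y -> v \in closables w ->
  stack ((Some v, false) :: w) =
    close_top ((size X).+1, runs [seq ~~ blocked w b | b <- Y]).
Proof.
move=> opw; rewrite mem_filter => /andP[/hasPn v_free _].
have [vX vY _ pX] := opens_split opw.
have opw' := opens_close opw.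
have remE : rem v (opens w) = X ++ Y by [].
rewrite /stack /flags opw' map_cat.
have flY : [seq ~~ blocked ((Some v, false) :: w) b | b <- Y] =
           [seq ~~ blocked w b | b <- Y].
  apply/eq_in_map => b /vY bv; congr (~~ _); rewrite blocked_close remE /blocked opw.
  have XF (Q : nat -> bool) : has (fun a => (a < b) && Q a) X = false.
    by apply/hasP => -[a /vX va /andP[ab _]]; lia.
  rewrite !has_cat /= !XF /= [v < b]ltnNge (ltnW bv) /=.
  apply: eq_in_has => a /vY av; rewrite [v < a]ltnNge (ltnW av) /=; lia.
rewrite flY; case/lastP: X opw vX pX opw' remE {flY} => [|X m] opw vX pX opw' remE.
  by [].
have flm : ~~ blocked ((Some v, false) :: w) m.
  rewrite blocked_close remE; apply/hasPn => a.
  have vm : v < m by apply: vX; rewrite mem_rcons mem_head.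
  rewrite mem_cat mem_rcons inE -orbA => /or3P[/eqP->|aX|aY]; first by rewrite ltnn.
    move: pX; rewrite -cats1 pairwise_cat => /and3P[/allrelP /(_ a m aX)].
    by rewrite inE eqxx => /(_ isT) /=; lia.
  have av := vY _ aY; rewrite [v < a]ltnNge (ltnW av) /=.
  rewrite negb_and; apply/orP; right; apply/hasPn => i iw.
  have /v_free : a \in opens w by rewrite opw !mem_cat inE aY !orbT.
  by rewrite av => /hasPn /(_ _ iw); lia.
have flX : [seq ~~ blocked ((Some v, false) :: w) b | b <- X] = nseq (size X) false.
  rewrite -(size_map (fun b => ~~ blocked ((Some v, false) :: w) b)).
  apply/all_pred1P; rewrite all_map; apply/allP => b bX /=.
  rewrite eqbF_neg negbK blocked_close remE; apply/hasP; exists m.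
    by rewrite mem_cat mem_rcons mem_head.
  have -> /= : b < size w by apply: opens_lt; rewrite opw mem_cat mem_rcons inE bX orbT.
  have -> : v < m by apply: vX; rewrite mem_rcons mem_head.
  move: pX; rewrite -cats1 pairwise_cat => /and3P[/allrelP /(_ b m bX) mb _ _].
  by move: mb; rewrite inE eqxx => /(_ isT) /= ->.
by rewrite map_rcons flX flm cat_rcons runs_nseq size_rcons.
Qed.

Lemma stack_closings w :
  [seq stack ((Some v, false) :: w) | v <- closables w] =
  [seq close_top p | p <- closings 0 (stack w)].
Proof.
(* [X] holds the open vertices already passed on the way down; their number is the accumulated
   size. *)
suff gen X L : opens w = X ++ L ->
    [seq stack ((Some v, false) :: w) | v <- L & ~~ blocked w v] =
    [seq close_top p | p <- closings (size X) (runs [seq ~~ blocked w b | b <- L])].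
  exact: (gen [::]).
elim: L X => [|b L IH] X opw //=.
have IH' := IH (rcons X b); rewrite cat_rcons size_rcons in IH'.
case: (boolP (blocked w b)) => [b_blocked|b_free] /=; last first.
  rewrite IH' // addn1 [LHS]/= (@stack_close_at w X b L) //.
  by rewrite mem_filter b_free opw mem_cat mem_head orbT.
rewrite IH' //; have [Xb Lb _ _] := opens_split opw.
(* A blocked vertex has an open vertex below it, so the default branch of [runs] is not reached. *)
have L_neq0 : L != [::].
  case/hasP: b_blocked => a; rewrite opw mem_cat inE => /or3P[/Xb|/eqP->|].
  - by move=> ? /andP[? _]; lia.
  - by rewrite ltnn.
  - by case: (L).
have: runs [seq ~~ blocked w b | b <- L] != [::] by rewrite runs_eq0; case: (L) L_neq0.
by case: (runs _) => //= c r _; rewrite addSnnS.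
Qed.

Lemma stack_extensions w : good w ->
  [seq stack w' | w' <- extensions w] =
  flatten [seq [:: st; 1 :: st]
          | st <- stack w :: [seq close_top p | p <- closings 0 (stack w)]].
Proof.
move=> gw; rewrite -stack_closings /extensions map_flatten -map_comp /=.
rewrite stack_push /= ?gw // stack_skip; congr [:: _, _ & flatten _].
rewrite -!map_comp; apply/eq_in_map => v v_closable /=.
by rewrite stack_push //= gw.
Qed.

(** * Counting words by their stack *)

Definition stacks (n : nat) : seq (seq nat) := [seq stack w | w <- words n].

Lemma stacksS n : stacks n.+1 =
  flatten [seq flatten [seq [:: st'; 1 :: st']
                       | st' <- st :: [seq close_top p | p <- closings 0 st]]
          | st <- stacks n].
Proof.
rewrite /stacks /= map_flatten -!map_comp; congr flatten.
apply/eq_in_map => w; rewrite mem_words => /andP[_ gw].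
exact: stack_extensions.
Qed.

Lemma stacks_gt0 n st : st \in stacks n -> all (leq 1) st.
Proof. by case/mapP => w _ ->; exact: runs_gt0. Qed.

(** A closing either takes the first chain alone or has a last merged chain [c]. In the second case
    stopping one chain earlier is the closing [(s - c, c :: r)], and positivity of the chains puts
    [c] strictly between 0 and [s]. *)
Lemma count_closings acc s r st : all (leq 1) st ->
  count_mem (s, r) (closings acc st) =
  (if st is c :: r' then (acc + c == s) && (r' == r) else false) +
  \sum_(1 <= c < s) count_mem (s - c, c :: r) (closings acc st).
Proof.
elim: st acc => [|c0 r0 IH] acc /=; first by rewrite big1.
case/andP=> c0_gt0 r0_gt0; rewrite xpair_eqE big_split /=; congr addn.
rewrite {}IH //; congr addn.
case: r0 r0_gt0 => [|c1 r1] /=.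
  by rewrite big1 // => c _; rewrite xpair_eqE andbF.
case/andP=> c1_gt0 _; case: eqP => [s_eq|s_neq]; last first.
  rewrite big_nat_cond big1 // => c /andP[/andP[c_gt0 c_lt] _].
  rewrite xpair_eqE eqseq_cons; apply/eqP; rewrite eqb0.
  by apply/negP => /and3P[/eqP ? /eqP ? _]; apply: s_neq; lia.
have c1_in : c1 \in index_iota 1 s by rewrite mem_index_iota; lia.
rewrite (bigD1_seq c1) ?iota_uniq //=.
rewrite xpair_eqE eqseq_cons eqxx big1 => [|c /negbTE c_neq]; last first.
  by rewrite xpair_eqE eqseq_cons [c1 == c]eq_sym c_neq andbF.
have -> : acc + c0 == s - c1 by apply/eqP; lia.
by rewrite addn0.
Qed.

Definition stack_count (n : nat) (st : seq nat) : nat := count_mem st (stacks n).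

Definition closing_count (n s : nat) (r : seq nat) : nat :=
  \sum_(st <- stacks n) count_mem (s, r) (closings 0 st).

Lemma closing_countE n s r : 
  closing_count n s r =
  stack_count n (s :: r) + \sum_(1 <= c < s) closing_count n (s - c) (c :: r).
Proof.
rewrite /closing_count exchange_big /= /stack_count -sum1_count.
rewrite [X in _ = X + _]big_mkcond /= -big_split /= big_seq [RHS]big_seq.
apply: eq_bigr => st /stacks_gt0 st_gt0; rewrite count_closings //; congr addn.
by case: st {st_gt0} => //= c r'; rewrite eqseq_cons; case: (_ && _).
Qed.

(** The two summands are the preimages of [st] under [close_top]: total size 1 over all of [st], or
    a total size one larger than the top chain. *)
Definition closed_count (n : nat) (st : seq nat) : nat :=
  closing_count n 1 st + (if st is c :: r then closing_count n c.+1 r else 0).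

Lemma count_close_top acc st' st : all (leq 1) st -> all (leq 1) st' ->
  count_mem st [seq close_top p | p <- closings acc st'] =
  count_mem (1, st) (closings acc st') +
  (if st is c :: r then count_mem (c.+1, r) (closings acc st') else 0).
Proof.
elim: st' acc => [|c0 r0 IH] acc st_gt0 /=; first by case: (st).
case/andP=> c0_gt0 r0_gt0; rewrite {}IH // /close_top /=.
case: st st_gt0 => [_|c r /= /andP[c_gt0 _]]; rewrite !xpair_eqE.
  by rewrite !addn0; case: ifP.
rewrite addnACA; congr addn; case: ifP => [/eqP->|/eqP neq1] /=.
  by case: (c) c_gt0 => //= c' _; rewrite addn0.
rewrite eqseq_cons; congr ((_ && _) : nat); apply/eqP/eqP; lia.
Qed.

Lemma closed_countE n st : all (leq 1) st ->
  closed_count n st = \sum_(st' <- stacks n)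
    count_mem st [seq close_top p | p <- closings 0 st'].
Proof.
move=> st_gt0; rewrite /closed_count /closing_count [RHS]big_seq.
under [RHS]eq_bigr => st' /stacks_gt0 st'_gt0 do rewrite count_close_top //.
by rewrite big_split /= -!big_seq; case: (st) => [|c r]; rewrite ?big1_eq.
Qed.

Lemma count_push st (s : seq (seq nat)) :
  count_mem st (flatten [seq [:: x; 1 :: x] | x <- s]) =
  count_mem st s + (if st is 1 :: r then count_mem r s else 0).
Proof.
elim: s => [|x s IH] /=; first by case: (st) => [|[|[]]].
rewrite {}IH; case: (st) => [|[|[|c]] r]; rewrite ?eqseq_cons ?addn0 //=.
lia.
Qed.

Lemma stack_countS n st : all (leq 1) st ->
  stack_count n.+1 st =
  stack_count n st + closed_count n st +
  (if st is 1 :: r then stack_count n r + closed_count n r else 0).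
Proof.
have sumE t : all (leq 1) t -> \sum_(x <- stacks n)
    count_mem t (x :: [seq close_top p | p <- closings 0 x]) =
    stack_count n t + closed_count n t.
  move=> t_gt0; rewrite closed_countE // /stack_count -sum1_count.
  rewrite [X in _ = X + _]big_mkcond -big_split /=.
  by apply: eq_bigr => x _ /=; case: (x == t).
move=> st_gt0; rewrite {1}/stack_count stacksS count_flatten -map_comp sumnE big_map.
rewrite (eq_bigr _ (fun x _ => count_push st _)).
rewrite big_split /= -sumE //; congr addn.
case: (st) st_gt0 => [|[|[|c]] r] r_gt0; rewrite ?big1_eq //.
exact: sumE.
Qed.

Lemma stack_count0 st : stack_count 0 st = (st == [::]).
Proof. by rewrite /stack_count /= addn0 eq_sym. Qed.

(** The part about [opens] carries the induction: when [i3] is closed at [i5], an open [i2] would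
    block it, because the arc from [i1] to [i4] covers both; and a vertex that is no longer open
    starts no later arc. *)
Lemma good_avoids w i1 i2 i3 i4 i5 : good w ->
  i1 < i2 -> i2 < i3 -> i3 < i4 -> i4 < i5 ->
  (i1, i4) \in arcs w -> (i3, i5) \in arcs w ->
  (i2 \notin opens w) && ~~ has (fun i => (i.1 == i2) && (i5 < i.2)) (arcs w).
Proof.
move=> gw lt12 lt23 lt34 lt45; elim: w gw => // -[p b] w IH gw0 arc14 arc35.
have i5_lt : i5 <= size w by have /andP[_] := arcs_lt gw0 arc35.
move: gw0 arc14 arc35 => /= /andP[gw p_ok] arc14 arc35.
have arc14' : (i1, i4) \in arcs w.
  by case: p p_ok arc14 {arc35} => // v _; rewrite inE => /orP[/eqP[_ ?]|//]; lia.
have i2_lt : (i2 == size w) = false by apply/eqP; lia.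
suff: (i2 \notin (if p is Some v then rem v (opens w) else opens w)) &&
   ~~ has (fun i => (i.1 == i2) && (i5 < i.2))
     (if p is Some v then (v, size w) :: arcs w else arcs w).
  by case: b => //; rewrite inE i2_lt.
case: p p_ok arc35 {arc14} => [v|_]; last by move=> arc35; apply: IH.
rewrite mem_filter inE => /andP[v_free v_open] /orP[/eqP[i3E i5E]|arc35].
  rewrite i5E /= ltnn andbF /=; apply/andP; split; last first.
    by apply/hasP => -[[i j]] /(arcs_lt gw) /andP[_ /= j_lt] /andP[_]; lia.
  apply/negP => /mem_rem i2_open; case/hasP: v_free; exists i2 => //.
  by rewrite -i3E lt23 /=; apply/hasP; exists (i1, i4); rewrite //= lt12.
have /andP[i2_open i2_arc] := IH gw arc14' arc35.
rewrite (contra _ i2_open) /=; last exact: mem_rem.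
by rewrite (negbTE i2_arc) orbF; apply: contra i2_open => /andP[/eqP<-].
Qed.

(** The head letter is read off from the arc that ends at the last vertex and from whether that
    vertex is open. For the shorter words the closed vertex is put back among the open ones. *)
Lemma good_inj w w' : good w -> good w' -> size w = size w' ->
  arcs w =i arcs w' -> opens w =i opens w' -> w = w'.
Proof.
elim: w w' => [|[p b] w IH] [|[p' b'] w'] //=.
move=> /andP[gw p_ok] /andP[gw' p'_ok] [size_eq] arcs_eq opens_eq.
have size_arc i : (i, size w) \in arcs w = false.
  by apply/negP => /(arcs_lt gw); rewrite ltnn andbF.
have size_arc' i : (i, size w) \in arcs w' = false.
  by apply/negP => /(arcs_lt gw'); rewrite -size_eq ltnn andbF.
have p_eq : p = p'.
  case: p p' arcs_eq {p_ok p'_ok opens_eq} => [v|] [v'|] //= arcs_eq.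
  - have := arcs_eq (v, size w).
    by rewrite !inE eqxx -size_eq xpair_eqE eqxx andbT size_arc' orbF => /esym/eqP->.
  - by have := arcs_eq (v, size w); rewrite !inE eqxx size_arc'.
  - by have := arcs_eq (v', size w); rewrite !inE -size_eq eqxx size_arc.
subst p'; pose op u := if p is Some v then rem v (opens u) else opens u.
have op_lt u v : v \in op u -> v < size u.
  by rewrite /op; case: (p) => [?|] => [/mem_rem|] /opens_lt.
have opensE c u i : i \in opens ((p, c) :: u) = (c && (i == size u)) || (i \in op u).
  by rewrite /= -/(op u); case: c; rewrite ?inE.
have b_eq : b = b'.
  have := opens_eq (size w); rewrite !opensE -size_eq eqxx !andbT.
  have /negbTE-> : size w \notin op w by apply/negP => /op_lt; rewrite ltnn.
  have /negbTE-> : size w \notin op w' by apply/negP => /op_lt; rewrite -size_eq ltnn.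
  by rewrite !orbF.
rewrite -b_eq in opens_eq *; congr (_ :: _).
have op_eq : op w =i op w'.
  move=> i; have := opens_eq i; rewrite !opensE -size_eq.
  case: eqP => [->|_]; last by rewrite !andbF.
  move=> _; apply/idP/idP => /op_lt; by rewrite -?size_eq ltnn.
apply: IH => // [i|i].
  case: i => i j; case: (j =P size w) => [->|/eqP/negbTE j_neq].
    by rewrite size_arc size_arc'.
  have := arcs_eq (i, j); case: (p) => //= v.
  by rewrite !inE !xpair_eqE -size_eq j_neq !andbF.
have := op_eq i; rewrite /op; case: (p) p_ok p'_ok => // v v_ok v'_ok.
rewrite !mem_rem_uniq ?opens_uniq // !inE; case: eqP => //= -> _.
by move: v_ok v'_ok; rewrite !mem_filter => /andP[_ ->] /andP[_ ->].
Qed.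

(** * The word of an avoiding arc relation *)

Section WordOf.
Variables (n : nat) (A : rel nat).
Hypothesis A_lt : forall i j, A i j -> i < j < n.
Hypothesis A_inj : forall i i' j, A i j -> A i' j -> i = i'.
Hypothesis A_fun : forall i j j', A i j -> A i j' -> j = j'.
Hypothesis A_avoids : forall i1 i2 i3 i4 i5 i6,
  i1 < i2 -> i2 < i3 -> i3 < i4 -> i4 < i5 -> i5 < i6 ->
  A i1 i4 -> A i2 i6 -> ~~ A i3 i5.

Fixpoint word_of (t : nat) : seq letter :=
  if t is t'.+1 then
    (ohead [seq i <- iota 0 n | A i t'], has (A t') (iota 0 n)) :: word_of t'
  else [::].

Lemma size_word_of t : size (word_of t) = t.
Proof. by elim: t => //= t ->. Qed.

Lemma ohead_pred t v :
  ohead [seq i <- iota 0 n | A i t] = Some v <-> A v t.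
Proof.
have mem_pred i : (i \in [seq i <- iota 0 n | A i t]) = A i t.
  rewrite mem_filter mem_iota add0n; case: (boolP (A i t)) => //= /A_lt; lia.
case E: [seq i <- iota 0 n | A i t] mem_pred => [|u s] mem_pred; split=> //=.
- by rewrite -mem_pred.
- by case=> <-; rewrite -mem_pred mem_head.
- move=> Avt; congr Some; apply: A_inj Avt; rewrite -mem_pred; exact: mem_head.
Qed.

Lemma arcs_word_of t i j : ((i, j) \in arcs (word_of t)) = (j < t) && A i j.
Proof.
elim: t => //= t IH; rewrite ltnS [j <= t]leq_eqVlt.
case E: (ohead _) => [v|]; rewrite ?inE IH.
  have Avt := (ohead_pred t v).1 E.
  rewrite xpair_eqE size_word_of; case: (j =P t) => [->|_] /=; last by rewrite andbF.
  rewrite ltnn orbF andbT; apply/eqP/idP => [-> //|Ait]; exact: A_inj Ait Avt.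
case: (j =P t) => [->|//]; rewrite ltnn /=; apply/esym/negP => Ait.
by have := (ohead_pred t i).2 Ait; rewrite E.
Qed.

Lemma opens_word_of t i : t <= n ->
  (i \in opens (word_of t)) = (i < t) && has (fun j => (t <= j) && A i j) (iota 0 n).
Proof.
elim: t => //= t IH t_lt.
have opE : (i \in (if ohead [seq i <- iota 0 n | A i t] is Some v
                   then rem v (opens (word_of t)) else opens (word_of t))) =
           (i < t) && has (fun j => (t < j) && A i j) (iota 0 n).
  have skip : ~~ A i t -> has (fun j => (t <= j) && A i j) (iota 0 n) =
                      has (fun j => (t < j) && A i j) (iota 0 n).
    move=> nAit; apply: eq_has => j; rewrite leq_eqVlt; case: (t =P j) => //= <-.
    by rewrite (negbTE nAit) andbF.
  case E: (ohead _) => [v|]; last first.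
    have nAit : ~~ A i t by apply/negP => Ait; have := (ohead_pred t i).2 Ait; rewrite E.
    by rewrite (IH (ltnW t_lt)) skip.
  have Avt := (ohead_pred t v).1 E.
  rewrite mem_rem_uniq ?opens_uniq // inE (IH (ltnW t_lt)).
  case: (i =P v) => [->|i_neq] /=.
    apply/esym/negP => /andP[_ /hasP[j _ /andP[tj Avj]]].
    by rewrite (A_fun Avt Avj) ltnn in tj.
  by rewrite skip //; apply/negP => Ait; apply: i_neq; apply: A_inj Ait Avt.
have has_t : has (A t) (iota 0 n) = has (fun j => (t < j) && A t j) (iota 0 n).
  by apply: eq_has => j; case: (boolP (A t j)) => [/A_lt/andP[->]|]; rewrite ?andbF.
rewrite ltnS [i <= t]leq_eqVlt; case: ifP => b; rewrite ?inE opE ?size_word_of.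
  by case: eqP => //= ->; rewrite -has_t b.
by case: eqP => //= ->; rewrite -has_t b ltnn.
Qed.

Lemma good_word_of t : t <= n -> good (word_of t).
Proof.
elim: t => //= t IH t_lt; rewrite (IH (ltnW t_lt)) /=.
case E: (ohead _) => [v|] //; have Avt := (ohead_pred t v).1 E.
have /andP[v_lt _] := A_lt Avt.
rewrite mem_filter (opens_word_of _ (ltnW t_lt)) v_lt /=; apply/andP; split; last first.
  by apply/hasP; exists t; rewrite ?mem_iota ?leqnn.
apply/hasP => -[i2]; rewrite (opens_word_of _ (ltnW t_lt)) => /andP[_ /hasP[i6 _]].
move=> /andP[t_le A26] /andP[lt23 /hasP[[i1 i4]]]; rewrite arcs_word_of /=.
move=> /andP[i4_lt A14] /andP[lt12 lt34].
(* Two arcs cannot both end at [t], so [i2] is closed strictly later, and [i1, i2, v, i4, t, i6] is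
   an occurrence of the pattern. *)
have t_lt6 : t < i6.
  rewrite ltn_neqAle t_le andbT; apply/eqP => t_eq; move: A26; rewrite -t_eq => A2t.
  by rewrite (A_inj A2t Avt) ltnn in lt23.
by have := A_avoids lt12 lt23 lt34 i4_lt t_lt6 A14 A26; rewrite Avt.
Qed.

Lemma word_of_complete : opens (word_of n) = [::].
Proof.
apply/eqP; rewrite -size_eq0 -leqn0 leqNgt -has_predT; apply/hasP => -[i].
rewrite opens_word_of // => /andP[_ /hasP[j _ /andP[j_le /A_lt]]]; lia.
Qed.

End WordOf.

(** * From partitions to words *)

Section FunctionalRelation.
Variables (T : finType) (e : rel T).

(** Two paths of a functional relation from a common start use the same edges until the shorter one
    ends. *)
Lemma connect_comparable : (forall x y y', e x y -> e x y' -> y = y') ->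
  forall x y z, connect e x y -> connect e x z -> connect e y z || connect e z y.
Proof.
move=> e_fun x y z /connectP[p]; elim: p x => [|a p IH] x /=.
  by move=> _ -> ->.
case/andP=> exa pa y_last; case/connectP=> -[|b q] /=.
  by move=> _ ->; apply/orP; right; apply/connectP; exists (a :: p); rewrite //= exa.
case/andP=> exb pb z_last; apply: (IH a) => //.
by rewrite (e_fun _ _ _ exa exb); apply/connectP; exists q.
Qed.

End FunctionalRelation.

Section ArcsOfPartition.
Variable n : nat.
Implicit Types (P : {set {set 'I_n}}) (e : rel 'I_n) (x y z : 'I_n).

Definition same_block e : rel 'I_n := [rel x y | connect e x y || connect e y x].

Definition partition_of e : {set {set 'I_n}} :=
  finset.equivalence_partition (same_block e) [set: 'I_n].

Definition arc_rel e : Prop :=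
  [/\ forall x y, e x y -> x < y,
      forall x x' y, e x y -> e x' y -> x = x' &
      forall x y y', e x y -> e x y' -> y = y'].

Lemma connect_leq e : arc_rel e -> forall x y, connect e x y -> x <= y.
Proof.
case=> e_lt _ _ x y /connectP[p]; elim: p x => [|a p IH] x /=.
  by move=> _ ->.
case/andP=> /e_lt xa pa y_last; apply: leq_trans (ltnW xa) _; exact: IH.
Qed.

Lemma same_block_equiv e : arc_rel e ->
  {in [set: 'I_n] & &, equivalence_rel (same_block e)}.
Proof.
case=> e_lt e_inj e_fun.
have sym x y : same_block e x y = same_block e y x by rewrite /same_block /= orbC.
have trans : transitive (same_block e).
  move=> y x z /= /orP[xy|yx] /orP[yz|zy].
  - by rewrite /same_block /= (connect_trans xy yz).
  (* Here [x] and [z] both lead to [y]. The reversed relation is functional because arcs are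
     determined by their right ends, so comparability applies to it. *)
  - rewrite /same_block /=; pose e' := [rel a b | e b a].
    have e'E a b : connect e' a b = connect e b a by rewrite connect_rev.
    rewrite -!e'E orbC; apply: (@connect_comparable _ e' _ y); rewrite ?e'E //.
    by move=> a b b' eba eb'a; apply: e_inj eba eb'a.
  - exact: connect_comparable e_fun _ _ _ yx yz.
  - by rewrite /same_block /= (connect_trans zy yx) orbT.
move=> x y z _ _ _; split; first by rewrite /same_block /= connect0.
move=> xy; apply/idP/idP; first by apply: trans; rewrite sym.
exact: trans.
Qed.

Lemma partition_ofP e : arc_rel e ->
  finset.partition (partition_of e) [set: 'I_n].
Proof. by move=> /same_block_equiv; apply: finset.equivalence_partitionP. Qed.

Lemma pblock_sym P x y : finset.partition P [set: 'I_n] ->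
  y \in finset.pblock P x -> finset.pblock P y = finset.pblock P x.
Proof. by move=> /and3P[_ tI _]; apply: finset.same_pblock. Qed.

Lemma mem_pblockT P x : finset.partition P [set: 'I_n] ->
  x \in finset.pblock P x.
Proof. by move=> /finset.cover_partition covP; rewrite finset.mem_pblock covP finset.inE. Qed.

Lemma is_arcP P x y : finset.partition P [set: 'I_n] ->
  reflect [/\ x < y, y \in finset.pblock P x &
              forall l, l \in finset.pblock P x -> x < l -> y <= l]
          (is_arc P x y).
Proof.
move=> partP; have /and3P[/eqP covP tI _] := partP.
apply: (iffP andP) => [[xy /exists_inP[B BP /and3P[xB yB /forall_inP noB]]]|[xy yx no]].
  rewrite (finset.def_pblock tI BP xB); split=> // l lB xl.
  by have := noB l lB; rewrite xl /= -leqNgt.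
split=> //; apply/exists_inP; exists (finset.pblock P x).
  by apply: finset.pblock_mem; rewrite covP finset.inE.
rewrite mem_pblockT // yx /=; apply/forall_inP => l lB.
by rewrite negb_and -implybE; apply/implyP => xl; rewrite -leqNgt no.
Qed.

Lemma is_arc_rel P : finset.partition P [set: 'I_n] -> arc_rel (is_arc P).
Proof.
move=> partP; split=> [x y /andP[]//|x x' y|x y y'].
  move=> /(is_arcP _ _ partP)[xy yx no] /(is_arcP _ _ partP)[x'y yx' no'].
  have xx' : finset.pblock P x = finset.pblock P x'.
    by rewrite -(pblock_sym partP yx) (pblock_sym partP yx').
  apply/val_inj/eqP; rewrite eqn_leq; apply/andP; split; rewrite leqNgt; apply/negP => lt.
    by have := no' x; rewrite -xx' mem_pblockT // => /(_ isT lt); rewrite leqNgt xy.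
  by have := no x'; rewrite xx' mem_pblockT // => /(_ isT lt); rewrite leqNgt x'y.
move=> /(is_arcP _ _ partP)[xy yx no] /(is_arcP _ _ partP)[xy' y'x no'].
by apply/val_inj/eqP; rewrite eqn_leq no //= no'.
Qed.

Lemma pblock_partition_of e x y : arc_rel e ->
  (y \in finset.pblock (partition_of e) x) = same_block e x y.
Proof.
move=> /same_block_equiv eqv.
by apply: finset.pblock_equivalence_partition; rewrite ?finset.in_setT.
Qed.

Lemma connect_first e x y : connect e x y -> x != y ->
  exists2 a, e x a & connect e a y.
Proof.
case/connectP=> -[|a p] /=; first by move=> _ ->; rewrite eqxx.
by case/andP=> exa pa y_last _; exists a => //; apply/connectP; exists p.
Qed.

Lemma is_arc_partition_of e : arc_rel e -> is_arc (partition_of e) =2 e.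
Proof.
move=> e_arc x y; have [e_lt e_inj e_fun] := e_arc.
have partP := partition_ofP e_arc; have le := connect_leq e_arc.
apply/(is_arcP _ _ partP)/idP => [[xy]|exy].
  rewrite pblock_partition_of // => xy_same no.
  have cxy : connect e x y by case/orP: xy_same => // /le; rewrite leqNgt xy.
  have [|a exa cay] := connect_first cxy; first by rewrite -val_eqE /= (ltn_eqF xy).
  suff -> : y = a by [].
  apply/val_inj/eqP; rewrite eqn_leq /= (le _ _ cay) andbT; apply: no (e_lt _ _ exa).
  by rewrite pblock_partition_of // /same_block /= connect1.
split; [exact: e_lt|by rewrite pblock_partition_of // /same_block /= connect1|].
move=> l; rewrite pblock_partition_of // => xl_same xl.
have cxl : connect e x l by case/orP: xl_same => // /le; rewrite leqNgt xl.
have [|a exa cal] := connect_first cxl; first by rewrite -val_eqE /= (ltn_eqF xl).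
by rewrite (e_fun _ _ _ exy exa) le.
Qed.

Lemma partition_of_is_arc P : finset.partition P [set: 'I_n] ->
  partition_of (is_arc P) = P.
Proof.
move=> partP; rewrite -[RHS](finset.equivalence_partition_pblock partP).
have arcP := is_arc_rel partP.
have conn x y : connect (is_arc P) x y -> y \in finset.pblock P x.
  case/connectP=> p; elim: p x => [|a p IH] x /=; first by move=> _ ->; exact: mem_pblockT.
  case/andP=> /(is_arcP _ _ partP)[_ ax _] pa y_last.
  by rewrite -(pblock_sym partP ax); apply: IH.
have conv x y : x <= y -> y \in finset.pblock P x -> connect (is_arc P) x y.
  have [k] := ubnP (y - x); elim: k x => // k IH x k_lt le_xy yx.
  have [->|x_neq] := eqVneq x y; first exact: connect0.
  have lt_xy : x < y by rewrite ltn_neqAle le_xy andbT.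
  have y_ok : (y \in finset.pblock P x) && (x < y) by rewrite yx.
  (* The least element of the block beyond [x] is where the arc from [x] ends; the induction
     continues from there. *)
  case: (@arg_minnP _ y (fun l => (l \in finset.pblock P x) && (x < l)) (@nat_of_ord n) y_ok).
  move=> a /andP[ax xa] a_min.
  apply: (connect_trans (y := a)).
    by apply/connect1/(is_arcP _ _ partP); split=> // l lx xl; apply: a_min; rewrite lx.
  have le_ay : a <= y by apply: a_min.
  by apply: IH; rewrite ?(pblock_sym partP ax) //; lia.
rewrite /partition_of /finset.equivalence_partition.
have eqR : same_block (is_arc P) =2 (fun x y => y \in finset.pblock P x).
  move=> x y; apply/idP/idP => [/orP[|] /conn //|yx] /=.
    by move=> xy; rewrite (pblock_sym partP xy) mem_pblockT.
  rewrite /same_block /=; case: (leqP x y) => [le|/ltnW le]; first by rewrite conv.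
  by rewrite (conv y x) ?orbT // (pblock_sym partP yx) mem_pblockT.
by apply: finset.eq_imset => x; apply/finset.setP => y; rewrite !finset.inE eqR.
Qed.

Definition nat_rel e : rel nat := fun i j =>
  [exists x : 'I_n, exists y : 'I_n, [&& e x y, i == x :> nat & j == y :> nat]].

Lemma nat_relP e (i j : nat) :
  reflect (exists x y : 'I_n, [/\ e x y, i = x :> nat & j = y :> nat]) (nat_rel e i j).
Proof.
apply: (iffP existsP) => [[x /existsP[y /and3P[exy /eqP-> /eqP->]]]|].
  by exists x, y.
by case=> x [y [exy -> ->]]; exists x; apply/existsP; exists y; rewrite exy !eqxx.
Qed.

Lemma nat_rel_val e x y : nat_rel e x y = e x y.
Proof.
apply/nat_relP/idP => [[x' [y' [exy /val_inj-> /val_inj->]]]//|exy].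
by exists x, y.
Qed.

Lemma nat_rel_lt e : arc_rel e -> forall i j, nat_rel e i j -> i < j < n.
Proof. by case=> e_lt _ _ i j /nat_relP[x [y [/e_lt ? -> ->]]]; apply/andP. Qed.

Lemma nat_rel_inj e : arc_rel e ->
  forall i i' j, nat_rel e i j -> nat_rel e i' j -> i = i'.
Proof.
case=> _ e_inj _ i i' j /nat_relP[x [y [exy -> ->]]].
by case/nat_relP=> x' [y' [exy' -> /val_inj yy']]; rewrite (e_inj _ x' _ exy) // yy'.
Qed.

Lemma nat_rel_fun e : arc_rel e ->
  forall i j j', nat_rel e i j -> nat_rel e i j' -> j = j'.
Proof.
case=> _ _ e_fun i j j' /nat_relP[x [y [exy -> ->]]].
by case/nat_relP=> x' [y' [exy' /val_inj xx' ->]]; rewrite (e_fun x _ y' exy) // xx'.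
Qed.

(** Since [7 - tau(a)] is 4, 6, 5 for [a = 1, 2, 3], the three openers are closed by the fourth, the
    sixth and the fifth vertex. *)
Definition avoids312 (A : rel nat) : Prop := forall i1 i2 i3 i4 i5 i6,
  i1 < i2 -> i2 < i3 -> i3 < i4 -> i4 < i5 -> i5 < i6 ->
  A i1 i4 -> A i2 i6 -> ~~ A i3 i5.

Lemma perm312E :
  [/\ perm312 (inord 0) = inord 2, perm312 (inord 1) = inord 0 &
      perm312 (inord 2) = inord 1].
Proof.
by split; rewrite permE /oneline312 (tnth_nth ord0) /= inordK.
Qed.

Lemma contains_perm312 P :
  reflect (avoids312 (nat_rel (is_arc P))) (~~ contains_pattern perm312 P).
Proof.
have [p0 p1 p2] := perm312E.
have o3 (a : 'I_3) : [\/ a = inord 0, a = inord 1 | a = inord 2].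
  by case: a => -[|[|[|a]]] a_lt //; [apply: Or31|apply: Or32|apply: Or33];
    apply: val_inj; rewrite /= inordK.
have eL (k : nat) (lt : k < 3) : lshift 3 (inord k : 'I_3) = inord k :> 'I_6.
  by apply: val_inj; rewrite /= !inordK //; lia.
have eR (k : nat) (lt : k < 3) : rev_ord (lshift 3 (inord k : 'I_3)) = inord (5 - k) :> 'I_6.
  by apply: val_inj; rewrite /= !inordK //; lia.
apply: (iffP existsPn) => [no i1 i2 i3 i4 i5 i6 lt12 lt23 lt34 lt45 lt56|avoid i].
  case/nat_relP=> x1 [x4 [e14 E1 E4]]; case/nat_relP=> x2 [x6 [e26 E2 E6]].
  apply/nat_relP => -[x3 [x5 [e35 E3 E5]]].
  have := no [ffun k : 'I_6 => nth x1 [:: x1; x2; x3; x4; x5; x6] k].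
  case/andP; split.
    apply/forallP => -[a a_lt]; apply/forallP => -[b b_lt]; apply/implyP => /= lt.
    rewrite !ffunE /=; move: a_lt b_lt lt.
    by case: a => [|[|[|[|[|[|a]]]]]]; case: b => [|[|[|[|[|[|b]]]]]] //= _ _ _; lia.
  apply/forallP => a; rewrite !ffunE.
  by case: (o3 a) => ->; rewrite ?p0 ?p1 ?p2 eL // eR // !inordK.
apply/negP => /andP[/forallP mono /forallP arc].
have lt k : k < 5 -> i (inord k) < i (inord k.+1).
  move=> k_lt; have /forallP /(_ (inord k.+1)) /implyP := mono (inord k).
  by apply; rewrite !inordK //; lia.
have a0 := arc (inord 0); have a1 := arc (inord 1); have a2 := arc (inord 2).
rewrite p0 eL // eR // in a0; rewrite p1 eL // eR // in a1; rewrite p2 eL // eR // in a2.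
have := avoid _ _ _ _ _ _ (lt 0 isT) (lt 1 isT) (lt 2 isT) (lt 3 isT) (lt 4 isT).
by rewrite !nat_rel_val => /(_ a0 a1) /negP.
Qed.

End ArcsOfPartition.

Lemma opens_no_arc w v j : good w -> v \in opens w -> (v, j) \notin arcs w.
Proof.
elim: w => // -[p b] w IH gw0 v_open; apply/negP => vj.
have /andP[v_lt j_lt] := arcs_lt gw0 vj.
move: gw0 v_open vj => /= /andP[gw p_ok] v_open vj.
have v_neq : (v == size w) = false by apply/eqP; rewrite /= in j_lt; lia.
clear j_lt.
have {}v_open : v \in (if p is Some u then rem u (opens w) else opens w).
  by case: b v_open => //; rewrite inE v_neq.
case: p p_ok vj v_open => [u|] p_ok; last first.
  by move=> vj v_open; have := IH gw v_open; rewrite vj.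
rewrite mem_rem_uniq ?opens_uniq // !inE xpair_eqE => vj /andP[/negbTE vu v_open].
by have := IH gw v_open; move: vj; rewrite vu /= => ->.
Qed.

Lemma arcs_inj w i i' j : good w ->
  (i, j) \in arcs w -> (i', j) \in arcs w -> i = i'.
Proof.
elim: w => // -[[v|] b] w IH /=; last by move=> /andP[gw _]; exact: IH.
move=> /andP[gw _]; rewrite !inE !xpair_eqE.
case: (j =P size w) => [->|_]; rewrite ?andbF ?andbT /=; last exact: IH.
have no k : (k, size w) \in arcs w = false.
  by apply/negP => /(arcs_lt gw); rewrite ltnn andbF.
by rewrite !no !orbF => /eqP-> /eqP->.
Qed.

Lemma arcs_fun w i j j' : good w ->
  (i, j) \in arcs w -> (i, j') \in arcs w -> j = j'.
Proof.
elim: w => // -[[v|] b] w IH /=; last by move=> /andP[gw _]; exact: IH.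
move=> /andP[gw]; rewrite mem_filter => /andP[_ v_open].
have no k : (v, k) \in arcs w = false by apply/negbTE/opens_no_arc.
rewrite !inE !xpair_eqE; case: (i =P v) => [->|_] /=; last exact: IH.
by rewrite !no !orbF => /eqP-> /eqP->.
Qed.

Lemma card_avoiding_partitions n :
  #|avoiding_partitions n perm312| = stack_count n [::].
Proof.
pose word P := word_of n (nat_rel (@is_arc n P)) n.
pose complete := [seq w <- words n | opens w == [::]].
have word_complete P : P \in avoiding_partitions n perm312 -> word P \in complete.
  rewrite finset.inE => /andP[partP /contains_perm312 avoidP].
  have arcP := is_arc_rel partP.
  have A_lt := nat_rel_lt arcP; have A_inj := nat_rel_inj arcP.
  have A_fun := nat_rel_fun arcP.
  by rewrite mem_filter mem_words size_word_of eqxx word_of_complete ?good_word_of.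
have word_inj : {in avoiding_partitions n perm312 &, injective word}.
  move=> P Q; rewrite !finset.inE => /andP[partP _] /andP[partQ _] eq_word.
  rewrite -(partition_of_is_arc partP) -(partition_of_is_arc partQ).
  suff eqA : is_arc P =2 is_arc Q.
    apply: finset.eq_imset => x; apply/finset.setP => y.
    by rewrite !finset.inE /same_block /= !(eq_connect eqA).
  have arcP := is_arc_rel partP; have arcQ := is_arc_rel partQ.
  move=> x y; have := arcs_word_of (nat_rel_lt arcP) (nat_rel_inj arcP) n x y.
  rewrite -/(word P) eq_word.
  rewrite (arcs_word_of (nat_rel_lt arcQ) (nat_rel_inj arcQ)).
  by rewrite !ltn_ord !nat_rel_val.
have word_surj w : w \in complete ->
    exists2 P, P \in avoiding_partitions n perm312 & word P = w.
  rewrite mem_filter mem_words => /and3P[/eqP w_complete /eqP w_size gw].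
  pose e : rel 'I_n := fun x y => (val x, val y) \in arcs w.
  have arc_e : arc_rel e.
    split=> [x y /(arcs_lt gw)/andP[]//|x x' y|x y y'] h h'; apply: val_inj.
      exact: arcs_inj gw h h'.
    exact: arcs_fun gw h h'.
  have partP := partition_ofP arc_e; have arcP := is_arc_rel partP.
  have relE i j : nat_rel (is_arc (partition_of e)) i j = ((i, j) \in arcs w).
    apply/nat_relP/idP => [[x [y [+ -> ->]]]|ij]; first by rewrite is_arc_partition_of.
    have /andP[lt_ij] := arcs_lt gw ij; rewrite w_size => j_lt.
    have i_lt := ltn_trans lt_ij j_lt; exists (Ordinal i_lt), (Ordinal j_lt).
    by rewrite is_arc_partition_of.
  have avoidP : avoids312 (nat_rel (is_arc (partition_of e))).
    move=> i1 i2 i3 i4 i5 i6 lt12 lt23 lt34 lt45 lt56; rewrite !relE => a14 a26.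
    apply/negP => a35; have /andP[_ /hasP[]] := good_avoids gw lt12 lt23 lt34 lt45 a14 a35.
    by exists (i2, i6); rewrite //= eqxx.
  exists (partition_of e).
    by rewrite finset.inE partP; apply/contains_perm312.
  have A_lt := nat_rel_lt arcP; have A_inj := nat_rel_inj arcP.
  have A_fun := nat_rel_fun arcP.
  apply: good_inj => //; rewrite ?size_word_of //.
  - exact: good_word_of.
  - move=> [i j]; rewrite arcs_word_of // relE andbC.
    by case: (boolP (_ \in _)) => //= /(arcs_lt gw); rewrite w_size => /andP[_ ->].
  - by move=> i; rewrite /word word_of_complete // w_complete.
rewrite /stack_count /stacks count_map.
have -> : count (preim stack (pred1 [::])) (words n) = size complete.
  by rewrite size_filter; apply: eq_count => w /=; rewrite stack_eq0.
rewrite cardE -(size_map word); apply/perm_size/uniq_perm.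
- rewrite map_inj_in_uniq ?enum_uniq // => P Q; rewrite !mem_enum; exact: word_inj.
- exact/filter_uniq/words_uniq.
move=> w; apply/mapP/idP => [[P]|/word_surj[P P_in <-]].
  by rewrite mem_enum => P_in ->; apply: word_complete.
by exists P; rewrite ?mem_enum.
Qed.

End Words.

(** * Formal power series *)

Section FpsTheory.
Variable R : comNzRingType.
Implicit Types (f g h : fps R) (p q : {poly R}).

Definition fpsX : fps R := fps_of_poly 'X.

Lemma fps_addE f g n : (f + g) n = f n + g n. Proof. by []. Qed.
Lemma fps_oppE f n : (- f) n = - f n. Proof. by []. Qed.
Lemma fps_subE f g n : (f - g) n = f n - g n. Proof. by []. Qed.
Lemma fps_mulE f g n : (f * g) n = \sum_(i < n.+1) f i * g (n - i)%N.
Proof. by []. Qed.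
Lemma fps_0E n : (0 : fps R) n = 0.
Proof. exact: coef0. Qed.
Lemma fps_1E n : (1 : fps R) n = (n == 0%N)%:R.
Proof. exact: coef1. Qed.

Lemma fps_mul0E f g : (f * g) 0%N = f 0%N * g 0%N.
Proof. by rewrite fps_mulE big_ord1. Qed.

Lemma fps_XmulE f n : (fpsX * f) n = if n is m.+1 then f m else 0.
Proof.
case: n => [|n]; first by rewrite fps_mul0E /fpsX /fps_of_poly coefX mul0r.
rewrite fps_mulE big_ord_recl big_ord_recl /fpsX /fps_of_poly !coefX mul0r mul1r add0r.
by rewrite big1 ?addr0 ?subn1 // => i _; rewrite coefX mul0r.
Qed.

Lemma fps_sumE (I : Type) (r : seq I) (P : pred I) (F : I -> fps R) n :
  (\sum_(i <- r | P i) F i) n = \sum_(i <- r | P i) F i n.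
Proof. by elim/big_rec2: _ => [|i x y _ <-]; rewrite ?fps_0E. Qed.

Lemma fps_cancel_unit f g : f 0%N = 1 -> f * g = 0 -> g = 0.
Proof.
move=> f0 fg; apply/funext => n; rewrite fps_0E.
have [k] := ubnP n; elim: k n => // k IH n n_lt.
have := congr1 (@^~ n) fg; rewrite fps_mulE fps_0E big_ord_recl subn0 f0 mul1r.
rewrite big1 ?addr0 // => -[i i_lt] _; rewrite [X in _ * X]IH ?mulr0 //=.
by rewrite /bump /=; lia.
Qed.

Lemma fps_cancel_X f : fpsX * f = 0 -> f = 0.
Proof.
move=> Xf; apply/funext => n; have := congr1 (@^~ n.+1) Xf.
by rewrite fps_XmulE !fps_0E.
Qed.

Definition agree n f g : Prop := forall m, (m < n)%N -> f m = g m.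

Lemma agree_add n f f' g g' :
  agree n f f' -> agree n g g' -> agree n (f + g) (f' + g').
Proof. by move=> ff' gg' m mn; rewrite !fps_addE ff' // gg'. Qed.

Lemma agree_mul n f f' g g' :
  agree n f f' -> agree n g g' -> agree n (f * g) (f' * g').
Proof.
move=> ff' gg' m mn; rewrite !fps_mulE; apply: eq_bigr => -[i /= im] _.
by rewrite ff' ?gg' //; lia.
Qed.

Lemma agree_X n f g : agree n f g -> agree n.+1 (fpsX * f) (fpsX * g).
Proof. by move=> fg [|m] mn; rewrite !fps_XmulE ?fg. Qed.

End FpsTheory.

Arguments fpsX {R}.

(** From the [n]-th iterate on the first [n] coefficients no longer change, so the diagonal of the
    iterates is a fixed point. *)
Lemma contraction_fixpoint (A : Type) (a : A) (F : (nat -> A) -> nat -> A) :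
  (forall n f g, (forall m, (m < n)%N -> f m = g m) ->
     forall m, (m < n.+1)%N -> F f m = F g m) ->
  exists f, F f = f.
Proof.
move=> F_contr; pose it k := iter k F (fun=> a).
have itE n k k' : (n <= k)%N -> (n <= k')%N ->
    forall m, (m < n)%N -> it k m = it k' m.
  elim: n k k' => // n IH [|k] [|k'] // nk nk'; exact: F_contr (IH _ _ nk nk').
exists (fun n => it n.+1 n); apply/funext => n.
rewrite -[RHS]/(F (it n) n); apply: (F_contr n) => // m mn.
exact: (itE m.+1).
Qed.

Section FpsMap.
Variables (A : comNzRingType) (R : comNzRingType).

Definition fps_map (phi : {rmorphism A -> R}) (F : fps A) : fps R :=
  fun n => phi (F n).

Variable phi : {rmorphism A -> R}.

Lemma fps_map_is_zmod_morphism : zmod_morphism (fps_map phi).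
Proof. by move=> F G; apply/funext => n; rewrite /fps_map fps_subE rmorphB. Qed.

Lemma fps_map_is_monoid_morphism : monoid_morphism (fps_map phi).
Proof.
split=> [|F G]; apply/funext => n; rewrite /fps_map.
  by rewrite !fps_1E rmorph_nat.
by rewrite !fps_mulE rmorph_sum; apply: eq_bigr => i _; rewrite rmorphM.
Qed.

HB.instance Definition _ := GRing.isZmodMorphism.Build (fps A) (fps R)
  (fps_map phi) fps_map_is_zmod_morphism.
HB.instance Definition _ := GRing.isMonoidMorphism.Build (fps A) (fps R)
  (fps_map phi) fps_map_is_monoid_morphism.

Lemma fps_map_X : fps_map phi fpsX = fpsX.
Proof.
by apply/funext => n; rewrite /fps_map /fpsX /fps_of_poly !coefX rmorph_nat.
Qed.

End FpsMap.

Section FpsExtend.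
Variables (A : comNzRingType) (R : comNzRingType) (phi : {rmorphism A -> fps R}).

(* The continuous extension of [phi] that sends the variable to the
   variable. *)
Definition fps_extend (F : fps A) : fps R :=
  fun n => \sum_(m < n.+1) phi (F m) (n - m)%N.

Let ev_poly (p : {poly A}) : fps R := (map_poly phi p).[fpsX].

Lemma fps_XnmulE (f : fps R) m n :
  (fpsX ^+ m * f) n = if (m <= n)%N then f (n - m)%N else 0.
Proof.
elim: m n => [|m IH] n; first by rewrite expr0 mul1r subn0.
by rewrite exprS -mulrA fps_XmulE; case: n => // n; rewrite IH ltnS subSS.
Qed.

Lemma ev_polyE p n : ev_poly p n = \sum_(m < n.+1) phi p`_m (n - m)%N.
Proof.
pose N := maxn (size p) n.+1.
have szN : (size (map_poly phi p) <= N)%N.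
  by rewrite (leq_trans (size_poly _ _)) ?leq_maxl.
rewrite /ev_poly (horner_coef_wide _ szN) fps_sumE.
rewrite (big_ord_widen N (fun m => phi p`_m (n - m)%N)) ?leq_maxr // [RHS]big_mkcond.
by apply: eq_bigr => i _; rewrite coef_map mulrC fps_XnmulE ltnS.
Qed.

(** Each coefficient sees only a truncation, on which the extension is polynomial evaluation;
    multiplicativity is inherited from there. *)
Lemma fps_extend_trunc F N n : (n < N)%N ->
  fps_extend F n = ev_poly (fps_trunc N F) n.
Proof.
move=> nN; rewrite ev_polyE; apply: eq_bigr => -[m /= mn] _.
by rewrite coef_poly (leq_ltn_trans _ nN).
Qed.

Lemma ev_polyM p q : ev_poly (p * q) = ev_poly p * ev_poly q.
Proof. by rewrite /ev_poly rmorphM hornerM. Qed.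

Lemma fps_extend_is_zmod_morphism : zmod_morphism fps_extend.
Proof.
move=> F G; apply/funext => n; rewrite /fps_extend fps_subE -sumrB.
by apply: eq_bigr => m _; rewrite rmorphB.
Qed.

Lemma fps_extend_is_monoid_morphism : monoid_morphism fps_extend.
Proof.
split=> [|F G]; apply/funext => n.
  rewrite /fps_extend big_ord_recl big1 => [|m _]; last by rewrite fps_1E rmorph0 fps_0E.
  by rewrite fps_1E rmorph1 subn0 addr0.
transitivity (ev_poly (fps_trunc n.+1 F * fps_trunc n.+1 G) n).
  rewrite ev_polyE; apply: eq_bigr => -[m /= mn] _.
  by rewrite -fps_mul_trunc.
rewrite ev_polyM !fps_mulE; apply: eq_bigr => -[m /= mn] _.
by rewrite -!fps_extend_trunc //; lia.
Qed.

HB.instance Definition _ := GRing.isZmodMorphism.Build (fps A) (fps R)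
  fps_extend fps_extend_is_zmod_morphism.
HB.instance Definition _ := GRing.isMonoidMorphism.Build (fps A) (fps R)
  fps_extend fps_extend_is_monoid_morphism.

Lemma fps_extend_X : fps_extend fpsX = fpsX.
Proof.
apply/funext => -[|n]; rewrite /fps_extend /fpsX /fps_of_poly.
  by rewrite big_ord1 !coefX rmorph0 fps_0E.
rewrite big_ord_recl big_ord_recl big1 => [|m _]; rewrite !coefX ?rmorph0 ?fps_0E //.
by rewrite rmorph1 add0r addr0 fps_1E subSS subn0; case: n.
Qed.

Lemma fps_extend_const a : fps_extend (fps_of_poly a%:P) = phi a.
Proof.
apply/funext => n; rewrite /fps_extend /fps_of_poly big_ord_recl coefC subn0.
by rewrite big1 ?addr0 // => m _; rewrite coefC rmorph0 fps_0E.
Qed.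

End FpsExtend.

(** * The kernel equation *)

Section TwoVariables.
Variable R : comNzRingType.
Implicit Types (F G : fps {poly R}) (f g : fps R).

Definition fps_const f : fps {poly R} := fps_map (@polyC R : {rmorphism R -> {poly R}}) f.

(** The variable [u], constant in [z]. Coefficients polynomial in [u] allow every series in [z] to
    be substituted for [u]. *)
Definition catalytic : fps {poly R} := fps_of_poly ('X)%:P.

Definition fps_coefu s F : fps R := fun n => (F n)`_s.

Definition fps_shift F : fps {poly R} := fun n => drop_poly 1 (F n).

Definition fps_deriv_u F : fps {poly R} := fun n => (F n)^`().

Lemma catalytic_mulE F n : (catalytic * F) n = 'X * F n.
Proof.
rewrite fps_mulE big_ord_recl subn0 /catalytic /fps_of_poly coefC big1 ?addr0 //.
by move=> m _; rewrite coefC mul0r.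
Qed.

Lemma fps_shiftE F : catalytic * fps_shift F = F - fps_const (fps_coefu 0 F).
Proof.
apply/funext => n; rewrite catalytic_mulE fps_subE.
apply/esym/eqP; rewrite subr_eq; apply/eqP; apply/polyP => -[|i].
  by rewrite coefD coefXM add0r coefC.
by rewrite coefD coefXM coefC addr0 coef_drop_poly addn1.
Qed.

Lemma fps_coefuD s F G : fps_coefu s (F + G) = fps_coefu s F + fps_coefu s G.
Proof. by apply/funext => n; rewrite /fps_coefu fps_addE coefD. Qed.

Lemma fps_coefuM s F G :
  fps_coefu s (F * G) = \sum_(i < s.+1) fps_coefu i F * fps_coefu (s - i) G.
Proof.
apply/funext => n; rewrite fps_sumE /fps_coefu fps_mulE coef_sum.
under eq_bigr => i _ do rewrite coefM.
by rewrite exchange_big; apply: eq_bigr => i _; rewrite fps_mulE.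
Qed.

Lemma fps_coefu_const s f : fps_coefu s (fps_const f) = if s is 0%N then f else 0.
Proof.
apply/funext => n; rewrite /fps_coefu /fps_const /fps_map coefC.
by case: s => //=; rewrite fps_0E.
Qed.

Lemma fps_coefu_constM s f F : fps_coefu s (fps_const f * F) = f * fps_coefu s F.
Proof.
rewrite fps_coefuM big_ord_recl subn0 fps_coefu_const big1 ?addr0 // => i _.
by rewrite fps_coefu_const mul0r.
Qed.

Lemma fps_coefu_catalytic s F :
  fps_coefu s (catalytic * F) = if s is s'.+1 then fps_coefu s' F else 0.
Proof.
apply/funext => n; rewrite /fps_coefu catalytic_mulE coefXM.
by case: s => //=; rewrite fps_0E.
Qed.

Lemma fps_coefu_shift s F : fps_coefu s (fps_shift F) = fps_coefu s.+1 F.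
Proof. by apply/funext => n; rewrite /fps_coefu coef_drop_poly addn1. Qed.

Lemma fps_deriv_uD F G : fps_deriv_u (F + G) = fps_deriv_u F + fps_deriv_u G.
Proof. by apply/funext => n; rewrite /fps_deriv_u fps_addE derivD. Qed.

Lemma fps_deriv_uN F : fps_deriv_u (- F) = - fps_deriv_u F.
Proof. by apply/funext => n; rewrite /fps_deriv_u fps_oppE derivN. Qed.

Lemma fps_deriv_uM F G :
  fps_deriv_u (F * G) = fps_deriv_u F * G + F * fps_deriv_u G.
Proof.
apply/funext => n; rewrite fps_addE /fps_deriv_u !fps_mulE raddf_sum -big_split.
by apply: eq_bigr => i _; exact: derivM.
Qed.

Lemma fps_deriv_u_const f : fps_deriv_u (fps_const f) = 0.
Proof. by apply/funext => n; rewrite /fps_deriv_u derivC fps_0E. Qed.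

Lemma fps_deriv_u_catalytic : fps_deriv_u catalytic = 1.
Proof.
apply/funext => n; rewrite /fps_deriv_u /catalytic /fps_of_poly coefC fps_1E.
by case: n => [|n] /=; rewrite ?derivX ?deriv0.
Qed.

Lemma fps_const_X : fps_const fpsX = fpsX.
Proof. exact: fps_map_X. Qed.

Definition subst_poly (f : fps R) : {rmorphism {poly R} -> fps R} :=
  (horner_eval f \o map_poly (fps_of_poly (R := R) \o polyC)).

Definition fps_subst (f : fps R) (F : fps {poly R}) : fps R :=
  fps_extend (subst_poly f) F.

End TwoVariables.

Section Substitution.
Variable R : comNzRingType.
Implicit Types (F G : fps {poly R}) (f g U : fps R).

Lemma subst_poly_const U c : subst_poly U c%:P = fps_of_poly c%:P.
Proof. by rewrite /subst_poly /= map_polyC /horner_eval hornerC. Qed.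

Lemma subst_poly_X U : subst_poly U 'X = U.
Proof. by rewrite /subst_poly /= map_polyX /horner_eval hornerX. Qed.

Lemma fps_subst_const U f : fps_subst U (fps_const f) = f.
Proof.
apply/funext => n; rewrite /fps_subst /fps_extend big_ord_recr.
rewrite big1 => [|[m mn] _].
  rewrite /fps_const /fps_map !subst_poly_const /fps_of_poly [LHS]/=.
  by rewrite subnn coefC add0r.
rewrite /fps_const /fps_map !subst_poly_const /fps_of_poly coefC.
by rewrite subn_eq0 leqNgt mn.
Qed.

Lemma fps_subst_catalytic U : fps_subst U (catalytic R) = U.
Proof. by rewrite /fps_subst /catalytic fps_extend_const subst_poly_X. Qed.

Lemma fps_subst_X U : fps_subst U fpsX = fpsX.
Proof. exact: fps_extend_X. Qed.

Lemma agree_subst_poly n U U' p :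
  agree n U U' -> agree n (subst_poly U p) (subst_poly U' p).
Proof.
move=> UU'; elim/poly_ind: p => [|p c IH]; first by rewrite !rmorph0.
rewrite !rmorphD !rmorphM !subst_poly_const !subst_poly_X.
by apply: agree_add => //; apply: agree_mul.
Qed.

Lemma agree_subst n U U' F :
  agree n U U' -> agree n (fps_subst U F) (fps_subst U' F).
Proof.
move=> UU' m mn; rewrite /fps_subst /fps_extend; apply: eq_bigr => -[i /= im] _.
by apply: (agree_subst_poly (F i) UU'); lia.
Qed.

Lemma agree_const n f g : agree n f g -> agree n (fps_const f) (fps_const g).
Proof. by move=> fg m mn; rewrite /fps_const /fps_map fg. Qed.

Lemma agree_coefu n s F G :
  agree n F G -> agree n (fps_coefu s F) (fps_coefu s G).
Proof. by move=> FG m mn; rewrite /fps_coefu FG. Qed.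

Lemma agree_shift n F G : agree n F G -> agree n (fps_shift F) (fps_shift G).
Proof. by move=> FG m mn; rewrite /fps_shift FG. Qed.

End Substitution.

Section Kernel.
Variable R : comNzRingType.

(* With [L = \sum_s L_s u^(s-1)]: [m] counts the walks that start right after a
   closing and end on the empty stack, and [L_s] the ways in which a chain can
   be opened and later be part of a closing of total size [s]. *)
Definition stack_equations (L : fps {poly R}) (m : fps R) : Prop :=
  m = 1 + fpsX * ((1 + fps_coefu 0 L) * m) /\
  L = fps_const (1 + fpsX * m) + fpsX * (fps_const m *
        (fps_shift L + catalytic R * ((1 + fps_shift L) * L))).

(** Every occurrence of an unknown on the right carries a factor [fpsX], so the two right sides
    together form a contraction on sequences of pairs. *)
Lemma stack_equations_solvable : exists L m, stack_equations L m.
Proof.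
pose lam (f : nat -> {poly R} * R) : fps {poly R} := fun n => (f n).1.
pose mu (f : nat -> {poly R} * R) : fps R := fun n => (f n).2.
pose step_mu f : fps R := 1 + fpsX * ((1 + fps_coefu 0 (lam f)) * mu f).
pose step_lam f : fps {poly R} := fps_const (1 + fpsX * mu f) +
  fpsX * (fps_const (mu f) *
    (fps_shift (lam f) + catalytic R * ((1 + fps_shift (lam f)) * lam f))).
have contr n f g : (forall k, (k < n)%N -> f k = g k) ->
    forall k, (k < n.+1)%N -> (step_lam f k, step_mu f k) = (step_lam g k, step_mu g k).
  move=> fg.
  have lam_fg : agree n (lam f) (lam g) by move=> k kn; rewrite /lam fg.
  have mu_fg : agree n (mu f) (mu g) by move=> k kn; rewrite /mu fg.
  have sh_fg := agree_shift lam_fg.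
  have lam_ok : agree n.+1 (step_lam f) (step_lam g).
    apply: agree_add.
      by apply: agree_const; apply: agree_add => //; apply: agree_X.
    apply: agree_X; apply: agree_mul; first exact: agree_const.
    apply: agree_add => //; apply: agree_mul => //; apply: agree_mul => //.
    exact: agree_add.
  have mu_ok : agree n.+1 (step_mu f) (step_mu g).
    apply: agree_add => //; apply: agree_X; apply: agree_mul => //.
    by apply: agree_add => //; apply: agree_coefu.
  by move=> k kn; rewrite lam_ok ?mu_ok.
have [f fE] := contraction_fixpoint ((0, 0) : {poly R} * R) contr.
exists (lam f), (mu f); split; apply/funext => n.
  by have := congr1 (fun g => (g n).2) fE.
by have := congr1 (fun g => (g n).1) fE.
Qed.

(** In the differentiated functional equation the derivative of [L] has the coefficient
    [u - z (1 + u + u^2 + 2 u L)]; [U] is its zero. *)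
Lemma kernel_root_exists (L : fps {poly R}) :
  exists U : fps R, U = fpsX * (1 + U + U ^+ 2 + 2 * U * fps_subst U L).
Proof.
pose step (U : fps R) := fpsX * (1 + U + U ^+ 2 + 2 * U * fps_subst U L).
have contr n U U' : agree n U U' -> agree n.+1 (step U) (step U').
  move=> UU'; apply: agree_X; apply: agree_add.
    apply: agree_add; first exact: agree_add.
    by rewrite !expr2; apply: agree_mul.
  apply: agree_mul; last exact: agree_subst.
  exact: agree_mul.
have [U UE] := contraction_fixpoint (0 : R) contr.
by exists U; rewrite -[LHS]UE.
Qed.

(* [D] stands for the derivative of [L] in the catalytic variable: at the root
   of the kernel its coefficient vanishes. *)
Lemma kernel_factor (A : comNzRingType) (z U L D l1 : A) (K := 1 - z - z * l1) :
  U = z * (1 + U + U ^+ 2 + 2 * U * L) ->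
  K * (U * L) = U * (K + z) + z * ((L - l1) * (1 + U * L) + U * (U * L)) ->
  K * (L + U * D) = K + z + z * (D * (1 + U * L) + (L - l1) * (L + U * D) +
    (U * L + U * (L + U * D))) ->
  ((1 + 2 * U) * (z * L) - U) * (1 - (1 - U - U ^+ 2) * (z * L)) = 0 /\
  z * l1 = z * L * (1 - U ^+ 2).
Proof.
move=> UE QE dQE; pose l := z * L.
have dQE' : K * L = K + z + z * ((L - l1) * L + 2 * (U * L)).
  apply/eqP; rewrite -subr_eq0; apply/eqP.
  transitivity (K * (L + U * D) - (K + z + z * (D * (1 + U * L) +
     (L - l1) * (L + U * D) + (U * L + U * (L + U * D)))) -
     D * (U - z * (1 + U + U ^+ 2 + 2 * U * L))); first by rewrite /K; ring.
  by rewrite dQE -UE; ring.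
have l1E : z * l1 = l * (1 - U ^+ 2).
  apply/eqP; rewrite -subr_eq0; apply/eqP.
  transitivity (K * (U * L) - (U * (K + z) +
      z * ((L - l1) * (1 + U * L) + U * (U * L))) -
      U * (K * L - (K + z + z * ((L - l1) * L + 2 * (U * L)))));
    first by rewrite /l; ring.
  by rewrite QE dQE'; ring.
split; last exact: l1E.
have zS : z * (1 + U + U ^+ 2) = U - 2 * U * l.
  transitivity (z * (1 + U + U ^+ 2 + 2 * U * L) - 2 * U * l); first by rewrite /l; ring.
  by rewrite -UE.
have lE : l - l ^+ 2 = z * (1 + 2 * U * l + U ^+ 2 * l).
  apply/eqP; rewrite -subr_eq0; apply/eqP.
  transitivity (z * (K * L - (K + z + z * ((L - l1) * L + 2 * (U * L)))) +
    (z * l1 - l * (1 - U ^+ 2)) * (- z)); first by rewrite /K /l; ring.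
  by rewrite dQE' l1E; ring.
(* [lE] and [zS] are both linear in the [z] outside [l]; eliminating it leaves a polynomial in [U]
   and [l] that splits into the two factors. *)
transitivity ((1 + U + U ^+ 2) * (l - l ^+ 2 - z * (1 + 2 * U * l + U ^+ 2 * l)) +
   (z * (1 + U + U ^+ 2) - (U - 2 * U * l)) * (1 + 2 * U * l + U ^+ 2 * l)).
  by rewrite -/l; ring.
by rewrite lE zS; ring.
Qed.

Lemma fps_deriv_u1 : fps_deriv_u (1 : fps {poly R}) = 0.
Proof.
by apply/funext => n; rewrite /fps_deriv_u fps_1E fps_0E; case: n => *; rewrite derivC.
Qed.

Lemma kernel_parametrization L m : stack_equations L m ->
  exists2 U : fps R, U = fpsX * ((1 + 2 * U) * (1 + U + U ^+ 2)) &
    (1 + fpsX * m) * ((1 + U) * (1 + U ^+ 2) ^+ 2) =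
    (1 + U + U ^+ 3) * (1 + U + U ^+ 2).
Proof.
case=> mE LE; have [U UE] := kernel_root_exists L.
set l1 := fps_coefu 0 L in mE.
pose z : fps R := fpsX; pose K := 1 - z - z * l1.
pose u := catalytic R; pose Z : fps {poly R} := fpsX.
have Km : K * m = 1.
  transitivity (m - z * ((1 + l1) * m)); first by rewrite /K; ring.
  by rewrite {1}mE addrK.
have cD (f g : fps R) : fps_const (f + g) = fps_const f + fps_const g.
  exact: rmorphD.
have cM (f g : fps R) : fps_const (f * g) = fps_const f * fps_const g.
  exact: rmorphM.
have c1 : fps_const (1 : fps R) = 1 by exact: rmorph1.
have sD (F G : fps {poly R}) : fps_subst U (F + G) = fps_subst U F + fps_subst U G.
  exact: rmorphD.
have sN (F : fps {poly R}) : fps_subst U (- F) = - fps_subst U F.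
  exact: rmorphN.
have sM (F G : fps {poly R}) : fps_subst U (F * G) = fps_subst U F * fps_subst U G.
  exact: rmorphM.
have s1 : fps_subst U (1 : fps {poly R}) = 1 by exact: rmorph1.
(* The factor [u] undoes the division by [u] in the shift, and the factor [K] removes [m] because
   [K m = 1]. *)
have QE : fps_const K * (u * L) = u * (fps_const K + Z) +
    Z * ((L - fps_const l1) * (1 + u * L) + u * (u * L)).
  have shE := fps_shiftE L; rewrite -/u -/l1 in shE.
  have kcm : fps_const K * fps_const m = 1 by rewrite -cM Km.
  transitivity (fps_const K * (u * (1 + Z * fps_const m) + Z * (fps_const m *
      (u * fps_shift L + u * ((u + u * fps_shift L) * L))))).
    by congr (_ * _); rewrite {1}LE cD c1 cM fps_const_X -/Z -/u; ring.
  rewrite shE; set k := fps_const K in kcm *; set cm := fps_const m in kcm *.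
  transitivity (u * (k + Z * (k * cm)) + Z * (k * cm *
     ((L - fps_const l1) + u * ((u + (L - fps_const l1)) * L)))); first by ring.
  by rewrite kcm; ring.
have := congr1 (@fps_deriv_u R) QE.
have dZ : fps_deriv_u Z = 0 by rewrite /Z -fps_const_X fps_deriv_u_const.
rewrite !(fps_deriv_uD, fps_deriv_uN, fps_deriv_uM) fps_deriv_u1 dZ !fps_deriv_u_const.
rewrite !fps_deriv_u_catalytic !(mul0r, mulr0, mul1r, add0r, addr0, subr0, oppr0) => dQE.
have := congr1 (fps_subst U) QE; have := congr1 (fps_subst U) dQE.
rewrite !(sD, sM, sN, s1, fps_subst_catalytic, fps_subst_X, fps_subst_const).
move=> dQEU QEU {dQE QE dZ}.
have [lE VE] := kernel_factor UE QEU dQEU.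
set l := fpsX * fps_subst U L in lE VE.
have U0 : U 0%N = 0 by rewrite UE fps_XmulE.
(* [l] is a multiple of [fpsX], so the second factor has constant coefficient 1 and can be
   cancelled. *)
have {}lE : (1 + 2 * U) * l = U.
  apply/eqP; rewrite -subr_eq0; apply/eqP; rewrite mulrC in lE.
  apply: fps_cancel_unit lE.
  by rewrite fps_subE fps_1E fps_mul0E /l fps_XmulE mulr0 subr0.
have zE : U = fpsX * ((1 + 2 * U) * (1 + U + U ^+ 2)).
  transitivity (U * (1 + 2 * U) - 2 * U * ((1 + 2 * U) * l)); first by rewrite lE; ring.
  transitivity ((1 + 2 * U) * (fpsX * (1 + U + U ^+ 2 + 2 * U * fps_subst U L) - 2 * U * l)).
    by rewrite -UE; ring.
  by rewrite /l; ring.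
exists U => //.
have Vl : (1 + 2 * U) * (z * l1) = U * (1 - U ^+ 2) by rewrite VE mulrA lE.
set T := (1 + 2 * U) in lE zE Vl; set S := (1 + U + U ^+ 2) in zE *.
have KE : K * (T * S) = (1 + U) * (1 + U ^+ 2) ^+ 2.
  transitivity (T * S - z * (T * S) - (T * (z * l1)) * S); first by rewrite /K; ring.
  by rewrite -zE Vl /T /S; ring.
rewrite -KE.
transitivity ((K * T + z * T * (K * m)) * S); first by rewrite -/z; ring.
rewrite Km; transitivity ((T - T * (z * l1)) * S); first by rewrite /K; ring.
by rewrite Vl /T; ring.
Qed.

End Kernel.

(** * Generating functions of words with a given stack *)

Lemma fps_boolE (R : comNzRingType) (b : bool) n :
  (b%:R : fps R) n = (b && (n == 0%N))%:R.
Proof. by case: b; [exact: fps_1E | exact: fps_0E]. Qed.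

Section ProductForm.
Variables (R : comNzRingType) (L : fps {poly R}) (m : fps R).
Hypothesis eqs : stack_equations L m.

Let lam s := fps_coefu s L.

(* The walks to [st] followed by a push: each chain contributes a factor that
   only depends on its length. *)
Fixpoint push_gf (st : seq nat) : fps R :=
  if st is c :: r then push_gf r * (fpsX * (m * ((c == 1)%:R + lam c)))
  else fpsX * m.

(** Words whose last letter opens over [r] and words whose last letter leaves [st] without opening
    are both counted by [push_gf], at [r] and at [st]; the 1 is the empty word. *)
Definition stack_gf (st : seq nat) : fps R :=
  if st is c :: r then (c == 1)%:R * push_gf r + push_gf st else 1 + fpsX * m.

Definition closing_gf (s : nat) (r : seq nat) : fps R := push_gf r * lam s.-1.

Definition closed_gf (st : seq nat) : fps R :=
  closing_gf 1 st + (if st is c :: r then closing_gf c.+1 r else 0).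

Lemma m_eq : m = 1 + fpsX * ((1 + lam 0) * m).
Proof. by case: eqs. Qed.

(** In the sum, [i.+1] is the size of the last merged chain, as in [count_closings]; [lam s] belongs
    to the total size [s.+1]. *)
Lemma lam_eq s : lam s = (s == 0%N)%:R * (1 + fpsX * m) + fpsX * (m * (lam s.+1 +
  \sum_(i < s) ((i == 0%N :> nat)%:R + lam i.+1) * lam (s - i.+1))).
Proof.
rewrite /lam {1}eqs.2 fps_coefuD fps_coefu_const -fps_const_X !fps_coefu_constM.
rewrite fps_coefuD fps_coefu_shift fps_coefu_catalytic.
case: s => [|s]; first by rewrite eqxx mul1r big_ord0.
rewrite mul0r fps_coefuM; congr (_ + _ * (_ * (_ + _))); apply: eq_bigr => -[i i_lt] _.
rewrite fps_coefuD fps_coefu_shift subSS /=; congr ((_ + _) * _).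
have <- : fps_const (1 : fps R) = 1 by exact: rmorph1.
by rewrite fps_coefu_const; case: i {i_lt}.
Qed.

Lemma push_gfE st : fpsX * (stack_gf st + closed_gf st) = push_gf st.
Proof.
rewrite /closed_gf /closing_gf; case: st => [|c r] /=.
  rewrite addr0; transitivity (fpsX * (1 + fpsX * ((1 + lam 0) * m))); first by ring.
  by rewrite -m_eq.
set d := (c == 1)%:R; set p := push_gf r.
transitivity (p * (fpsX * ((1 + fpsX * ((1 + lam 0) * m)) * (d + lam c)))); first by ring.
by rewrite -m_eq.
Qed.

Lemma push_gf0 st : push_gf st 0%N = 0.
Proof.
by elim: st => [|c r IH] /=; [rewrite fps_XmulE | rewrite fps_mul0E IH mul0r].
Qed.

Lemma stack_gfE st : stack_gf st = (st == [::])%:R + push_gf st +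
  (if st is 1%N :: r then push_gf r else 0).
Proof.
case: st => [|[|[|c]] r] /=; rewrite ?addr0 ?add0r ?mul0r ?mul1r ?add0r //.
exact: addrC.
Qed.

Lemma closing_gfE s r : closing_gf s.+1 r =
  stack_gf (s.+1 :: r) + \sum_(1 <= c < s.+1) closing_gf (s.+1 - c) (c :: r).
Proof.
rewrite /closing_gf /= big_add1 /= big_mkord lam_eq.
have -> : (s.+1 == 1)%N = (s == 0)%N by [].
set p := push_gf r; set d := (s == 0%N)%:R.
transitivity (d * p + p * (fpsX * (m * (d + lam s.+1))) + \sum_(i < s)
   p * (fpsX * (m * (((i == 0%N :> nat)%:R + lam i.+1) * lam (s - i.+1))))).
  by rewrite -!mulr_sumr; ring.
congr (_ + _); apply: eq_bigr => -[i i_lt] _ /=.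
have -> : (s.+1 - i.+1).-1 = (s - i.+1)%N by lia.
by ring.
Qed.

Lemma closing_count_gf n :
  (forall st, all (leq 1) st -> (stack_count n st)%:R = stack_gf st n) ->
  forall s r, all (leq 1) r -> (closing_count n s.+1 r)%:R = closing_gf s.+1 r n.
Proof.
move=> stackE s; have [k] := ubnP s; elim: k s => // k IH s s_lt r r_gt0.
rewrite closing_countE natrD stackE // natr_sum closing_gfE fps_addE fps_sumE.
congr (_ + _); rewrite big_nat [RHS]big_nat; apply: eq_bigr => c /andP[c_gt0 c_lt].
have -> : (s.+1 - c = (s - c).+1)%N by lia.
by rewrite IH //=; [lia | rewrite c_gt0].
Qed.

Lemma stack_count_gf n st : all (leq 1) st -> (stack_count n st)%:R = stack_gf st n.
Proof.
elim: n st => [|n IH] st st_gt0.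
  rewrite stack_count0 stack_gfE !fps_addE push_gf0.
  have -> : (if st is 1%N :: r then push_gf r else 0) 0%N = 0.
    by case: (st) => [|[|[|?]] ?]; rewrite ?fps_0E ?push_gf0.
  by rewrite !addr0 fps_boolE andbT.
have closeE := closing_count_gf IH.
have closedE t : all (leq 1) t ->
    (stack_count n t + closed_count n t)%:R = (stack_gf t + closed_gf t) n.
  move=> t_gt0; rewrite natrD IH // /closed_count natrD closeE // !fps_addE.
  congr (_ + (_ + _)); case: t t_gt0 => [|c r] /=; first by rewrite fps_0E.
  by case/andP=> _ r_gt0; rewrite closeE.
rewrite stack_countS // natrD closedE // [in RHS]stack_gfE -push_gfE.
rewrite [RHS]fps_addE [X in _ = X + _]fps_addE fps_XmulE.
have -> : ((st == [::])%:R : fps R) n.+1 = 0 by rewrite fps_boolE andbF.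
rewrite add0r; congr (_ + _); case: (st) st_gt0 => [|[|[|c]] r] r_gt0; rewrite ?fps_0E //.
by rewrite closedE // -push_gfE fps_XmulE.
Qed.

End ProductForm.

(** * The cubic *)

Lemma genfun312_parametrization : exists2 U : fps int,
  U = fpsX * ((1 + 2 * U) * (1 + U + U ^+ 2)) &
  genfun312 * ((1 + U) * (1 + U ^+ 2) ^+ 2) = (1 + U + U ^+ 3) * (1 + U + U ^+ 2).
Proof.
have [L [m eqs]] := stack_equations_solvable int.
have [U UE mU] := kernel_parametrization eqs; exists U => //; rewrite -mU.
congr (_ * _); apply/funext => n.
by rewrite /genfun312 card_avoiding_partitions -natz (stack_count_gf eqs).
Qed.

(** The cubic has degree 5 in [z = U / T] and degree 3 in [B], a fraction over [D]; the factor
    [T ^+ 5 * D ^+ 3] clears the denominators and leaves a polynomial identity in [U]. *)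
Lemma cubic312_identity (R : comNzRingType) (z B U T D : R) :
  z * T = U -> B * D = (1 + U + U ^+ 3) * (1 + U + U ^+ 2) ->
  T = (1 + 2 * U) * (1 + U + U ^+ 2) -> D = (1 + U) * (1 + U ^+ 2) ^+ 2 ->
  T ^+ 5 * D ^+ 3 *
  ((z - 1) * (5 * z ^+ 2 - 2 * z + 1) ^+ 2 * B ^+ 3 +
   (- 9 * z ^+ 5 + 54 * z ^+ 4 - 85 * z ^+ 3 + 59 * z ^+ 2 - 14 * z + 3) * B ^+ 2 +
   (- 9 * z ^+ 4 + 60 * z ^+ 3 - 64 * z ^+ 2 + 13 * z - 3) * B +
   (- 9 * z ^+ 3 + 23 * z ^+ 2 - 4 * z + 1)) = 0.
Proof.
move=> zT BD TE DE; set N := (1 + U + U ^+ 3) * _ in BD.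
transitivity
  ((z * T - T) * (5 * (z * T) ^+ 2 - 2 * (z * T) * T + T ^+ 2) ^+ 2 * (B * D) ^+ 3 +
   (- 9 * (z * T) ^+ 5 + 54 * (z * T) ^+ 4 * T - 85 * (z * T) ^+ 3 * T ^+ 2 +
    59 * (z * T) ^+ 2 * T ^+ 3 - 14 * (z * T) * T ^+ 4 + 3 * T ^+ 5) * (B * D) ^+ 2 * D +
   (- 9 * (z * T) ^+ 4 * T + 60 * (z * T) ^+ 3 * T ^+ 2 - 64 * (z * T) ^+ 2 * T ^+ 3 +
    13 * (z * T) * T ^+ 4 - 3 * T ^+ 5) * (B * D) * D ^+ 2 +
   (- 9 * (z * T) ^+ 3 * T ^+ 2 + 23 * (z * T) ^+ 2 * T ^+ 3 - 4 * (z * T) * T ^+ 4 +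
    T ^+ 5) * D ^+ 3); first by ring.
by rewrite zT BD /N TE DE; ring.
Qed.

Lemma fps_exp0E (R : comNzRingType) (f : fps R) k : (f ^+ k) 0%N = f 0%N ^+ k.
Proof.
elim: k => [|k IH]; first by rewrite !expr0 fps_1E.
by rewrite !exprS fps_mul0E IH.
Qed.

Lemma horner_cubic (A R : comNzRingType) (phi : {rmorphism A -> R}) (c0 c1 c2 c3 : A) x :
  (map_poly phi (c3%:P * 'X ^+ 3 + c2%:P * 'X ^+ 2 + c1%:P * 'X + c0%:P)).[x] =
  phi c3 * x ^+ 3 + phi c2 * x ^+ 2 + phi c1 * x + phi c0.
Proof.
rewrite !rmorphD 3!rmorphM 2!rmorphXn /= !map_polyC map_polyX.
by rewrite !(hornerD, hornerM, hornerXn, hornerX, hornerC).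
Qed.

Lemma root_cubic312 : root (map_poly (@fps_of_poly int) cubic312) genfun312.
Proof.
have [U UE BE] := genfun312_parametrization.
have U0 : U 0%N = 0 by rewrite UE fps_XmulE.
have := cubic312_identity (esym UE) BE erefl erefl.
set T := (1 + 2 * U) * _; set D := (1 + U) * _; set c := (X in _ * X = 0) => cE.
have {cE} c0 : c = 0.
  apply: fps_cancel_unit cE.
  rewrite /T /D !(fps_mul0E, fps_exp0E, fps_addE, fps_1E, U0) eqxx.
  by rewrite !(mulr0, expr0n, addr0, expr1n, mulr1).
apply/rootP; rewrite -[RHS]c0 /cubic312 /c.
by rewrite horner_cubic /fpsX; ring.
Qed.

Local Open Scope classical_set_scope.
Local Open Scope ring_scope.

(** * Absolutely convergent power series *)

Section PartialSums.
Variable R : comNzRingType.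
Implicit Types f g : fps R.

Definition psum f (N : nat) : R := \sum_(i < N) f i.

Lemma psum0 f : psum f 0 = 0. Proof. exact: big_ord0. Qed.

Lemma psumS f N : psum f N.+1 = psum f N + f N.
Proof. exact: big_ord_recr. Qed.

Lemma psumD f g N : psum (f + g) N = psum f N + psum g N.
Proof. by rewrite /psum -big_split. Qed.

Lemma psumN f N : psum (- f) N = - psum f N.
Proof. by rewrite /psum -sumrN. Qed.

Lemma psumM f g N : psum (f * g) N = \sum_(i < N) f i * psum g (N - i).
Proof.
elim: N => [|N IH]; first by rewrite psum0 big_ord0.
rewrite psumS IH fps_mulE big_ord_recr [RHS]big_ord_recr /= addrA -big_split /=.
congr (_ + _ * _); last by rewrite subnn subSn // subnn psumS psum0 add0r.
by apply: eq_bigr => -[i i_lt] _; rewrite /= subSn ?psumS ?mulrDr // ltnW.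
Qed.

End PartialSums.

Section AbsoluteConvergence.
Variable R : realType.
Implicit Types (f g h w : fps R) (c : R).

Definition fps_abs f : fps R := fun n => `|f n|.

Definition asum f : nat -> R := psum (fps_abs f).

Lemma asum_ge0 f N : 0 <= asum f N.
Proof. by apply: sumr_ge0 => i _; exact: normr_ge0. Qed.

Lemma asum_mono f M N : (M <= N)%N -> asum f M <= asum f N.
Proof.
move=> /subnK <-; elim: (N - M)%N => // k IH.
by rewrite addSn /asum psumS ler_wpDr // normr_ge0.
Qed.

Lemma psum_le f g N : (forall i, f i <= g i) -> psum f N <= psum g N.
Proof. by move=> fg; apply: ler_sum => i _. Qed.

Lemma asumD f g N : asum (f + g) N <= asum f N + asum g N.
Proof. by rewrite -psumD; apply: psum_le => i; exact: ler_normD. Qed.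

Lemma asumN f N : asum (- f) N = asum f N.
Proof. by apply: eq_bigr => i _; exact: normrN. Qed.

Lemma asum_psumM f g N : asum (f * g) N <= \sum_(i < N) `|f i| * asum g (N - i).
Proof.
rewrite -(psumM (fps_abs f) (fps_abs g)); apply: psum_le => n.
apply: le_trans (ler_norm_sum _ _ _) _; rewrite fps_mulE.
by apply: ler_sum => i _; rewrite normrM.
Qed.

Lemma asumM f g N : asum (f * g) N <= asum f N * asum g N.
Proof.
apply: le_trans (asum_psumM _ _ _) _; rewrite mulr_suml.
apply: ler_sum => i _; apply: ler_wpM2l; first exact: normr_ge0.
exact: asum_mono (leq_subr _ _).
Qed.

Definition abounded (C : R) f : Prop := forall N, asum f N <= C.

Definition ell1 f : Prop := exists C, abounded C f.

Lemma abounded_ge0 C f : abounded C f -> 0 <= C.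
Proof. by move/(_ 0%N); rewrite /asum psum0. Qed.

Lemma aboundedD C D f g : abounded C f -> abounded D g -> abounded (C + D) (f + g).
Proof. by move=> fC gD N; apply: le_trans (asumD _ _ _) _; exact: lerD. Qed.

Lemma aboundedM C D f g : abounded C f -> abounded D g -> abounded (C * D) (f * g).
Proof.
move=> fC gD N; apply: le_trans (asumM _ _ _) _.
by apply: ler_pM; rewrite ?asum_ge0.
Qed.

Lemma aboundedN C f : abounded C f -> abounded C (- f).
Proof. by move=> fC N; rewrite asumN. Qed.

Definition fps_cst c : fps R := fps_of_poly c%:P.

Lemma fps_cst_is_zmod_morphism : zmod_morphism fps_cst.
Proof. by move=> c d; rewrite /fps_cst !rmorphB. Qed.

Lemma fps_cst_is_monoid_morphism : monoid_morphism fps_cst.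
Proof. by split=> [|c d]; rewrite /fps_cst ?rmorph1 ?rmorphM. Qed.

HB.instance Definition _ := GRing.isZmodMorphism.Build R (fps R)
  fps_cst fps_cst_is_zmod_morphism.
HB.instance Definition _ := GRing.isMonoidMorphism.Build R (fps R)
  fps_cst fps_cst_is_monoid_morphism.

Lemma fps_cstE c n : fps_cst c n = if n is 0%N then c else 0.
Proof. by rewrite /fps_cst /fps_of_poly coefC; case: n. Qed.

Lemma fps_cst_mulE c f n : (fps_cst c * f) n = c * f n.
Proof.
rewrite fps_mulE big_ord_recl fps_cstE subn0 big1 ?addr0 // => i _.
by rewrite fps_cstE mul0r.
Qed.

Lemma abounded_cst c : abounded `|c| (fps_cst c).
Proof.
case=> [|N]; first by rewrite /asum psum0.
rewrite /asum /psum big_ord_recl big1 ?addr0 /fps_abs ?fps_cstE // => i _.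
by rewrite fps_cstE normr0.
Qed.

Lemma abounded_X C f : abounded C f -> abounded C (fpsX * f).
Proof.
move=> fC [|N]; first by rewrite /asum psum0 (abounded_ge0 fC).
apply: le_trans (fC N); rewrite /asum /psum big_ord_recl /fps_abs fps_XmulE normr0 add0r.
by apply: ler_sum => i _; rewrite fps_XmulE.
Qed.

Lemma ell1D f g : ell1 f -> ell1 g -> ell1 (f + g).
Proof. by move=> [C fC] [D gD]; exists (C + D); exact: aboundedD. Qed.

Lemma ell1M f g : ell1 f -> ell1 g -> ell1 (f * g).
Proof. by move=> [C fC] [D gD]; exists (C * D); exact: aboundedM. Qed.

Lemma ell1N f : ell1 f -> ell1 (- f).
Proof. by move=> [C fC]; exists C; exact: aboundedN. Qed.

Lemma ell1_cst c : ell1 (fps_cst c).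
Proof. by exists `|c|; exact: abounded_cst. Qed.

(** The first [N] coefficients of the fixed point are those of the [N]-th iterate of 0, which stays
    in the ball; bounds on partial sums need no more. *)
Lemma abounded_fixpoint (F : fps R -> fps R) C f :
  (forall n g h, agree n g h -> agree n.+1 (F g) (F h)) ->
  (forall g, abounded C g -> abounded C (F g)) ->
  0 <= C -> F f = f -> abounded C f.
Proof.
move=> F_contr F_bnd C_ge0 fE N.
have sum_agree n g h : agree n g h -> asum g n = asum h n.
  by move=> gh; apply: eq_bigr => i _; rewrite /fps_abs gh.
have [g gC fg] : exists2 g, abounded C g & agree N f g.
  elim: N => [|N [g gC fg]].
    by exists (fps_cst 0) => // N; apply: le_trans (abounded_cst _ _) _; rewrite normr0.
  by exists (F g); [exact: F_bnd | rewrite -fE; exact: F_contr].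
by rewrite (sum_agree _ _ _ fg).
Qed.

Definition fps_tail f : fps R := fun n => f n.+1.

Lemma fps_tailE f : f = fps_cst (f 0%N) + fpsX * fps_tail f.
Proof.
by apply/funext => -[|n]; rewrite fps_addE fps_cstE fps_XmulE ?addr0 ?add0r.
Qed.

Lemma abounded_tail C f : f 0%N = 0 -> abounded C f -> abounded C (fps_tail f).
Proof.
move=> f0 fC N; apply: le_trans (fC N.+1).
by rewrite /asum /psum big_ord_recl /= lerDr normr_ge0.
Qed.

Lemma fps_tailE0 f : f 0%N = 0 -> f = fpsX * fps_tail f.
Proof. by move=> f0; rewrite {1}[f]fps_tailE f0 rmorph0 add0r. Qed.

Lemma fps_fixpoint (F : fps R -> fps R) :
  (forall n g h, agree n g h -> agree n.+1 (F g) (F h)) -> exists f, F f = f.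
Proof. exact: (contraction_fixpoint (0 : R)). Qed.

(** The inverse is the fixed point of [t = 1 - w t]. The ball of radius [1 / (1 - th)] is preserved
    since [1 + th / (1 - th) = 1 / (1 - th)]. *)
Lemma ell1_inverse w (th : R) : w 0%N = 0 -> abounded th w -> th < 1 ->
  exists2 t, (1 + w) * t = 1 & ell1 t.
Proof.
move=> w0 wth th1; pose F t : fps R := fps_cst 1 - fpsX * (fps_tail w * t).
have F_contr n g h : agree n g h -> agree n.+1 (F g) (F h).
  move=> gh; apply: agree_add => //.
  by move=> m mn; rewrite !fps_oppE; congr (- _); apply: agree_X m mn; exact: agree_mul.
have [t tE] := fps_fixpoint F_contr.
exists t.
  rewrite [in LHS](fps_tailE0 w0); transitivity (t + fpsX * (fps_tail w * t)); first by ring.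
  by rewrite -{1}tE /F rmorph1 subrK.
have th_gt : 0 < 1 - th by lra.
exists ((1 - th)^-1); apply: abounded_fixpoint F_contr _ _ tE; last by rewrite invr_ge0 ltW.
move=> g gC; have -> : (1 - th)^-1 = `|1| + th * (1 - th)^-1.
  by rewrite normr1; field; rewrite gt_eqF.
apply: aboundedD; first exact: abounded_cst.
by apply/aboundedN/abounded_X/aboundedM => //; exact: abounded_tail.
Qed.

(* [s = 1 - X e] with [e = (X e^2 - w / X) / 2]: the bound [th] on the absolute
   sum is preserved since [(th^2 + th) / 2 <= th]. *)
Lemma ell1_sqrt w (th : R) : w 0%N = 0 -> abounded th w -> th < 1 ->
  exists s, [/\ s ^+ 2 = 1 + w, s 0%N = 1 & exists2 e, s = 1 - e & e 0%N = 0 /\ abounded th e].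
Proof.
move=> w0 wth th1.
pose F e : fps R := fps_cst (2^-1) * (fpsX * (e * e) - fps_tail w).
have F_contr n g h : agree n g h -> agree n.+1 (F g) (F h).
  move=> gh; apply: agree_mul => //; apply: agree_add => //.
  by apply: agree_X; exact: agree_mul.
have [e eE] := fps_fixpoint F_contr.
have e2 : 2 * e = fpsX * (e * e) - fps_tail w.
  rewrite -{1}[e]eE /F mulrA -[2]/(2%:R) -(rmorph_nat (fps_cst : {rmorphism R -> fps R})).
  by rewrite -rmorphM /= divff ?pnatr_eq0 // rmorph1 mul1r.
have th0 := abounded_ge0 wth.
exists (1 - fpsX * e); split.
- rewrite [in RHS](fps_tailE0 w0).
  transitivity (1 - fpsX * (2 * e) + fpsX * (fpsX * (e * e))); first by ring.
  by rewrite e2; ring.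
- by rewrite fps_subE fps_XmulE fps_1E subr0.
exists (fpsX * e) => //; split; first by rewrite fps_XmulE.
apply/abounded_X; apply: (abounded_fixpoint F_contr _ th0 eE).
move=> g gth N; apply: (@le_trans _ _ (`|2^-1| * (th * th + th))).
  apply: aboundedM; first exact: abounded_cst.
  apply: aboundedD; first by apply/abounded_X/aboundedM.
  by apply/aboundedN/abounded_tail.
rewrite ger0_norm ?invr_ge0 //; nra.
Qed.

(** * Evaluation at the radius of convergence *)

Definition fsum f : R := limn (psum f).

Lemma ell1_abs_cvg f : ell1 f -> cvgn (asum f).
Proof.
move=> [C fC]; apply: nondecreasing_is_cvgn => [m n mn|]; first exact: asum_mono.
by exists C => _ [n _ <-].
Qed.

Lemma psum_series f : psum f = series f.
Proof. by apply/funext => N; rewrite /series /= big_mkord. Qed.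

Lemma fsum_cvg f : ell1 f -> psum f @ \oo --> fsum f.
Proof.
move=> /ell1_abs_cvg; rewrite /asum /fsum !psum_series => f_cvg.
exact: (@normed_cvg R R f f_cvg).
Qed.

Lemma fsum_eq f l : psum f @ \oo --> l -> fsum f = l.
Proof. exact: cvg_lim. Qed.

Lemma fsumD f g : ell1 f -> ell1 g -> fsum (f + g) = fsum f + fsum g.
Proof.
move=> /fsum_cvg f_cvg /fsum_cvg g_cvg; apply: fsum_eq.
have -> : psum (f + g) = psum f \+ psum g by apply/funext => N; rewrite psumD.
exact: cvgD.
Qed.

Lemma fsumN f : ell1 f -> fsum (- f) = - fsum f.
Proof.
move=> /fsum_cvg f_cvg; apply: fsum_eq.
have -> : psum (- f) = - psum f :> (nat -> R) by apply/funext => N; rewrite psumN.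
exact: cvgN.
Qed.

Lemma fsum_cst c : fsum (fps_cst c) = c.
Proof.
apply: fsum_eq; rewrite -cvg_shiftS; apply: cvg_near_cst.
apply: nearW => N /=; rewrite /psum big_ord_recl big1 ?addr0 ?fps_cstE //.
by move=> i _; rewrite fps_cstE.
Qed.

Lemma norm_psum_le f N : `|psum f N| <= asum f N.
Proof. exact: ler_norm_sum. Qed.

Lemma fsum_le C f : abounded C f -> `|fsum f| <= C.
Proof.
move=> fC; have f_cvg : `|psum f N| @[N --> \oo] --> `|fsum f|.
  by apply: cvg_norm; apply: fsum_cvg; exists C.
rewrite -(cvg_lim _ f_cvg) //; apply: limr_le; first exact: cvgP f_cvg.
by apply: nearW => N; apply: le_trans (norm_psum_le _ _) (fC N).
Qed.

(** Dominated convergence for sums: the tail is small uniformly in [N], the finite head tends to 0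
    term by term. *)
Lemma tannery f (c : nat -> nat -> R) (C : R) : ell1 f ->
  (forall N i, (i < N)%N -> `|c N i| <= C) ->
  (forall i, c N i @[N --> \oo] --> 0) ->
  (fun N => \sum_(i < N) f i * c N i) @ \oo --> 0.
Proof.
move=> f_ell1 c_le c_cvg; pose A := limn (asum f).
have A_cvg : asum f N @[N --> \oo] --> A by apply: ell1_abs_cvg.
have C_ge0 : 0 <= C by apply: le_trans (c_le 1%N 0%N _); rewrite ?normr_ge0.
(* Beyond [J] two partial sums of absolute values differ by at most [2 del], and
   [2 del C <= eps / 2]; adding 1 to [C] keeps the divisor positive. *)
apply/cvgrPdist_le => eps eps0; pose del := eps / 4 / (C + 1).
have C1_gt0 : 0 < C + 1 by lra.
have del0 : 0 < del by rewrite /del !divr_gt0.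
have /cvgrPdist_le/(_ del del0)[J _ JP] := A_cvg.
have fin_cvg : (fun N => \sum_(i < J) f i * c N i) @ \oo --> 0.
  have sum0 : \sum_(i < J) f i * 0 = 0 by rewrite big1 // => i _; rewrite mulr0.
  rewrite -[X in _ --> X]sum0; apply: cvg_big => [|i _]; first exact: add_continuous.
  by apply: cvgM (c_cvg i); exact: cvg_cst.
have eps2 : 0 < eps / 2 by lra.
have /cvgrPdist_le/(_ _ eps2) fin_le := fin_cvg.
near=> N.
have JN : (J <= N)%N by near: N; exact: nbhs_infty_ge.
have fin_leN : `|0 - \sum_(i < J) f i * c N i| <= eps / 2 by near: N.
rewrite sub0r normrN in fin_leN; rewrite sub0r normrN.
rewrite -(big_mkord xpredT (fun i => f i * c N i)) (big_cat_nat _ JN) //= big_mkord.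
apply: le_trans (ler_normD _ _) _.
suff : `|\sum_(J <= i < N) f i * c N i| <= eps / 2 by lra.
apply: (@le_trans _ _ (C * (asum f N - asum f J))).
  have -> : asum f N - asum f J = \sum_(J <= i < N) `|f i|.
    rewrite /asum /psum -!(big_mkord xpredT (fun i => `|f i|)).
    by rewrite [X in X - _](big_cat_nat _ JN) //= addrAC subrr add0r.
  apply: le_trans (ler_norm_sum _ _ _) _; rewrite mulr_sumr big_nat [leRHS]big_nat.
  apply: ler_sum => i /andP[_ iN]; rewrite normrM mulrC.
  by apply: ler_wpM2r; rewrite ?normr_ge0 ?c_le.
have JA := JP J (leqnn J); have NA := JP N JN.
have : asum f N - asum f J <= 2 * del.
  move: JA NA; rewrite /= !ler_norml => /andP[? ?] /andP[? ?]; lra.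
move=> /(ler_wpM2l C_ge0) /le_trans; apply.
have -> : C * (2 * del) = eps / 2 * (C / (C + 1)).
  by rewrite /del; field; rewrite gt_eqF.
apply: ler_piMr; first lra.
rewrite ler_pdivrMr //; lra.
Unshelve. all: by end_near. Qed.

(** As in the theorem of Mertens: the error against the product of the partial sums is a sum of
    [f i] times differences of partial sums of [g], to which [tannery] applies. *)
Lemma fsumM f g : ell1 f -> ell1 g -> fsum (f * g) = fsum f * fsum g.
Proof.
move=> f_ell1 g_ell1; apply: fsum_eq.
have f_cvg := fsum_cvg f_ell1; have g_cvg := fsum_cvg g_ell1.
pose c N i := psum g N - psum g (N - i).
have -> : psum (f * g) = (fun N => psum f N * psum g N - \sum_(i < N) f i * c N i).
  apply/funext => N; rewrite psumM /c /psum mulr_suml -sumrB.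
  by apply: eq_bigr => i _; ring.
rewrite -[X in _ --> X]subr0; apply: cvgB; first exact: cvgM.
have [C gC] := g_ell1.
apply: (@tannery f c (2 * C)) => // [N i _|i].
  apply: le_trans (ler_normB _ _) _.
  have := le_trans (norm_psum_le g N) (gC N).
  by have := le_trans (norm_psum_le g (N - i)) (gC _); lra.
rewrite -[X in _ --> X](subrr (fsum g)); apply: cvgB => //.
rewrite -(cvg_shiftn i); apply: cvg_trans g_cvg; apply: near_eq_cvg.
by apply: nearW => N /=; rewrite addnK.
Qed.

Lemma fsum1 : fsum 1 = 1.
Proof. by rewrite -(rmorph1 (fps_cst : {rmorphism R -> fps R})) fsum_cst. Qed.

(** * The algebra of tame series *)

Definition fps_deriv f : fps R := fun n => (n.+1)%:R * f n.+1.

Let theta f : fps R := fun n => n%:R * f n.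

Lemma X_fps_deriv f : fpsX * fps_deriv f = theta f.
Proof. by apply/funext => -[|n]; rewrite fps_XmulE /theta ?mul0r. Qed.

Lemma fps_derivD f g : fps_deriv (f + g) = fps_deriv f + fps_deriv g.
Proof. by apply/funext => n; rewrite fps_addE /fps_deriv fps_addE mulrDr. Qed.

Lemma fps_derivN f : fps_deriv (- f) = - fps_deriv f.
Proof. by apply/funext => n; rewrite fps_oppE /fps_deriv fps_oppE mulrN. Qed.

Lemma fps_deriv_cst c : fps_deriv (fps_cst c) = 0.
Proof. by apply/funext => n; rewrite fps_0E /fps_deriv fps_cstE mulr0. Qed.

Lemma fps_deriv1 : fps_deriv 1 = 0.
Proof. by rewrite -(rmorph1 (fps_cst : {rmorphism R -> fps R})) fps_deriv_cst. Qed.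

Lemma fps_derivX : fps_deriv fpsX = 1.
Proof.
apply/funext => n; rewrite /fps_deriv /fpsX /fps_of_poly coefX fps_1E.
by case: n => [|n]; rewrite ?mulr1 ?mulr0.
Qed.

(** After multiplication by [fpsX] the derivative multiplies the [n]-th coefficient by [n], and the
    product rule becomes [n = i + (n - i)]. *)
Lemma fps_derivM f g : fps_deriv (f * g) = fps_deriv f * g + f * fps_deriv g.
Proof.
apply/eqP; rewrite -subr_eq0; apply/eqP/fps_cancel_X.
transitivity (fpsX * fps_deriv (f * g) - ((fpsX * fps_deriv f) * g + f * (fpsX * fps_deriv g))).
  by ring.
rewrite !X_fps_deriv; apply/eqP; rewrite subr_eq0; apply/eqP/funext => n.
rewrite fps_addE /theta !fps_mulE mulr_sumr -big_split; apply: eq_bigr => -[i i_lt] _ /=.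
by rewrite -{1}(subnKC (i_lt : (i <= n)%N)) natrD; ring.
Qed.

End AbsoluteConvergence.

Section Tame.
Variable R : realType.
Implicit Types (f g h : fps R) (c : R).

(* The coefficients of (1 - x)^(-1/2). *)
Fixpoint cbin (n : nat) : R :=
  if n is k.+1 then cbin k * ((k%:R + 2^-1) / k.+1%:R) else 1.

Definition isqrt : fps R := cbin.

Lemma cbin_gt0 n : 0 < cbin n.
Proof. by elim: n => //= n IH; rewrite mulr_gt0 // divr_gt0 // ltr_wpDl. Qed.

Lemma cbinS n : (n.+1)%:R * cbin n.+1 = (n%:R + 2^-1) * cbin n.
Proof.
by rewrite /= mulrC -mulrA divfK ?pnatr_eq0 // mulrC.
Qed.

Lemma isqrt_deriv : (1 - fpsX) * (2 * fps_deriv isqrt) = isqrt.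
Proof.
transitivity (2 * (fps_deriv isqrt - fpsX * fps_deriv isqrt)); first by ring.
have -> : 2 = fps_cst 2 :> fps R by rewrite rmorph_nat.
apply/funext => n; rewrite fps_cst_mulE fps_subE X_fps_deriv.
by rewrite /fps_deriv /isqrt cbinS; field.
Qed.

(** By [isqrt_deriv] the left side has derivative 0, so it equals its constant coefficient. *)
Lemma isqrt_sqr : (1 - fpsX) * isqrt ^+ 2 = 1.
Proof.
have d0 : fps_deriv ((1 - fpsX) * isqrt ^+ 2) = 0.
  rewrite expr2 !fps_derivM fps_derivD fps_derivN fps_deriv1 fps_derivX.
  transitivity (isqrt * ((1 - fpsX) * (2 * fps_deriv isqrt) - isqrt)); first by ring.
  by rewrite isqrt_deriv subrr mulr0.
apply/funext => -[|n]; rewrite fps_1E /=.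
  by rewrite fps_mul0E fps_subE fps_1E expr2 fps_mul0E /fpsX /fps_of_poly coefX /isqrt /=; ring.
have := congr1 (@^~ n) d0; rewrite /fps_deriv fps_0E => /eqP.
by rewrite mulf_eq0 pnatr_eq0 => /eqP.
Qed.

Lemma cbin_psum n : n%:R * cbin n = psum isqrt n / 2.
Proof.
elim: n => [|n IH]; first by rewrite psum0 !mul0r.
by rewrite cbinS psumS mulrDl mulrDl IH mulrC [2^-1 * _]mulrC.
Qed.

Lemma cbin_le1 n : cbin n <= 1.
Proof.
elim: n => //= n IH; rewrite -[leRHS]mulr1; apply: ler_pM => //.
- exact/ltW/cbin_gt0.
- by rewrite ler_pdivrMr // mul1r -[n.+1]addn1 natrD lerD2l; lra.
Qed.

(* The sequence [n cbin(n)^2] increases, as in Wallis' product. *)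
Lemma cbin_sqr_ge n : 1 <= 4 * (n.+1)%:R * cbin n.+1 ^+ 2.
Proof.
elim: n => [|n IH]; first by rewrite /=; lra.
apply: le_trans IH _; set m : R := n.+1%:R.
have m_gt0 : 0 < m by rewrite ltr0n.
have S : (m + 1) * cbin n.+2 = (m + 2^-1) * cbin n.+1.
  by rewrite -cbinS -[n.+2]addn1 natrD.
have -> : n.+2%:R = m + 1 by rewrite -[n.+2]addn1 natrD.
have cE : cbin n.+2 = (m + 2^-1) / (m + 1) * cbin n.+1.
  by rewrite mulrAC -S; field; lra.
rewrite cE; set A := (m + 2^-1) / (m + 1); set c := cbin n.+1.
have -> : 4 * (m + 1) * (A * c) ^+ 2 = 4 * (m + 1) * A ^+ 2 * c ^+ 2 by ring.
apply: ler_wpM2r; first exact: sqr_ge0.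
have -> : 4 * (m + 1) * A ^+ 2 = 4 * (m + 2^-1) ^+ 2 / (m + 1).
  by rewrite /A; field; lra.
rewrite ler_pdivlMr; nra.
Qed.

Lemma psum_isqrt_ge n : n%:R <= psum isqrt n ^+ 2.
Proof.
case: n => [|n]; first exact: sqr_ge0.
have -> : psum isqrt n.+1 = 2 * (n.+1%:R * cbin n.+1) by rewrite cbin_psum; field.
have := cbin_sqr_ge n; set m : R := n.+1%:R; have : 0 < m by rewrite ltr0n.
set c := cbin _; nra.
Qed.

Lemma psum_isqrt_gt0 n : 0 < psum isqrt n.+1.
Proof.
have := cbin_psum n.+1; have : 0 < n.+1%:R * cbin n.+1 :> R.
  by rewrite mulr_gt0 ?cbin_gt0 ?ltr0n.
lra.
Qed.

Lemma psum_isqrt_cvg : (psum isqrt n)^-1 @[n --> \oo] --> 0.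
Proof.
apply/cvgrPdist_le => eps eps0; near=> n.
have n_gt0 : (0 < n)%N by near: n; exact: nbhs_infty_gt.
have n_ge : eps^-1 ^+ 2 <= n%:R by near: n; exact: nbhs_infty_ger.
rewrite sub0r normrN; have p_gt0 := psum_isqrt_gt0 n.-1; rewrite prednK // in p_gt0.
rewrite gtr0_norm ?invr_gt0 // -[eps]invrK lef_pV2 ?posrE ?invr_gt0 //.
have eV_ge0 : 0 <= eps^-1 by rewrite invr_ge0 ltW.
rewrite -(ler_sqr eV_ge0 (ltW p_gt0)); exact: le_trans n_ge (psum_isqrt_ge _).
Unshelve. all: by end_near. Qed.

(* This differential subring contains the rational functions of the series
   below, and the convolution with [isqrt] respects the limits in it. *)
Definition tame f : Prop := ell1 f /\ exists2 g, ell1 g & fps_deriv f = isqrt * g.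

Lemma tameD f g : tame f -> tame g -> tame (f + g).
Proof.
move=> [f1 [df df1 dfE]] [g1 [dg dg1 dgE]]; split; first exact: ell1D.
by exists (df + dg); [exact: ell1D | rewrite fps_derivD dfE dgE mulrDr].
Qed.

Lemma tameN f : tame f -> tame (- f).
Proof.
move=> [f1 [df df1 dfE]]; split; first exact: ell1N.
by exists (- df); [exact: ell1N | rewrite fps_derivN dfE mulrN].
Qed.

Lemma tameM f g : tame f -> tame g -> tame (f * g).
Proof.
move=> [f1 [df df1 dfE]] [g1 [dg dg1 dgE]]; split; first exact: ell1M.
exists (df * g + f * dg); first by apply: ell1D; exact: ell1M.
by rewrite fps_derivM dfE dgE; ring.
Qed.

Lemma tame_cst c : tame (fps_cst c).
Proof.
split; first exact: ell1_cst.
by exists (fps_cst 0); [exact: ell1_cst | rewrite fps_deriv_cst rmorph0 mulr0].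
Qed.

Lemma tame_nat n : tame n%:R.
Proof. by rewrite -(rmorph_nat (@fps_cst R : {rmorphism R -> fps R})); exact: tame_cst. Qed.

Lemma tameX f k : tame f -> tame (f ^+ k).
Proof.
move=> f_tame; elim: k => [|k IH]; first exact: (tame_nat 1).
by rewrite exprS; exact: tameM.
Qed.

Let fps_cst_half : fps_cst 2^-1 * 2 = 1 :> fps R.
Proof.
rewrite -(rmorph_nat (@fps_cst R : {rmorphism R -> fps R})) -rmorphM mulVf ?rmorph1 //.
Qed.

Lemma tame_inverse f t : tame f -> ell1 t -> f * t = 1 -> tame t.
Proof.
move=> [f1 [df df1 dfE]] t1 ft; split => //.
exists (- (t * t * df)); first by apply/ell1N/ell1M => //; exact: ell1M.
have := congr1 (@fps_deriv R) ft; rewrite fps_derivM fps_deriv1 dfE => dft.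
transitivity (t * (isqrt * df * t + f * fps_deriv t) + fps_deriv t * (1 - f * t) -
  t * t * (isqrt * df)); first by ring.
by rewrite dft ft; ring.
Qed.

Lemma tame_sqrt f s t : tame f -> ell1 s -> ell1 t -> s ^+ 2 = f -> s * t = 1 ->
  tame s.
Proof.
move=> [f1 [df df1 dfE]] s1 t1 sf st; split => //.
exists (fps_cst 2^-1 * (t * df)); first by apply: ell1M; [exact: ell1_cst | exact: ell1M].
have := congr1 (@fps_deriv R) sf; rewrite expr2 fps_derivM dfE => ds.
have half := fps_cst_half.
transitivity (fps_cst 2^-1 * t * (fps_deriv s * s + s * fps_deriv s) +
  fps_deriv s * (1 - fps_cst 2^-1 * 2 * (s * t))); first by ring.
by rewrite ds half st; ring.
Qed.

(* Transfer: with [a = isqrt * f] and [f' = isqrt * g] the relation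
   [(1 - x) a' = a / 2 + g] gives [n a_n = (sum_(i < n) a_i) / 2 + sum_(i < n) g_i],
   so that [a_n / cbin n] is a ratio of partial sums. *)
Lemma tame_transfer f : tame f ->
  (isqrt * f) n / cbin n @[n --> \oo] --> fsum f.
Proof.
move=> [f1 [g g1 dfE]]; set a := isqrt * f.
have da : (1 - fpsX) * fps_deriv a = fps_cst 2^-1 * a + g.
  rewrite fps_derivM dfE; have half := fps_cst_half.
  transitivity ((fps_cst 2^-1 * 2) * (1 - fpsX) * fps_deriv isqrt * f +
    ((1 - fpsX) * isqrt ^+ 2) * g); first by rewrite half; ring.
  rewrite isqrt_sqr -/a; transitivity (fps_cst 2^-1 * ((1 - fpsX) * (2 * fps_deriv isqrt)) * f + g).
    by ring.
  by rewrite isqrt_deriv /a; ring.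
have aS n : n%:R * a n = psum a n / 2 + psum g n.
  elim: n => [|n IH]; first by rewrite !psum0 !mul0r addr0.
  have := congr1 (@^~ n) da; rewrite mulrBl mul1r fps_subE X_fps_deriv.
  rewrite fps_addE fps_cst_mulE /fps_deriv !psumS; lra.
clear dfE da; have aE n : a n.+1 / cbin n.+1 = psum f n.+1 -
    \sum_(i < n.+1) f i * (1 - psum isqrt (n.+1 - i) / psum isqrt n.+1) +
    2 * psum g n.+1 * (psum isqrt n.+1)^-1.
  have p_gt0 := psum_isqrt_gt0 n; have c_gt0 := cbin_gt0 n.+1.
  have n_gt0 : 0 < n.+1%:R :> R by rewrite ltr0n.
  have -> : psum f n.+1 - \sum_(i < n.+1) f i *
      (1 - psum isqrt (n.+1 - i) / psum isqrt n.+1) = psum a n.+1 / psum isqrt n.+1.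
    have -> : a = f * isqrt by exact: mulrC.
    rewrite psumM mulr_suml /psum -sumrB; apply: eq_bigr => i _.
    by rewrite -/(psum _ _); ring.
  have := aS n.+1; have cp := cbin_psum n.+1; move=> aSn.
  have -> : cbin n.+1 = psum isqrt n.+1 / 2 / n.+1%:R :> R by rewrite -cp; field; lra.
  have -> : a n.+1 = (psum a n.+1 / 2 + psum g n.+1) / n.+1%:R :> R.
    by rewrite -aSn mulrC mulKf ?pnatr_eq0.
  set p := psum isqrt n.+1 in p_gt0 *; set A := psum a _; set G := psum g _.
  by field; lra.
have lim_eq : fsum f = fsum f - 0 + 2 * fsum g * 0 by ring.
have : psum f N - \sum_(i < N) f i * (1 - psum isqrt (N - i) / psum isqrt N) +
    2 * psum g N * (psum isqrt N)^-1 @[N --> \oo] --> fsum f.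
  rewrite lim_eq; apply: cvgD; last first.
    apply: cvgM psum_isqrt_cvg; apply: cvgM; first exact: cvg_cst.
    exact: fsum_cvg.
  apply: cvgB; first exact: fsum_cvg.
  pose c N i := 1 - psum isqrt (N - i) / psum isqrt N.
  have p_ge0 N : 0 <= psum isqrt N.
    by apply: sumr_ge0 => k _; exact/ltW/cbin_gt0.
  (* As [cbin] is at most 1, a shift by [i] changes a partial sum by at most [i], which is
     negligible against the unbounded [psum isqrt N]. *)
  have p_diff k i : 0 <= psum isqrt (k + i) - psum isqrt k <= i%:R.
    elim: i => [|i /andP[IH1 IH2]]; first by rewrite addn0 subrr lexx.
    rewrite addnS psumS -[i.+1]addn1 natrD /isqrt.
    have := cbin_gt0 (k + i); have := cbin_le1 (k + i).
    rewrite /isqrt in IH1 IH2; set x := cbin _ => x_le x_gt; lra.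
  have c_bnd N i : (i < N)%N -> 0 <= c N i <= i%:R * (psum isqrt N)^-1.
    case: N => // N iN; have p_gt0 := psum_isqrt_gt0 N.
    have -> : c N.+1 i = (psum isqrt N.+1 - psum isqrt (N.+1 - i)) / psum isqrt N.+1.
      by rewrite /c; field; lra.
    have := p_diff (N.+1 - i)%N i; rewrite subnK 1?ltnW // => /andP[d0 d1].
    by rewrite divr_ge0 //= ler_pM2r ?invr_gt0.
  apply: (@tannery _ _ c 1) => // [N i iN|i].
    have /andP[c0 _] := c_bnd N i iN; rewrite ger0_norm // /c.
    by rewrite lerBlDr lerDl divr_ge0.
  have cv : i%:R * (psum isqrt N)^-1 @[N --> \oo] --> 0.
    rewrite -[X in _ --> X](mulr0 i%:R).
    by apply: cvgM psum_isqrt_cvg; exact: cvg_cst.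
  apply: (squeeze_cvgr _ (cvg_cst 0) cv); near=> N; apply: c_bnd.
  by near: N; exact: nbhs_infty_gt.
apply: cvg_trans; apply: near_eq_cvg; near=> N.
have : (0 < N)%N by near: N; exact: nbhs_infty_gt.
by move=> /prednK <-; rewrite aE.
Unshelve. all: by end_near. Qed.

End Tame.

(** * Scaling and values of absolutely convergent series *)

Section Evaluation.
Variable R : realType.
Implicit Types (f g w : fps R) (a c : R).

Definition fps_scale c f : fps R := fun n => c ^+ n * f n.

Lemma fps_scale_is_zmod_morphism c : zmod_morphism (fps_scale c).
Proof. by move=> f g; apply/funext => n; rewrite /fps_scale !fps_subE mulrBr. Qed.

Lemma fps_scale_is_monoid_morphism c : monoid_morphism (fps_scale c).
Proof.
split=> [|f g]; apply/funext => n; rewrite /fps_scale.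
  by rewrite fps_1E; case: n => [|n]; rewrite ?mul1r ?mulr0.
rewrite !fps_mulE mulr_sumr; apply: eq_bigr => -[i i_lt] _ /=.
by rewrite -{1}(subnKC (i_lt : (i <= n)%N)) exprD; ring.
Qed.

HB.instance Definition _ c := GRing.isZmodMorphism.Build (fps R) (fps R)
  (fps_scale c) (fps_scale_is_zmod_morphism c).
HB.instance Definition _ c := GRing.isMonoidMorphism.Build (fps R) (fps R)
  (fps_scale c) (fps_scale_is_monoid_morphism c).

Lemma fps_scale_X c : fps_scale c fpsX = fps_cst c * fpsX.
Proof.
apply/funext => n; rewrite fps_cst_mulE /fps_scale /fpsX /fps_of_poly coefX.
by case: n => [|[|n]]; rewrite ?mulr0 ?expr1.
Qed.

Lemma fsum_X f : ell1 f -> fsum (fpsX * f) = fsum f.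
Proof.
move=> f1; apply: fsum_eq; rewrite -cvg_shiftS.
have -> : (fun n => psum (fpsX * f) n.+1) = psum f.
  apply/funext => n; rewrite /psum big_ord_recl fps_XmulE add0r.
  by apply: eq_bigr => i _; rewrite fps_XmulE.
exact: fsum_cvg.
Qed.

Lemma ell1_X f : ell1 f -> ell1 (fpsX * f).
Proof. by case=> C fC; exists C; exact: abounded_X. Qed.

Lemma ell1_nat n : ell1 (n%:R : fps R).
Proof. by case: (tame_nat R n). Qed.

Lemma abounded_nat n : abounded n%:R (n%:R : fps R).
Proof.
rewrite -[X in abounded _ X](rmorph_nat (@fps_cst R : {rmorphism R -> fps R})).
by rewrite -{1}[n%:R]ger0_norm //; exact: abounded_cst.
Qed.

Definition value f a : Prop := ell1 f /\ fsum f = a.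

Lemma valueD f g a c : value f a -> value g c -> value (f + g) (a + c).
Proof. by move=> [f1 <-] [g1 <-]; split; [exact: ell1D | exact: fsumD]. Qed.

Lemma valueM f g a c : value f a -> value g c -> value (f * g) (a * c).
Proof. by move=> [f1 <-] [g1 <-]; split; [exact: ell1M | exact: fsumM]. Qed.

Lemma valueN f a : value f a -> value (- f) (- a).
Proof. by move=> [f1 <-]; split; [exact: ell1N | exact: fsumN]. Qed.

Lemma value_cst c : value (fps_cst c) c.
Proof. by split; [exact: ell1_cst | exact: fsum_cst]. Qed.

Lemma value_nat n : value n%:R n%:R.
Proof.
by rewrite -[X in value X](rmorph_nat (@fps_cst R : {rmorphism R -> fps R}));
  exact: value_cst.
Qed.

Lemma valueX f a k : value f a -> value (f ^+ k) (a ^+ k).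
Proof.
move=> fa; elim: k => [|k IH]; first exact: (value_nat 1).
by rewrite !exprS; exact: valueM.
Qed.

Lemma valueV f g a : f * g = 1 -> ell1 g -> value f a -> value g a^-1.
Proof.
move=> fg g1 fa; have [_] := valueM fa (conj g1 erefl).
rewrite fg fsum1 => /esym ag; split=> //.
have a_neq0 : a != 0.
  by apply/eqP => a0; have := oner_eq0 R; rewrite -ag a0 mul0r eqxx.
by rewrite -[RHS]mulr1 -ag mulKf.
Qed.

(** The root has the form [1 - e] with [e] bounded by [th < 1], which gives both its inverse and the
    sign of its value. *)
Lemma ell1_sqrt_unit w (th : R) : w 0%N = 0 -> abounded th w -> th < 1 ->
  exists s t, [/\ s ^+ 2 = 1 + w, s * t = 1, ell1 s & ell1 t] /\
    s 0%N = 1 /\ 0 < fsum s.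
Proof.
move=> w0 wth th1; have [s [s2 s0 [e sE [e0 eth]]]] := ell1_sqrt w0 wth th1.
have e1 : ell1 e by exists th.
have [||t st t1] := @ell1_inverse _ (- e) th _ _ th1.
- by rewrite fps_oppE e0 oppr0.
- exact: aboundedN.
have [s1 sv] : value s (1 - fsum e).
  rewrite sE; exact: valueD (value_nat 1) (valueN (conj e1 erefl)).
exists s, t; split; first by split=> //; rewrite sE.
split=> //; rewrite sv subr_gt0; have := fsum_le eth.
by rewrite ler_norml => /andP[_] /le_lt_trans; exact.
Qed.

Lemma fps_cancel_neq0 f g : f 0%N != 0 -> f * g = 0 -> g = 0.
Proof.
move=> f0 fg; apply: (@fps_cancel_unit _ (fps_cst (f 0%N)^-1 * f)).
  by rewrite fps_cst_mulE mulVf.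
by rewrite -mulrA fg mulr0.
Qed.

End Evaluation.

(** * The dominant singularity *)

Section Singularity.
Variables (R : realType) (tau : R).
Hypothesis tauE : 4 * tau ^+ 3 + 3 * tau ^+ 2 = 1.
Hypothesis tau_lo : 455 / 1000 < tau.
Hypothesis tau_hi : tau < 456 / 1000.

(** This is [Phi'(tau)] for [Phi(x) = (1 + 2x)(1 + x + x^2)]. The equation of [tau] says
    [Phi(tau) = tau Phi'(tau)]: [x / Phi(x)] is critical at [tau] and takes the value [1 / rho]
    there. *)
Let rho : R := 3 + 6 * tau + 6 * tau ^+ 2.
Let ri : fps R := fps_cst rho^-1.
Let t : fps R := fps_cst tau.

Lemma rho_gt0 : 0 < rho. Proof. by rewrite /rho; nra. Qed.

Lemma tau_gt0 : 0 < tau. Proof. by move: tau_lo; lra. Qed.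

Lemma tau2_lt1 : 2 * tau < 1. Proof. by move: tau_hi; lra. Qed.

Lemma tau_tau2_lt1 : tau + tau * tau < 1.
Proof. by have := tau_gt0; have := tau2_lt1; nra. Qed.

Lemma tau_lt1 : tau < 1. Proof. by move: tau_hi; lra. Qed.

Lemma tau_sqr_lt1 : tau ^+ 2 < 1.
Proof. by rewrite expr_lt1 ?tau_lt1 // ltW // tau_gt0. Qed.

Lemma tau_m0_lt : 2 * tau < 3 + 4 * tau.
Proof. by have := tau_gt0; lra. Qed.

(** With [q = 4 tau^3] this gives [|q - 1/2| = 1/2 - q], so that the remainder in [hh_inverse] has
    absolute sum at most [1 - q/2 < 1]. *)
Lemma tau3_bounds : 0 < 4 * tau ^+ 3 /\ 4 * tau ^+ 3 < 2^-1.
Proof.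
have t3 := exprn_gt0 3 tau_gt0; have t_lo : 9 / 20 < tau by move: tau_lo; lra.
have t2 : 9 / 20 * tau < tau ^+ 2 by rewrite expr2 ltr_pM2r ?tau_gt0.
by split; move: tauE; lra.
Qed.

Lemma cofactor_gt0 s : `|s| <= tau -> 0 < s + 3 / 2 + 2 * tau.
Proof. by rewrite ler_norml => /andP[]; move: tau_lo; lra. Qed.

Lemma rho_tau : rho * tau = (1 + 2 * tau) * (1 + tau + tau ^+ 2).
Proof. by rewrite /rho; move: tauE; lra. Qed.

Lemma tE : 4 * t ^+ 3 + 3 * t ^+ 2 = 1.
Proof.
transitivity (fps_cst (4 * tau ^+ 3 + 3 * tau ^+ 2)); last by rewrite tauE rmorph1.
by rewrite /t; ring.
Qed.

Variable u : fps R.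
Hypothesis uE : u = ri * (fpsX * ((1 + 2 * u) * (1 + u + u ^+ 2))).

Let Phi : fps R := (1 + 2 * u) * (1 + u + u ^+ 2).

Lemma u0 : u 0%N = 0.
Proof. by rewrite uE fps_cst_mulE fps_XmulE mulr0. Qed.

(** [Phi] has nonnegative coefficients and [Phi(tau) = rho tau], so the fixed point map preserves
    the ball of radius [tau]. *)
Lemma u_abounded : abounded tau u.
Proof.
pose F g : fps R := ri * (fpsX * ((1 + 2 * g) * (1 + g + g * g))).
have F_contr n g h : agree n g h -> agree n.+1 (F g) (F h).
  move=> gh; apply: agree_mul => //; apply: agree_X; apply: agree_mul.
    by apply: agree_add => //; apply: agree_mul.
  apply: agree_add; first exact: agree_add.
  exact: agree_mul.
apply: (@abounded_fixpoint _ F tau) => // [g gt|].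
- have -> : tau = `|rho^-1| * ((1 + 2 * tau) * (1 + tau + tau * tau)).
    rewrite gtr0_norm ?invr_gt0 ?rho_gt0 // -expr2 -rho_tau mulKf //.
    by rewrite gt_eqF ?rho_gt0.
  apply: aboundedM; first exact: abounded_cst.
  apply: abounded_X; apply: aboundedM.
    apply: aboundedD; first exact: (abounded_nat R 1).
    by apply: aboundedM => //; exact: (abounded_nat R 2).
  apply: aboundedD; last exact: aboundedM.
  by apply: aboundedD => //; exact: (abounded_nat R 1).
- exact/ltW/tau_gt0.
Qed.

Lemma u_ell1 : ell1 u. Proof. by exists tau; exact: u_abounded. Qed.

(** The value [s] solves the cubic [Phi(s) = rho s], of which [tau] is a double root; the third root
    [-3/2 - 2 tau] is excluded by [|s| <= tau]. *)
Lemma value_u : value u tau.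
Proof.
split; first exact: u_ell1.
have u1 := u_ell1; set s := fsum u.
have vu : value u s by [].
have vPhi : value Phi ((1 + 2 * s) * (1 + s + s ^+ 2)).
  have v1 := value_nat R 1; have v2 := value_nat R 2.
  by do ?[apply: valueD | apply: valueM | apply: valueX] => //.
have s_le : `|s| <= tau by apply: fsum_le; exact: u_abounded.
have sE : rho * s = (1 + 2 * s) * (1 + s + s ^+ 2).
  have [Phi1 <-] := vPhi; rewrite /s uE -/Phi fsumM ?fsum_cst ?fsum_X //.
  - by rewrite mulVKf // gt_eqF ?rho_gt0.
  - exact: ell1_cst.
  - exact: ell1_X.
have : 2 * (tau - s) ^+ 2 * (s + 3 / 2 + 2 * tau) = 0.
  transitivity ((1 + 2 * s) * (1 + s + s ^+ 2) - rho * s + (4 * tau ^+ 3 + 3 * tau ^+ 2 - 1)).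
    by rewrite /rho; field.
  by rewrite sE tauE; ring.
have m_gt0 : 0 < s + 3 / 2 + 2 * tau.
  exact: cofactor_gt0.
move=> /eqP; rewrite mulf_eq0 (gt_eqF m_gt0) orbF mulf_eq0 pnatr_eq0 /= sqrf_eq0.
by rewrite subr_eq0 => /eqP.
Qed.

(** The factorization of [Phi - rho u] with its double root, now for series, where [rho u] is
    [fpsX * Phi]. *)
Lemma square_root : (t - u) ^+ 2 * (2 * u + 3 + 4 * t) = (1 - fpsX) * Phi.
Proof.
have ru : fps_cst rho * u = fpsX * Phi.
  by rewrite {1}uE -/Phi mulrA -rmorphM divff ?rmorph1 ?mul1r // gt_eqF ?rho_gt0.
transitivity (Phi - fps_cst rho * u + (4 * t ^+ 3 + 3 * t ^+ 2 - 1)).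
  have -> : fps_cst rho = 3 + 6 * t + 6 * t ^+ 2 by rewrite /rho /t; ring.
  by rewrite /Phi; ring.
by rewrite ru tE; ring.
Qed.

(** The divided difference of [4 x^3 + 3 x^2] between [tau] and [u]. *)
Let hh : fps R := 4 * u ^+ 2 + (3 + 4 * t) * u + (3 * t + 4 * t ^+ 2).

(** Differentiating [rho u = x Phi] and eliminating [x] gives [rho u' (Phi - u Phi'(u)) = Phi^2],
    and [Phi - u Phi'(u) = 1 - 3u^2 - 4u^3] vanishes at [tau]. *)
Lemma u_deriv : fps_cst rho * fps_deriv u * ((t - u) * hh) = Phi ^+ 2.
Proof.
have ru : fps_cst rho * u = fpsX * Phi.
  by rewrite {1}uE -/Phi mulrA -rmorphM divff ?rmorph1 ?mul1r // gt_eqF ?rho_gt0.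
have dPhi : fps_deriv Phi = (3 + 6 * u + 6 * u ^+ 2) * fps_deriv u.
  by rewrite /Phi !(expr2, fps_derivM, fps_derivD, fps_deriv1); ring.
have := congr1 (@fps_deriv R) ru.
rewrite [LHS]fps_derivM [X in _ = X]fps_derivM fps_deriv_cst mul0r add0r.
rewrite fps_derivX mul1r dPhi => du.
have -> : (t - u) * hh = 1 - 3 * u ^+ 2 - 4 * u ^+ 3.
  transitivity (4 * t ^+ 3 + 3 * t ^+ 2 - 3 * u ^+ 2 - 4 * u ^+ 3); first by rewrite /hh; ring.
  by rewrite tE.
transitivity (fps_cst rho * fps_deriv u * Phi -
   fps_cst rho * u * (3 + 6 * u + 6 * u ^+ 2) * fps_deriv u).
  by rewrite /Phi; ring.
by rewrite du ru; ring.
Qed.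

(* [h = (1 + y + q y^2) / tau] with [y = u / tau] and [q = 4 tau^3]; the factor
   [1 - y / 2] makes the sum of the remaining absolute values less than 1. *)
Lemma hh_inverse : exists2 hi, hh * hi = 1 & ell1 hi.
Proof.
pose y : fps R := fps_cst tau^-1 * u.
have t_gt0 := tau_gt0; have tn0 : tau != 0 by rewrite gt_eqF.
have ty : t * y = u by rewrite /y mulrA -rmorphM divff // rmorph1 mul1r.
have y_bnd : abounded 1 y.
  have -> : 1 = `|tau^-1| * tau by rewrite gtr0_norm ?invr_gt0 // mulVf.
  by apply: aboundedM u_abounded; exact: abounded_cst.
have y0 : y 0%N = 0 by rewrite /y fps_cst_mulE u0 mulr0.
pose q := 4 * tau ^+ 3; pose Q := fps_cst q; pose H : fps R := fps_cst 2^-1.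
have H2 : 2 * H = 1.
  by rewrite -(rmorph_nat (@fps_cst R : {rmorphism R -> fps R})) -rmorphM divff ?rmorph1 // pnatr_eq0.
pose w := H * y + fps_cst (q - 2^-1) * (y * y) - H * Q * (y * (y * y)).
have wE : (1 + y + Q * (y * y)) * (1 - H * y) = 1 + w.
  have -> : w = H * y + (Q - H) * (y * y) - H * Q * (y * (y * y)) by rewrite /w rmorphB.
  transitivity (1 + 2 * H * y - H * y + Q * (y * y) - H * (y * y) - H * Q * (y * (y * y))).
    by rewrite H2; ring.
  by ring.
have [w_bnd q_gt0] : abounded (1 - q / 2) w /\ 0 < q.
  have [q_gt0 q_lt] := tau3_bounds; rewrite -/q in q_gt0 q_lt.
  split=> //; have yy : abounded 1 (y * y) by rewrite -[1]mulr1; exact: aboundedM.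
  have yyy : abounded 1 (y * (y * y)) by rewrite -[1]mulr1; exact: aboundedM.
  have -> : 1 - q / 2 = `|2^-1| * 1 + `|q - 2^-1| * 1 + `|2^-1| * `|q| * 1.
    rewrite (gtr0_norm q_gt0) gtr0_norm ?invr_gt0 // ltr0_norm ?subr_lt0 //.
    by field.
  apply: aboundedD; first apply: aboundedD.
  - by apply: aboundedM => //; exact: abounded_cst.
  - by apply: aboundedM => //; exact: abounded_cst.
  - by apply/aboundedN/aboundedM => //; apply: aboundedM; exact: abounded_cst.
have w0 : w 0%N = 0.
  by rewrite /w fps_subE fps_addE !fps_mul0E y0 !(mulr0, mul0r) addr0 subr0.
have [|wi wwi wi1] := ell1_inverse w0 w_bnd; first by rewrite ltrBlDr ltrDl divr_gt0.
have hhE : hh * t = 1 + y + Q * (y * y).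
  rewrite /hh -ty; transitivity ((4 * t ^+ 3 + 3 * t ^+ 2) * (1 + y) + 4 * t ^+ 3 * (y * y)).
    by ring.
  by rewrite tE /Q /q; have -> : fps_cst (4 * tau ^+ 3) = 4 * t ^+ 3 by [rewrite /t; ring]; ring.
exists (t * (1 - H * y) * wi).
  transitivity (hh * t * (1 - H * y) * wi); first by ring.
  by rewrite hhE wE.
have y1 : ell1 y by exists 1.
apply: (ell1M (ell1M (ell1_cst tau) _) wi1).
exact: (ell1D (ell1_nat R 1) (ell1N (ell1M (ell1_cst _) y1))).
Qed.

(** [ell1_sqrt] asks for [1 + w] with the absolute sum of [w] below 1. This holds for [1 + 2u], for
    [1 + u + u^2] and for the normalized linear factor, but not for [Phi] as a whole; [v] is
    assembled from the three roots. *)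
Lemma sqrt_Phi : exists v vi, [/\ v ^+ 2 * (2 * u + 3 + 4 * t) = Phi, v * vi = 1,
  ell1 v & ell1 vi] /\ [/\ 0 < v 0%N, 0 < fsum v &
  exists2 mi, (2 * u + 3 + 4 * t) * mi = 1 & ell1 mi].
Proof.
have t_gt0 := tau_gt0; have u_bnd := u_abounded; have u00 := u0.
have [|||sa [sai [[sa2 saV sa1 sai1] [sa0 sav]]]] := @ell1_sqrt_unit _ (2 * u) (2 * tau).
- by rewrite fps_mul0E u00 mulr0.
- by apply: aboundedM => //; exact: (abounded_nat R 2).
- exact: tau2_lt1.
have [|||sb [sbi [[sb2 sbV sb1 sbi1] [sb0 sbv]]]] := @ell1_sqrt_unit _ (u + u * u) (tau + tau * tau).
- by rewrite fps_addE fps_mul0E u00 mulr0 addr0.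
- by apply: aboundedD => //; exact: aboundedM.
- exact: tau_tau2_lt1.
pose m0 := 3 + 4 * tau; have m0_gt0 : 0 < m0 by rewrite addr_gt0 ?mulr_gt0.
have [|||sc [sci [[sc2 scV sc1 sci1] [sc0 scv]]]] :=
  @ell1_sqrt_unit _ (fps_cst (2 / m0) * u) (2 / m0 * tau).
- by rewrite fps_mul0E u00 mulr0.
- rewrite -{1}[2 / m0]gtr0_norm ?divr_gt0 //.
  by apply: aboundedM => //; exact: abounded_cst.
- by rewrite mulrAC ltr_pdivrMr // mul1r; exact: tau_m0_lt.
have mE : 2 * u + 3 + 4 * t = fps_cst m0 * sc ^+ 2.
  have m0m : fps_cst m0 * fps_cst (2 / m0) = 2.
    by rewrite -rmorphM mulrC divfK ?gt_eqF // rmorph_nat.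
  transitivity (fps_cst m0 + fps_cst m0 * fps_cst (2 / m0) * u); last by rewrite sc2; ring.
  by rewrite m0m /m0 /t; ring.
pose k := Num.sqrt m0; have k_gt0 : 0 < k by rewrite sqrtr_gt0.
have kk : fps_cst k^-1 * fps_cst k = 1 by rewrite -rmorphM mulVf ?rmorph1 // gt_eqF.
have k2 : fps_cst m0 = fps_cst k ^+ 2 by rewrite -rmorphXn sqr_sqrtr // ltW.
exists (sa * sb * sci * fps_cst k^-1), (sai * sbi * sc * fps_cst k); split; first split.
- rewrite mE k2; transitivity (sa ^+ 2 * sb ^+ 2 * (sc * sci) ^+ 2 * (fps_cst k^-1 * fps_cst k) ^+ 2).
    by ring.
  by rewrite scV kk sa2 sb2 /Phi; ring.
- transitivity ((sa * sai) * (sb * sbi) * (sc * sci) * (fps_cst k^-1 * fps_cst k)); first by ring.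
  by rewrite saV sbV scV kk !mulr1.
- by do ?apply: ell1M => //; exact: ell1_cst.
- by do ?apply: ell1M => //; exact: ell1_cst.
have vsci : value sci (fsum sc)^-1 by apply: valueV scV sci1 _.
split; last first.
- exists (sci ^+ 2 * fps_cst k^-1 ^+ 2).
    rewrite mE k2; transitivity ((sc * sci) ^+ 2 * (fps_cst k^-1 * fps_cst k) ^+ 2); first by ring.
    by rewrite scV kk !expr1n mulr1.
  by rewrite !expr2; apply: ell1M; apply: ell1M => //; exact: ell1_cst.
- have [_ ->] := valueM (valueM (valueM (conj sa1 erefl) (conj sb1 erefl)) vsci) (value_cst k^-1).
  by rewrite !mulr_gt0 ?invr_gt0.
rewrite !fps_mul0E fps_cstE sa0 sb0 !mul1r mulr_gt0 ?invr_gt0 //.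
by have := congr1 (@^~ 0%N) scV; rewrite /= fps_mul0E sc0 mul1r fps_1E => ->.
Qed.

Lemma Phi_deriv : fps_deriv Phi = (3 + 6 * u + 6 * u ^+ 2) * fps_deriv u.
Proof.
by rewrite /Phi !(expr2, fps_derivM, fps_derivD, fps_deriv1); ring.
Qed.

(** By [square_root] both sides have the same square; their sum has a positive constant coefficient
    and can be cancelled, which decides the sign. *)
Lemma isqrt_tu v : v ^+ 2 * (2 * u + 3 + 4 * t) = Phi -> 0 < v 0%N ->
  isqrt R * (t - u) = v.
Proof.
move=> v2 v0; have sq := square_root; have is2 := isqrt_sqr R.
have m_neq0 : (2 * u + 3 + 4 * t) 0%N != 0.
  have -> : 2 * u + 3 + 4 * t = 2 * u + fps_cst (3 + 4 * tau) by rewrite /t; ring.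
  by rewrite fps_addE fps_mul0E u0 mulr0 add0r fps_cstE gt_eqF // addr_gt0 // mulr_gt0 ?tau_gt0.
have p_neq0 : (isqrt R * (t - u) + v) 0%N != 0.
  rewrite fps_addE fps_mul0E fps_subE u0 subr0 /t fps_cstE gt_eqF // addr_gt0 //.
  by rewrite mulr_gt0 ?tau_gt0 // cbin_gt0.
apply/eqP; rewrite -subr_eq0; apply/eqP.
apply: (fps_cancel_neq0 p_neq0); apply: (fps_cancel_neq0 m_neq0).
transitivity (isqrt R ^+ 2 * ((t - u) ^+ 2 * (2 * u + 3 + 4 * t)) -
  v ^+ 2 * (2 * u + 3 + 4 * t)); first by ring.
rewrite sq v2; transitivity (((1 - fpsX) * isqrt R ^+ 2) * Phi - Phi); first by ring.
by rewrite is2; ring.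
Qed.

Lemma rho_ri : fps_cst rho * ri = 1.
Proof. by rewrite -rmorphM divff ?rmorph1 // gt_eqF ?rho_gt0. Qed.

Lemma u_deriv_isqrt v vi hi :
  isqrt R * (t - u) = v -> v * vi = 1 -> hh * hi = 1 ->
  fps_deriv u = isqrt R * (ri * Phi ^+ 2 * vi * hi).
Proof.
move=> tuE vV hV; have du := u_deriv; have rr := rho_ri.
transitivity (fps_deriv u * (fps_cst rho * ri) * (isqrt R * (t - u) * vi) * (hh * hi)).
  by rewrite rr tuE vV hV; ring.
transitivity (isqrt R * ri * vi * hi * (fps_cst rho * fps_deriv u * ((t - u) * hh))).
  by ring.
by rewrite du; ring.
Qed.

Variable b : fps R.
Hypothesis bE : b * ((1 + u) * (1 + u ^+ 2) ^+ 2) = (1 + u + u ^+ 3) * (1 + u + u ^+ 2).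

Lemma b_deriv i1 i2 : (1 + u) * i1 = 1 -> (1 + u ^+ 2) * i2 = 1 ->
  fps_deriv b = ri * (Phi ^+ 2 * i1 ^+ 2 * i2 ^+ 3).
Proof.
move=> i1V i2V; have rr := rho_ri.
set A := (1 + u) * (1 + u ^+ 2) ^+ 2; set N := (1 + u + u ^+ 3) * (1 + u + u ^+ 2).
have dA : fps_deriv A = ((1 + u ^+ 2) ^+ 2 + (1 + u) * (4 * u * (1 + u ^+ 2))) * fps_deriv u.
  by rewrite /A !(expr2, fps_derivM, fps_derivD, fps_deriv1); ring.
have dN : fps_deriv N = ((1 + 3 * u ^+ 2) * (1 + u + u ^+ 2) +
    (1 + u + u ^+ 3) * (1 + 2 * u)) * fps_deriv u.
  by rewrite /N !(exprS, expr0, mulr1, fps_derivM, fps_derivD, fps_deriv1); ring.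
have db : fps_deriv b * A + b * fps_deriv A = fps_deriv N.
  by rewrite -[N]bE -/A -fps_derivM.
(* The derivative of [N / A] in [u] has the numerator [(1 + u^2)(1 - 3u^2 - 4u^3)]; by [u_deriv] its
   second factor times [rho u'] is [Phi^2]. *)
have dbA : fps_cst rho * fps_deriv b * A ^+ 2 = (1 + u ^+ 2) * Phi ^+ 2.
  have -> : Phi ^+ 2 = fps_cst rho * fps_deriv u * (1 - 3 * u ^+ 2 - 4 * u ^+ 3).
    rewrite -u_deriv; congr (_ * _).
    transitivity (4 * t ^+ 3 + 3 * t ^+ 2 - 3 * u ^+ 2 - 4 * u ^+ 3); first by rewrite /hh; ring.
    by rewrite tE.
  transitivity (fps_cst rho * (A * (fps_deriv b * A + b * fps_deriv A) - (b * A) * fps_deriv A)).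
    by ring.
  by rewrite db bE -/N dN dA /A /N; ring.
transitivity ((fps_cst rho * ri) * fps_deriv b * ((1 + u) * i1) ^+ 2 * ((1 + u ^+ 2) * i2) ^+ 4).
  by rewrite rr i1V i2V; ring.
transitivity (ri * (fps_cst rho * fps_deriv b * A ^+ 2) * i1 ^+ 2 * i2 ^+ 4); first by rewrite /A; ring.
rewrite dbA; transitivity (ri * Phi ^+ 2 * i1 ^+ 2 * i2 ^+ 3 * ((1 + u ^+ 2) * i2)); first by ring.
by rewrite i2V; ring.
Qed.

Lemma inverse_deriv (f g : fps R) : f * g = 1 -> fps_deriv g = - (g ^+ 2 * fps_deriv f).
Proof.
move=> fg; have := congr1 (@fps_deriv R) fg; rewrite fps_derivM fps_deriv1 => dfg.
transitivity (g * (fps_deriv f * g + f * fps_deriv g) + fps_deriv g * (1 - f * g) -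
  g ^+ 2 * fps_deriv f); first by ring.
by rewrite dfg fg; ring.
Qed.

Lemma b_deriv2 i1 i2 : (1 + u) * i1 = 1 -> (1 + u ^+ 2) * i2 = 1 ->
  fps_deriv (fps_deriv b) = ri * (2 * Phi * (3 + 6 * u + 6 * u ^+ 2) * i1 ^+ 2 * i2 ^+ 3 -
    2 * Phi ^+ 2 * i1 ^+ 3 * i2 ^+ 3 - 6 * u * Phi ^+ 2 * i1 ^+ 2 * i2 ^+ 4) * fps_deriv u.
Proof.
move=> i1V i2V; rewrite (b_deriv i1V i2V).
have d1 : fps_deriv i1 = - (i1 ^+ 2 * fps_deriv u).
  by rewrite (inverse_deriv i1V) fps_derivD fps_deriv1 add0r.
have d2 : fps_deriv i2 = - (i2 ^+ 2 * (2 * u * fps_deriv u)).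
  by rewrite (inverse_deriv i2V) fps_derivD fps_deriv1 add0r expr2 fps_derivM; ring.
have dP := Phi_deriv; set P := Phi in dP *; clearbody P.
rewrite fps_derivM fps_deriv_cst !(exprS, expr0, mulr1, fps_derivM) dP d1 d2; ring.
Qed.

Let h0 : R := 4 * tau ^+ 2 + (3 + 4 * tau) * tau + (3 * tau + 4 * tau ^+ 2).
Let P0 : R := (1 + 2 * tau) * (1 + tau + tau ^+ 2).

(** The second derivative of [b] is [isqrt * (q * g)] with [q] from [b_deriv2] and [g] from
    [u_deriv_isqrt]. The limit is the value of [q * g], with [tau] for [u] and [V] for the root
    [v]. *)
Lemma b_transfer : exists V : R, [/\ 0 < V, V ^+ 2 * (2 * tau + 3 + 4 * tau) = P0 &
  (n.+1%:R * (n.+2%:R * b n.+2)) / cbin R n @[n --> \oo] -->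
  rho^-1 * (2 * P0 * (3 + 6 * tau + 6 * tau ^+ 2) * (1 + tau)^-1 ^+ 2 * (1 + tau ^+ 2)^-1 ^+ 3 -
    2 * P0 ^+ 2 * (1 + tau)^-1 ^+ 3 * (1 + tau ^+ 2)^-1 ^+ 3 -
    6 * tau * P0 ^+ 2 * (1 + tau)^-1 ^+ 2 * (1 + tau ^+ 2)^-1 ^+ 4) *
  (rho^-1 * P0 ^+ 2 * V^-1 * h0^-1)].
Proof.
have [v [vi [[v2 vV v1 vi1] [v00 v_gt0 [mi miV mi1]]]]] := sqrt_Phi.
have [hi hV hi1] := hh_inverse.
have u_bnd := u_abounded; have u00 := u0; have u1 := u_ell1; have vu := value_u.
have [|i1 i1V i11] := @ell1_inverse _ u tau u00 u_bnd; first exact: tau_lt1.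
have [||i2 i2V i21] := @ell1_inverse _ (u ^+ 2) (tau ^+ 2) _ _ tau_sqr_lt1.
- by rewrite expr2 fps_mul0E u00 mulr0.
- by rewrite !expr2; exact: aboundedM.
have tuE := isqrt_tu v2 v00.
have du := u_deriv_isqrt tuE vV hV.
have v1n := value_nat R 1; have v2n := value_nat R 2; have v3n := value_nat R 3.
have v4n := value_nat R 4; have v6n := value_nat R 6; have vt := value_cst tau.
have vri := value_cst rho^-1.
have vP : value Phi P0 by do ?[apply: valueD | apply: valueM | apply: valueX] => //.
have vh : value hh h0 by do ?[apply: valueD | apply: valueM | apply: valueX] => //.
have vv : value v (fsum v) by [].
have vvi := valueV vV vi1 vv; have vhi := valueV hV hi1 vh.
have vi1' : value i1 (1 + tau)^-1 by apply: (valueV i1V i11); exact: valueD.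
have vi2' : value i2 (1 + tau ^+ 2)^-1.
  by apply: (valueV i2V i21); apply: valueD => //; exact: valueX.
set V := fsum v in v_gt0 vv vvi *; exists V; split=> //.
  have [_ <-] : value (v ^+ 2 * (2 * u + 3 + 4 * t)) (V ^+ 2 * (2 * tau + 3 + 4 * tau)).
    by do ?[apply: valueD | apply: valueM | apply: valueX].
  by rewrite v2; case: vP.
pose g := ri * Phi ^+ 2 * vi * hi.
have vg : value g (rho^-1 * P0 ^+ 2 * V^-1 * h0^-1).
  exact: valueM (valueM (valueM vri (valueX 2 vP)) vvi) vhi.
(* For this [g] only has to lie in [ell1]; that [g] itself is tame follows afterwards, since it is
   built from [u]. *)
have tu : tame u by split => //; exists g => //; case: vg.
have tn n : tame (n%:R : fps R) by exact: tame_nat.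
have t1n := tn 1%N; have tt : tame t by exact: tame_cst.
have tPhi : tame Phi.
  by apply: tameM; do ?apply: tameD => //; [exact: tameM (tn 2) tu | exact: tameX].
have tm : tame (2 * u + 3 + 4 * t).
  exact: tameD (tameD (tameM (tn 2) tu) (tn 3)) (tameM (tn 4) tt).
have tmi := tame_inverse tm mi1 miV.
have tv : tame v.
  apply: (tame_sqrt (tameM tPhi tmi) v1 vi1 _ vV).
  transitivity (v ^+ 2 * ((2 * u + 3 + 4 * t) * mi)); first by rewrite miV mulr1.
  by rewrite mulrA v2.
have tvi := tame_inverse tv vi1 vV.
have thh : tame hh.
  apply: tameD (tameD (tameM (tn 4) (tameX 2 tu)) _) _.
    exact: tameM (tameD (tn 3) (tameM (tn 4) tt)) tu.
  exact: tameD (tameM (tn 3) tt) (tameM (tn 4) (tameX 2 tt)).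
have thi := tame_inverse thh hi1 hV.
have ti1 : tame i1 by apply: tame_inverse i11 i1V; exact: tameD.
have ti2 : tame i2.
  by apply: tame_inverse i21 i2V; apply: tameD => //; exact: tameX.
have tri : tame ri by exact: tame_cst.
have tg : tame g by exact: tameM (tameM (tameM tri (tameX 2 tPhi)) tvi) thi.
pose q := ri * (2 * Phi * (3 + 6 * u + 6 * u ^+ 2) * i1 ^+ 2 * i2 ^+ 3 -
    2 * Phi ^+ 2 * i1 ^+ 3 * i2 ^+ 3 - 6 * u * Phi ^+ 2 * i1 ^+ 2 * i2 ^+ 4).
have tq : tame q.
  apply: tameM tri _; apply: tameD (tameD _ (tameN _)) (tameN _).
  - apply: tameM (tameM (tameM (tameM (tn 2) tPhi) _) (tameX 2 ti1)) (tameX 3 ti2).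
    exact: tameD (tameD (tn 3) (tameM (tn 6) tu)) (tameM (tn 6) (tameX 2 tu)).
  - exact: tameM (tameM (tameM (tn 2) (tameX 2 tPhi)) (tameX 3 ti1)) (tameX 3 ti2).
  - exact: tameM (tameM (tameM (tameM (tn 6) tu) (tameX 2 tPhi)) (tameX 2 ti1)) (tameX 4 ti2).
have vq : value q (rho^-1 * (2 * P0 * (3 + 6 * tau + 6 * tau ^+ 2) *
    (1 + tau)^-1 ^+ 2 * (1 + tau ^+ 2)^-1 ^+ 3 -
    2 * P0 ^+ 2 * (1 + tau)^-1 ^+ 3 * (1 + tau ^+ 2)^-1 ^+ 3 -
    6 * tau * P0 ^+ 2 * (1 + tau)^-1 ^+ 2 * (1 + tau ^+ 2)^-1 ^+ 4)).
  apply: valueM vri _; apply: valueD (valueD _ (valueN _)) (valueN _).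
  - apply: valueM (valueM (valueM (valueM v2n vP) _) (valueX 2 vi1')) (valueX 3 vi2').
    exact: valueD (valueD v3n (valueM v6n vu)) (valueM v6n (valueX 2 vu)).
  - exact: valueM (valueM (valueM v2n (valueX 2 vP)) (valueX 3 vi1')) (valueX 3 vi2').
  - exact: valueM (valueM (valueM (valueM v6n vu) (valueX 2 vP)) (valueX 2 vi1')) (valueX 4 vi2').
have [_ <-] := valueM vq vg.
have ddb : fps_deriv (fps_deriv b) = isqrt R * (q * g).
  by rewrite (b_deriv2 i1V i2V) -/q du -/g; ring.
have := tame_transfer (tameM tq tg); rewrite -ddb.
by rewrite /fps_deriv.
Qed.

End Singularity.

(** * Numerical constants *)

(* With [x^3 = 9 + 6 sqrt 3] the number [d = x - 3 / x] is a root of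
   [d^3 + 9 d - 18] and the growth rate is [3 / (2 - d)]. *)
Lemma tau_exists (R : realType) : exists2 tau : R,
  4 * tau ^+ 3 + 3 * tau ^+ 2 = 1 &
  0 < tau /\ growth312 R = 3 + 6 * tau + 6 * tau ^+ 2.
Proof.
pose r3 : R := Num.sqrt 3; pose c : R := 9 + 6 * r3; pose x := c `^ (1 / 3).
have r3_ge0 : 0 <= r3 by exact: sqrtr_ge0.
have r32 : r3 ^+ 2 = 3 by rewrite sqr_sqrtr.
have c_gt0 : 0 < c by rewrite /c; lra.
have x_gt0 : 0 < x by rewrite powR_gt0.
have x3 : x ^+ 3 = c.
  by rewrite -powR_mulrn ?powR_ge0 // -powRrM div1r mulVf ?pnatr_eq0 // powRr1 // ltW.
have x2 : c `^ (2 / 3) = x ^+ 2.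
  by rewrite -[RHS]powR_mulrn ?powR_ge0 // -powRrM div1r mulrC.
have gE : growth312 R = 3 * x / (3 + 2 * x - x ^+ 2) by rewrite -x2.
pose d := x - 3 / x.
have xd : x * d = x ^+ 2 - 3 by rewrite /d; field; rewrite gt_eqF.
have d3 : d ^+ 3 + 9 * d = 18.
  have : x ^+ 3 * (d ^+ 3 + 9 * d - 18) = 0.
    transitivity ((x * d) ^+ 3 + 9 * x ^+ 2 * (x * d) - 18 * x ^+ 3); first by ring.
    rewrite xd; transitivity ((x ^+ 3) ^+ 2 - 18 * x ^+ 3 - 27); first by ring.
    rewrite x3 /c; transitivity (36 * (r3 ^+ 2 - 3)); first by ring.
    by rewrite r32 subrr mulr0.
  by move/eqP; rewrite mulf_eq0 expf_eq0 /= gt_eqF //= subr_eq0 => /eqP.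
(* Squaring [d^3 + 9 d = 18] gives a cubic equation for [d^2]; this affine function of [d^2] turns
   it into the equation of [tau]. *)
pose tau := (3 + d ^+ 2) / 12; exists tau.
  apply/eqP; rewrite -subr_eq0; apply/eqP.
  transitivity ((d ^+ 3 + 9 * d - 18) * (d ^+ 3 + 9 * d + 18) / 432).
    by rewrite /tau; field.
  by rewrite d3 subrr !mul0r.
split; first by rewrite /tau divr_gt0 // ltr_wpDr ?sqr_ge0.
have dtau : (2 - d) * (3 + 6 * tau + 6 * tau ^+ 2) = 3.
  apply/eqP; rewrite -subr_eq0; apply/eqP.
  transitivity ((d ^+ 3 + 9 * d - 18) * (- d ^+ 2 + 2 * d - 9) / 24).
    by rewrite /tau; field.
  by rewrite d3 subrr !mul0r.
rewrite gE; have -> : 3 + 2 * x - x ^+ 2 = x * (2 - d) by rewrite mulrBr xd; ring.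
have d2 : 2 - d != 0.
  by apply/eqP => d20; move: dtau; rewrite d20 mul0r; lra.
have x0 : x != 0 by rewrite gt_eqF.
rewrite -{1}dtau; field; rewrite ?d2 ?x0 //.
Qed.

Section Bounds.
Variables (R : realType) (tau : R).
Hypothesis tauE : 4 * tau ^+ 3 + 3 * tau ^+ 2 = 1.
Hypothesis tau_gt0 : 0 < tau.

Lemma tau_gt (l : R) : 0 <= l -> 4 * l ^+ 3 + 3 * l ^+ 2 < 1 -> l < tau.
Proof.
move=> l0 l_lt; rewrite ltNge; apply/negP => tl; have t0 := ltW tau_gt0.
have := lerXn2r 2 t0 l0 tl; have := lerXn2r 3 t0 l0 tl.
have := tauE; lra.
Qed.

Lemma tau_lt (l : R) : 0 <= l -> 1 < 4 * l ^+ 3 + 3 * l ^+ 2 -> tau < l.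
Proof.
move=> l0 l_lt; rewrite ltNge; apply/negP => tl; have t0 := ltW tau_gt0.
have := lerXn2r 2 l0 t0 tl; have := lerXn2r 3 l0 t0 tl.
have := tauE; lra.
Qed.

Lemma tau_bounds : 455 / 10 ^+ 3 + 410 / 10 ^+ 6 < tau < 455 / 10 ^+ 3 + 410 / 10 ^+ 6 + 1 / 10 ^+ 7.
Proof.
apply/andP; split; first by apply: tau_gt; lra.
by apply: tau_lt; lra.
Qed.

Lemma rho_bounds :
  `|3 + 6 * tau + 6 * tau ^+ 2 - (6 + 976 / 10 ^+ 3 + 85 / 10 ^+ 5)| <= 5 / 10 ^+ 6.
Proof.
have /andP[lo hi] := tau_bounds; rewrite ler_norml; apply/andP; split; nra.
Qed.

End Bounds.

(** * Wallis' product with two-sided bounds *)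

Section Wallis.
Variable R : realType.

Lemma cbin_ratio n : cbin R n.+1 = (n%:R + 2^-1) / (n%:R + 1) * cbin R n.
Proof. by rewrite /= -[n.+1]addn1 natrD mulrC. Qed.

(** The weights come from the expansion [1 / (pi cbin(n)^2) = n + 1/4 + 1/(32 n) - ...]: cut after
    two terms it yields a sequence increasing to [1 / pi], after three terms the decreasing [k]. *)
Let g n : R := (n%:R + 1 / 4) * cbin R n ^+ 2.
Let k n : R := (n%:R + 1 / 4 + 1 / (32 * n%:R)) * cbin R n ^+ 2.

Lemma wallis_lower_mono n : g n <= g n.+1.
Proof.
rewrite /g cbin_ratio -[n.+1]addn1 natrD -subr_ge0; set m := n%:R; set c := cbin R n.
have m0 : 0 <= m by exact: ler0n.
have -> : (m + 1 + 1 / 4) * ((m + 2^-1) / (m + 1) * c) ^+ 2 - (m + 1 / 4) * c ^+ 2 =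
    c ^+ 2 / (16 * (m + 1) ^+ 2) by field; lra.
by rewrite divr_ge0 ?sqr_ge0 // mulr_ge0 ?sqr_ge0.
Qed.

(** At [n = 0] the inverse of [32 n] is 0 by convention, and [k 0 = 1/4] lies below [k 1]. *)
Lemma wallis_upper_mono n : (0 < n)%N -> k n.+1 <= k n.
Proof.
move=> n_gt0; rewrite /k cbin_ratio -[n.+1]addn1 natrD -subr_ge0.
have : 0 < n%:R :> R by rewrite ltr0n.
set m := n%:R; set c := cbin R n => m0.
have -> : (m + 1 / 4 + 1 / (32 * m)) * c ^+ 2 -
    (m + 1 + 1 / 4 + 1 / (32 * (m + 1))) * ((m + 2^-1) / (m + 1) * c) ^+ 2 =
    (3 / 4 * m + 1) * c ^+ 2 / (32 * m * (m + 1) ^+ 3) by field; lra.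
apply: divr_ge0; first by apply: mulr_ge0; [lra | exact: sqr_ge0].
by apply: mulr_ge0; [lra | apply: exprn_ge0; lra].
Qed.

Lemma wallis_lower_le m n : (m <= n)%N -> g m <= g n.
Proof.
move=> /subnK <-; elim: (n - m)%N => // d IH.
exact: le_trans IH (wallis_lower_mono _).
Qed.

Lemma wallis_upper_le m n : (0 < m)%N -> (m <= n)%N -> k n <= k m.
Proof.
move=> m0 /subnK <-; elim: (n - m)%N => // d IH.
by apply: le_trans (wallis_upper_mono _) IH; rewrite addn_gt0 m0 orbT.
Qed.

Lemma wallis_le n : g n <= k n.
Proof. by apply: ler_wpM2r; [exact: sqr_ge0 | rewrite lerDl divr_ge0 // mulr_ge0]. Qed.

Lemma cbin_sqr_cvg : cbin R n ^+ 2 @[n --> \oo] --> 0.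
Proof.
have bnd n : cbin R n ^+ 2 <= n.+1%:R^-1.
  have h_le : (n%:R + 2^-1) * cbin R n ^+ 2 <= 2^-1.
    elim: n => [|n]; first by rewrite add0r expr1n mulr1.
    apply: le_trans; rewrite cbin_ratio -[n.+1]addn1 natrD -subr_ge0.
    set m := n%:R; set c := cbin R n; have m0 : 0 <= m by exact: ler0n.
    have -> : (m + 2^-1) * c ^+ 2 - (m + 1 + 2^-1) * ((m + 2^-1) / (m + 1) * c) ^+ 2 =
      (m + 2^-1) * c ^+ 2 / (4 * (m + 1) ^+ 2) by field; lra.
    apply: divr_ge0; first by apply: mulr_ge0; [lra | exact: sqr_ge0].
    by apply: mulr_ge0 => //; exact: sqr_ge0.
  rewrite -[leRHS]mul1r ler_pdivlMr ?ltr0n // -[n.+1]addn1 natrD mulrC.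
  have := ler0n R n; have := sqr_ge0 (cbin R n); nra.
apply: (squeeze_cvgr _ (cvg_cst 0) (@cvg_harmonic R)).
by apply: nearW => n; rewrite sqr_ge0 bnd.
Qed.

Lemma wallis : exists c : R, [/\ 0 < c, cbin R n * Num.sqrt n%:R @[n --> \oo] --> c,
  318 / 10 ^+ 3 + 26 / 10 ^+ 5 <= c ^+ 2 & c ^+ 2 <= 318 / 10 ^+ 3 + 32 / 10 ^+ 5].
Proof.
have g_cvg : cvgn g.
  apply: nondecreasing_is_cvgn; first by move=> m n; exact: wallis_lower_le.
  exists (k 1) => _ [n _ <-]; case: n => [|n].
    exact: le_trans (wallis_lower_le (leq0n 1)) (wallis_le 1).
  exact: le_trans (wallis_le _) (wallis_upper_le _ _).
set C := limn g in g_cvg.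
(* The limit is [1 / pi]; the index 16 already separates it to the digits required. *)
have C_lo : 318 / 10 ^+ 3 + 26 / 10 ^+ 5 <= C.
  apply: (@le_trans _ _ (g 16)); first by rewrite /g /=; lra.
  by apply: nondecreasing_cvgn_le => // m n; exact: wallis_lower_le.
have C_hi : C <= 318 / 10 ^+ 3 + 32 / 10 ^+ 5.
  apply: (@le_trans _ _ (k 16)); last by rewrite /k /=; lra.
  apply: limr_le => //; near=> n; apply: le_trans (wallis_le n) _.
  by apply: wallis_upper_le => //; near: n; exact: nbhs_infty_ge.
have C_gt0 : 0 < C by apply: lt_le_trans C_lo; lra.
exists (Num.sqrt C); rewrite sqr_sqrtr ?(ltW C_gt0) // sqrtr_gt0; split=> //.
have -> : (fun n => cbin R n * Num.sqrt n%:R) =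
    Num.sqrt \o (fun n => g n - 1 / 4 * cbin R n ^+ 2).
  apply/funext => n /=; have -> : g n - 1 / 4 * cbin R n ^+ 2 = cbin R n ^+ 2 * n%:R.
    by rewrite /g; ring.
  by rewrite sqrtrM ?sqr_ge0 // sqrtr_sqr gtr0_norm ?cbin_gt0.
apply: continuous_cvg; first exact: sqrt_continuous.
rewrite -[C]subr0 -[X in _ --> _ - X](mulr0 (1 / 4)); apply: cvgB => //.
by apply: cvgM; [exact: cvg_cst | exact: cbin_sqr_cvg].
Unshelve. all: by end_near. Qed.

End Wallis.

(** * Interval enclosure of the transfer constant *)

Lemma itv_mul (R : realType) (a b c d x y l h : R) : a <= x <= b -> c <= y <= d ->
  0 <= a -> 0 <= c -> l <= a * c -> b * d <= h -> l <= x * y <= h.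
Proof.
move=> /andP[ax xb] /andP[cy yd] a0 c0 l_le h_ge; apply/andP; split.
  by apply: le_trans l_le _; exact: ler_pM.
apply: le_trans h_ge; apply: ler_pM => //; first exact: le_trans a0 ax.
exact: le_trans c0 cy.
Qed.

Lemma itv_inv (R : realType) (a b x : R) :
  0 < x -> a * x <= 1 <= b * x -> a <= x^-1 <= b.
Proof. by move=> x0; rewrite -[x^-1]mul1r ler_pdivlMr // ler_pdivrMr. Qed.

Section TransferConstant.
Variables (R : realType) (tau V : R).
Hypothesis tauE : 4 * tau ^+ 3 + 3 * tau ^+ 2 = 1.
Hypothesis tau_gt0 : 0 < tau.

Let rho : R := 3 + 6 * tau + 6 * tau ^+ 2.
Let h0 : R := 4 * tau ^+ 2 + (3 + 4 * tau) * tau + (3 * tau + 4 * tau ^+ 2).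
Let P0 : R := (1 + 2 * tau) * (1 + tau + tau ^+ 2).

Hypothesis V_gt0 : 0 < V.
Hypothesis VE : V ^+ 2 * (2 * tau + 3 + 4 * tau) = P0.

Definition kappa : R :=
  rho^-1 * (2 * P0 * (3 + 6 * tau + 6 * tau ^+ 2) * (1 + tau)^-1 ^+ 2 * (1 + tau ^+ 2)^-1 ^+ 3 -
    2 * P0 ^+ 2 * (1 + tau)^-1 ^+ 3 * (1 + tau ^+ 2)^-1 ^+ 3 -
    6 * tau * P0 ^+ 2 * (1 + tau)^-1 ^+ 2 * (1 + tau ^+ 2)^-1 ^+ 4) *
  (rho^-1 * P0 ^+ 2 * V^-1 * h0^-1).

(** A form fit for interval arithmetic: [P0 = rho tau] and [h0 = 6 tau (1 + 2 tau)] make [rho]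
    cancel, and what remains are products of positive terms with a single difference. *)
Lemma kappaE : kappa * (3 * (V * (1 + 2 * tau))) = P0 * P0 * ((1 + tau)^-1 * (1 + tau)^-1 *
    ((1 + tau ^+ 2)^-1 * (1 + tau ^+ 2)^-1 * (1 + tau ^+ 2)^-1)) *
    ((1 + tau)^-1 - 3 * (tau * tau * (1 + tau ^+ 2)^-1)).
Proof.
set a1 := (1 + tau)^-1; set a2 := (1 + tau ^+ 2)^-1.
have rho0 : rho != 0 by rewrite /rho gt_eqF //; have := tau_gt0; nra.
have t0 : tau != 0 by rewrite gt_eqF.
have V0 : V != 0 by rewrite gt_eqF.
have s0 : 1 + 2 * tau != 0 by rewrite gt_eqF //; have := tau_gt0; lra.
have a1E : (1 + tau) * a1 = 1.
  by rewrite mulfV // gt_eqF //; have := tau_gt0; lra.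
have P0E : P0 = rho * tau by rewrite /P0 /rho; move: tauE; lra.
have h0E : h0 = 6 * tau * (1 + 2 * tau) by rewrite /h0; ring.
rewrite /kappa -/rho -/a1 -/a2 h0E P0E.
clearbody rho a1 a2.
transitivity (rho ^+ 2 * tau ^+ 2 * (a1 ^+ 2 * a2 ^+ 3) * (1 - tau * a1 - 3 * tau ^+ 2 * a2)).
  by field; rewrite rho0 t0 V0 s0.
have -> : 1 - tau * a1 = a1 by rewrite -a1E; ring.
by ring.
Qed.

Lemma V_compare : (forall l : R, 0 < l -> l * l * (3 + 6 * tau) < P0 -> l <= V) /\
  (forall l : R, 0 < l -> P0 < l * l * (3 + 6 * tau) -> V <= l).
Proof.
have t0 := tau_gt0; have V0 := V_gt0.
have V2 : V * V * (3 + 6 * tau) = P0 by rewrite -VE; ring.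
split=> l l0 l_lt; rewrite leNgt; apply/negP => V_lt; move: l_lt; rewrite -V2;
  apply/negP; rewrite -leNgt; apply: ler_wpM2r; try lra.
  by apply: ler_pM; rewrite ?ltW.
by apply: ler_pM; rewrite ?ltW.
Qed.

End TransferConstant.

(** Each subterm is enclosed to about six decimals and then treated as an atom, so that only linear
    goals and comparisons of numerals arise; [V] is enclosed through its square. *)
Lemma kappa_bounds (R : realType) (tau V : R) :
  4 * tau ^+ 3 + 3 * tau ^+ 2 = 1 -> 0 < tau -> 0 < V ->
  V ^+ 2 * (2 * tau + 3 + 4 * tau) = (1 + 2 * tau) * (1 + tau + tau ^+ 2) ->
  1089 / 10 ^+ 4 + 7 / 10 ^+ 5 <= kappa tau V <= 1089 / 10 ^+ 4 + 9 / 10 ^+ 5.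
Proof.
move=> tauE t0 V0 VE; have := kappaE tauE t0 V0; have := V_compare t0 V0 VE.
set P0 := (1 + 2 * tau) * (1 + tau + tau ^+ 2).
set a1 := (1 + tau)^-1; set a2 := (1 + tau ^+ 2)^-1 => V_compare KE.
have P0E : P0 = 1 + 3 * tau + 3 * (tau * tau) + 2 * (tau * tau * tau) by rewrite /P0; ring.
have t_itv : 455 / 10 ^+ 3 + 410 / 10 ^+ 6 <= tau <= 455 / 10 ^+ 3 + 411 / 10 ^+ 6.
  have /andP[] := tau_bounds tauE t0; clear => ? ?; apply/andP; split; lra.
clearbody P0.
have t2_itv : 207 / 10 ^+ 3 + 398 / 10 ^+ 6 <= tau * tau <= 207 / 10 ^+ 3 + 400 / 10 ^+ 6.
  by apply: (itv_mul t_itv t_itv); clear; lra.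
have t3_itv : 94 / 10 ^+ 3 + 451 / 10 ^+ 6 <= tau * tau * tau <= 94 / 10 ^+ 3 + 453 / 10 ^+ 6.
  by apply: (itv_mul t2_itv t_itv); clear; lra.
have P_itv : 3 + 177 / 10 ^+ 3 + 326 / 10 ^+ 6 <= P0 <= 3 + 177 / 10 ^+ 3 + 339 / 10 ^+ 6.
  rewrite P0E; move: t_itv t2_itv t3_itv; set t2 := tau * tau; set t3 := t2 * tau; clear.
  by move=> /andP[? ?] /andP[? ?] /andP[? ?]; apply/andP; split; lra.
have a1_itv : 687 / 10 ^+ 3 + 91 / 10 ^+ 6 <= a1 <= 687 / 10 ^+ 3 + 92 / 10 ^+ 6.
  by move: t_itv => /andP[]; clear => ? ?; apply: itv_inv; [lra | apply/andP; split; lra].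
have a2_itv : 828 / 10 ^+ 3 + 225 / 10 ^+ 6 <= a2 <= 828 / 10 ^+ 3 + 228 / 10 ^+ 6.
  move: t2_itv => /andP[]; rewrite /a2 expr2; set t2 := tau * tau; clear => ? ?.
  by apply: itv_inv; [lra | apply/andP; split; lra].
have q_itv : 171 / 10 ^+ 3 + 772 / 10 ^+ 6 <= tau * tau * a2 <= 171 / 10 ^+ 3 + 775 / 10 ^+ 6.
  by apply: (itv_mul t2_itv a2_itv); clear; lra.
have B_itv : 171 / 10 ^+ 3 + 766 / 10 ^+ 6 <= a1 - 3 * (tau * tau * a2) <=
  171 / 10 ^+ 3 + 776 / 10 ^+ 6.
  move: a1_itv q_itv => /andP[+ +] /andP[]; set q := tau * tau * a2; clearbody a1 q; clear.
  by move=> ? ? ? ?; apply/andP; split; lra.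
have p_itv : 472 / 10 ^+ 3 + 94 / 10 ^+ 6 <= a1 * a1 <= 472 / 10 ^+ 3 + 96 / 10 ^+ 6.
  by apply: (itv_mul a1_itv a1_itv); clear; lra.
have r_itv : 685 / 10 ^+ 3 + 956 / 10 ^+ 6 <= a2 * a2 <= 685 / 10 ^+ 3 + 962 / 10 ^+ 6.
  by apply: (itv_mul a2_itv a2_itv); clear; lra.
have s_itv : 568 / 10 ^+ 3 + 125 / 10 ^+ 6 <= a2 * a2 * a2 <= 568 / 10 ^+ 3 + 133 / 10 ^+ 6.
  by apply: (itv_mul r_itv a2_itv); clear; lra.
have w_itv : 268 / 10 ^+ 3 + 208 / 10 ^+ 6 <= a1 * a1 * (a2 * a2 * a2) <=
  268 / 10 ^+ 3 + 214 / 10 ^+ 6.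
  by apply: (itv_mul p_itv s_itv); clear; lra.
have PP_itv : 10 + 95 / 10 ^+ 3 + 400 / 10 ^+ 6 <= P0 * P0 <= 10 + 95 / 10 ^+ 3 + 484 / 10 ^+ 6.
  by apply: (itv_mul P_itv P_itv); clear; lra.
have x_itv : 2 + 707 / 10 ^+ 3 + 667 / 10 ^+ 6 <=
  P0 * P0 * (a1 * a1 * (a2 * a2 * a2)) <= 2 + 707 / 10 ^+ 3 + 751 / 10 ^+ 6.
  by apply: (itv_mul PP_itv w_itv); clear; lra.
have y_itv : 465 / 10 ^+ 3 + 85 / 10 ^+ 6 <=
  P0 * P0 * (a1 * a1 * (a2 * a2 * a2)) * (a1 - 3 * (tau * tau * a2)) <=
  465 / 10 ^+ 3 + 127 / 10 ^+ 6.
  by apply: (itv_mul x_itv B_itv); clear; lra.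
have V_itv : 744 / 10 ^+ 3 + 491 / 10 ^+ 6 <= V <= 744 / 10 ^+ 3 + 496 / 10 ^+ 6.
  have [VV VV'] := V_compare; move: t_itv P_itv => /andP[] + + /andP[].
  move: VV VV'; clear => VV VV' ? ? ? ?.
  by apply/andP; split; [apply: VV | apply: VV']; lra.
have sz_itv : 1 + 2 * (455 / 10 ^+ 3 + 410 / 10 ^+ 6) <= 1 + 2 * tau <=
  1 + 2 * (455 / 10 ^+ 3 + 411 / 10 ^+ 6).
  by move: t_itv => /andP[]; clear => ? ?; apply/andP; split; lra.
have z_itv : 1 + 422 / 10 ^+ 3 + 588 / 10 ^+ 6 <= V * (1 + 2 * tau) <=
  1 + 422 / 10 ^+ 3 + 600 / 10 ^+ 6.
  by apply: (itv_mul V_itv sz_itv); clear; lra.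
move: y_itv z_itv; rewrite -KE; set z := V * (1 + 2 * tau); set k := kappa tau V; clear.
move=> /andP[y_lo y_hi] /andP[z_lo z_hi]; have z_gt0 : 0 < z by lra.
by apply/andP; split; rewrite -(ler_pM2r z_gt0); lra.
Qed.

(** * Asymptotics *)

Lemma cvg_sqrt1 (R : realType) (f : nat -> R) : f @ \oo --> (0 : R) ->
  Num.sqrt (1 + f n) @[n --> \oo] --> (1 : R).
Proof.
move=> f0; rewrite -[X in _ --> X]sqrtr1; apply: continuous_cvg; first exact: sqrt_continuous.
by rewrite -[X in _ --> X]addr0; apply: cvgD f0; exact: cvg_cst.
Qed.

Lemma genfun312_cvg (R : realType) : exists delta : R, [/\ 0 < delta,
  `|delta - (61 / 10 ^+ 3 + 518 / 10 ^+ 6)| <= 5 / 10 ^+ 5 &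
  #|avoiding_partitions n perm312|%:R / growth312 R ^+ n * (n%:R ^+ 2 * Num.sqrt n%:R)
    @[n --> \oo] --> delta].
Proof.
have [tau tauE [tau_gt0 growthE]] := tau_exists R.
set rho := growth312 R in growthE *.
have /andP[t_lo t_hi] := tau_bounds tauE tau_gt0.
have lo : 455 / 1000 < tau by clear -t_lo; lra.
have hi : tau < 456 / 1000 by clear -t_hi; lra.
have [U UE BE] := genfun312_parametrization.
pose toR : {rmorphism int -> R} := intmul 1.
pose sigma : fps int -> fps R := fun f => fps_scale rho^-1 (fps_map toR f).
have sigmaD f g : sigma (f + g) = sigma f + sigma g by rewrite /sigma !rmorphD.
have sigmaM f g : sigma (f * g) = sigma f * sigma g by rewrite /sigma !rmorphM.
have sigma1 : sigma 1 = 1 by rewrite /sigma !rmorph1.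
have sigmaX : sigma fpsX = fps_cst rho^-1 * fpsX by rewrite /sigma fps_map_X fps_scale_X.
pose u := sigma U; pose b := sigma genfun312.
have uE : u = fps_cst rho^-1 * (fpsX * ((1 + 2 * u) * (1 + u + u ^+ 2))).
  by rewrite mulrA -sigmaX; move: (congr1 sigma UE); rewrite !expr2 !(sigmaM, sigmaD, sigma1).
have bE : b * ((1 + u) * (1 + u ^+ 2) ^+ 2) = (1 + u + u ^+ 3) * (1 + u + u ^+ 2).
  by move: (congr1 sigma BE); rewrite !exprS !expr0 !mulr1 !(sigmaM, sigmaD, sigma1).
have bnE n : b n = #|avoiding_partitions n perm312|%:R / rho ^+ n.
  by rewrite /b /sigma /fps_scale /fps_map /genfun312 /toR /= -pmulrn exprVn mulrC.
rewrite growthE in uE.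
have [V [V_gt0 VE b_cvg]] := b_transfer tauE lo hi uE bE.
rewrite -[X in _ --> X]/(kappa tau V) in b_cvg.
have [c [c_gt0 c_cvg c_lo c_hi]] := wallis R.
have := kappa_bounds tauE tau_gt0 V_gt0 VE.
set K := kappa tau V in b_cvg * => /andP[K_lo K_hi].
exists (K * c); split.
- by rewrite mulr_gt0 //; apply: lt_le_trans K_lo; clear; lra.
- have c_b : 564 / 10 ^+ 3 + 14 / 10 ^+ 5 <= c <= 564 / 10 ^+ 3 + 21 / 10 ^+ 5.
    clear -c_gt0 c_lo c_hi; apply/andP; split; rewrite leNgt; apply/negP => c_lt; nra.
  have : 61 / 10 ^+ 3 + 47 / 10 ^+ 5 <= K * c <= 61 / 10 ^+ 3 + 5 / 10 ^+ 4.
    by apply: (@itv_mul _ _ _ _ _ _ _ _ _ (introT andP (conj K_lo K_hi)) c_b); clear; lra.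
  move=> /andP[]; set x := K * c; clear => ? ?.
  by rewrite ler_norml; apply/andP; split; lra.
(* At index [n + 3] the square root of [n + 1] is a nonzero divisor. The last two factors of the
   product below correct [(n + 2)(n + 3) sqrt(n + 1)] to [(n + 3)^(5/2)]. *)
rewrite -(cvg_shiftn 3).
pose h : nat -> R := harmonic.
have lim_eq : K * c = K * c * (1 + 0) * 1 by ring.
rewrite lim_eq; have h_cvg : h @ \oo --> (0 : R) by exact: cvg_harmonic.
have hS_cvg : h n.+1 @[n --> \oo] --> (0 : R) by rewrite (cvg_shiftS h).
have h2_cvg : 2 * h n @[n --> \oo] --> (0 : R).
  by rewrite -[X in _ --> X](mulr0 2); apply: cvgM h_cvg; exact: cvg_cst.
have cvg_all : (n.+2%:R * (n.+3%:R * b n.+3)) / cbin R n.+1 *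
    (cbin R n.+1 * Num.sqrt n.+1%:R) * (1 + h n.+1) * Num.sqrt (1 + 2 * h n)
    @[n --> \oo] --> K * c * (1 + 0) * 1.
  apply: cvgM; last exact: cvg_sqrt1.
  apply: cvgM; last by apply: cvgD => //; exact: cvg_cst.
  apply: cvgM.
    by rewrite (cvg_shiftS (fun n => (n.+1%:R * (n.+2%:R * b n.+2)) / cbin R n)).
  by rewrite (cvg_shiftS (fun n => cbin R n * Num.sqrt n%:R)).
apply: cvg_trans cvg_all; apply: near_eq_cvg; apply: nearW => n.
rewrite [RHS]/= addn3 -bnE; set x := b n.+3.
have n1 : n.+1%:R != 0 :> R by rewrite pnatr_eq0.
have n2 : n.+2%:R != 0 :> R by rewrite pnatr_eq0.
have c1 : cbin R n.+1 != 0 by rewrite gt_eqF // cbin_gt0.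
have s1 : Num.sqrt n.+1%:R != 0 :> R by rewrite gt_eqF // sqrtr_gt0 ltr0n.
have -> : 1 + h n.+1 = n.+3%:R / n.+2%:R by rewrite -natr1 mulrDl divff // mul1r.
have -> : 1 + 2 * h n = n.+3%:R / n.+1%:R.
  by rewrite -[n.+3]addn2 natrD [RHS]mulrDl divff.
have -> : Num.sqrt (n.+3%:R / n.+1%:R) = Num.sqrt n.+3%:R / Num.sqrt n.+1%:R :> R.
  by rewrite sqrtrM ?ler0n // sqrtrV ?ler0n.
move: n1 n2 c1 s1; set p := n.+1%:R; set q := n.+2%:R; set r := n.+3%:R.
set y := cbin R n.+1; set s := Num.sqrt p; set w := Num.sqrt r.
by clearbody x p q r y s w; clear => _ q0 y0 s0; field; rewrite q0 y0 s0.
Qed.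

Lemma powRN52 (R : realType) (x : R) : 0 < x ->
  x `^ (- (5 / 2)) = (x ^+ 2 * Num.sqrt x)^-1.
Proof.
move=> x_gt0; rewrite powRN (_ : 5 / 2 = 2 + 2^-1 :> R); last by lra.
by rewrite powRD ?gt_eqF ?implybT // powR_mulrn ?powR12_sqrt // ltW.
Qed.

Theorem theorem4p2 (R : realType) :
  root (map_poly (@fps_of_poly int) cubic312) genfun312 /\
  `|growth312 R - (6 + 976 / 10 ^+ 3 + 85 / 10 ^+ 5)| <= 5 / 10 ^+ 6 /\
  exists delta : R,
    `|delta - (61 / 10 ^+ 3 + 518 / 10 ^+ 6)| <= 5 / 10 ^+ 5 /\
    (fun n : nat => #|avoiding_partitions n perm312|%:R : R) ~_\oo
    (fun n : nat => delta * n%:R `^ (- (5 / 2)) * growth312 R ^+ n).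
Proof.
have [tau tauE [tau_gt0 growthE]] := tau_exists R.
split; first exact: root_cubic312.
split; first by rewrite growthE; exact: rho_bounds.
have rho_gt0 : 0 < growth312 R.
  by rewrite growthE; move: tau_gt0; clear; move=> *; nra.
have [delta [delta_gt0 delta_bnd cvg_delta]] := genfun312_cvg R.
exists delta; split=> //; apply/eqaddoP => e e_gt0.
(* Equivalence bounds the error relative to a sequence that has [delta] as a factor, hence the
   tolerance [e * delta] for the quotient. *)
move/cvgrPdist_le: cvg_delta => /(_ (e * delta)); rewrite mulr_gt0 // => /(_ isT) near_delta.
near=> n.
have n_gt0 : 0 < n%:R :> R by rewrite ltr0n; near: n; exact: nbhs_infty_gt.
have : `|delta - #|avoiding_partitions n perm312|%:R / growth312 R ^+ n *
  (n%:R ^+ 2 * Num.sqrt n%:R)| <= e * delta by near: n.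
rewrite -[(_ - _) n]/(#|avoiding_partitions n perm312|%:R -
  delta * n%:R `^ (- (5 / 2)) * growth312 R ^+ n).
rewrite powRN52 //; set a := #|_|%:R; set q := n%:R ^+ 2 * _; set r := _ ^+ n.
have q_gt0 : 0 < q by rewrite mulr_gt0 ?exprn_gt0 ?sqrtr_gt0.
have r_gt0 : 0 < r by rewrite exprn_gt0.
rewrite distrC => le_delta.
have -> : a - delta * q^-1 * r = (a / r * q - delta) * (r / q).
  by move: q_gt0 r_gt0 => /lt0r_neq0 q0 /lt0r_neq0 r0; field; rewrite r0 q0.
rewrite normrM (gtr0_norm (divr_gt0 r_gt0 q_gt0)).
rewrite (_ : delta * q^-1 * r = delta * (r / q)); last by rewrite -mulrA (mulrC q^-1).
rewrite (gtr0_norm (mulr_gt0 delta_gt0 (divr_gt0 r_gt0 q_gt0))) (mulrA e delta).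
by rewrite ler_pM2r // divr_gt0.
Unshelve. all: by end_near.
Qed.
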